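(* Let $n$ be a positive integer, $\mathbf{g}=(g_0,\dots,g_{n-1})$ with $g_k\in H(\mathbb{D})$ for $0\leq k\leq n-1$, and $0<p\leq q<\infty$. Then (a) $I_{\mathbf{g}}^{(n)}:A^p\to A^q$ is bounded if and only if, for every $0\le k\le n-1$: $g_k\in\mathcal{B}^{0,\,n-k-\frac2p+\frac2q}$ when $n-k\geq\frac2p-\frac2q$, and $g_k\equiv0$ when $n-k<\frac2p-\frac2q$; (b) $I_{\mathbf{g}}^{(n)}:A^p\to A^q$ is compact if and only if, for every $0\le k\le n-1$: $g_k\in\mathcal{B}_0^{0,\,n-k-\frac2p+\frac2q}$ when $n-k>\frac2p-\frac2q$, and $g_k\equiv0$ when $n-k\leq\frac2p-\frac2q$.
   Context: $\mathbb{D}$ is the open unit disc, $H(\mathbb{D})$ the analytic functions on $\mathbb{D}$, $dA=\frac{dx\,dy}{\pi}$, and $A^p=\{f\in H(\mathbb{D}):\int_{\mathbb{D}}|f|^p\,dA<\infty\}$ is the Bergman space. $I$ is the integration operator $(If)(z)=\int_0^zf(w)\,dw$ and $I^n$ its $n$-th iterate; $I_{\mathbf{g}}^{(n)}f=I^n\big(fg_0+f'g_1+\cdots+f^{(n-1)}g_{n-1}\big)$. For an integer $m\geq0$ and real $\alpha\geq0$, $\mathcal{B}^{m,\alpha}=\{f\in H(\mathbb{D}):\sup_{z\in\mathbb{D}}|f^{(m)}(z)|(1-|z|^2)^\alpha<\infty\}$ and $\mathcal{B}_0^{m,\alpha}=\{f\in H(\mathbb{D}):\lim_{|z|\to1^-}|f^{(m)}(z)|(1-|z|^2)^\alpha=0\}$.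 *)

(* Defs.v *)
From HB Require Import structures.
From mathcomp Require Import all_boot all_order all_algebra.
From mathcomp Require Import all_classical all_reals all_analysis.
From mathcomp Require Import complex.
Set Implicit Arguments. Unset Strict Implicit. Unset Printing Implicit Defensive.
Import Order.TTheory GRing.Theory Num.Theory.
Import numFieldNormedType.Exports.
Local Open Scope classical_set_scope.
Local Open Scope ring_scope.
Local Open Scope complex_scope.

Section Defs.
Variable R : realType.
Local Notation C := R[i].

Definition cre (z : C) : R := let: a +i* _ := z in a.
Definition cim (z : C) : R := let: _ +i* b := z in b.

Definition cabs (z : C) : R := Num.sqrt (cre z ^+ 2 + cim z ^+ 2).

Definition disc : set C := [set z | cabs z < 1].

Definition has_cderiv (f : C -> C) (z l : C) : Prop :=
  forall e : R, 0 < e -> exists2 d : R, 0 < d &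
    forall h : C, h != 0 -> cabs h < d -> cabs ((f (z + h) - f z) / h - l) < e.

(* the complex derivative (chosen; 0 where it does not exist) *)
Definition cderiv (f : C -> C) : C -> C :=
  fun z => xget 0 [set l | has_cderiv f z l].

Definition cderivn (k : nat) (f : C -> C) : C -> C := iter k cderiv f.

Definition analytic (f : C -> C) : Prop :=
  forall z, disc z -> exists l, has_cderiv f z l.

Definition area_int (F : C -> R) : \bar R :=
  ((\int[(@lebesgue_measure R \x @lebesgue_measure R)%E]_(xy in
        [set xy : R * R | (xy.1 ^+ 2 + xy.2 ^+ 2 < 1)%R])
      (F (xy.1 +i* xy.2)%C)%:E) * (pi^-1)%:E)%E.

Definition Bergman (p : R) (f : C -> C) : Prop :=
  analytic f /\ (area_int (fun z => (cabs (f z) `^ p)%R) < +oo)%E.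

Definition Bnorm (p : R) (f : C -> C) : R :=
  (fine (area_int (fun z => cabs (f z) `^ p))) `^ p^-1.

Definition cint01 (h : R -> C) : C :=
  (\int[@lebesgue_measure R]_(t in `[0, 1]) cre (h t))%R
  +i* (\int[@lebesgue_measure R]_(t in `[0, 1]) cim (h t))%R.

(* (I f)(z) = int_0^z f(w) dw, along the segment [0,z] *)
Definition Iop (f : C -> C) : C -> C :=
  fun z => z * cint01 (fun t => f (t%:C * z)).

Definition Ig (n : nat) (g : 'I_n -> C -> C) (f : C -> C) : C -> C :=
  iter n Iop (fun z => \sum_(k < n) cderivn k f z * g k z).

Definition bounded_op (p q : R) (T : (C -> C) -> (C -> C)) : Prop :=
  exists c : R, forall f, Bergman p f ->
    Bergman q (T f) /\ Bnorm q (T f) <= c * Bnorm p f.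

Definition compact_op (p q : R) (T : (C -> C) -> (C -> C)) : Prop :=
  (forall f, Bergman p f -> Bergman q (T f)) /\
  forall u : nat -> C -> C, (forall j, Bergman p (u j)) ->
    (exists M : R, forall j, Bnorm p (u j) <= M) ->
    exists (phi : nat -> nat) (h : C -> C),
      {homo phi : i j / (i < j)%N} /\ Bergman q h /\
      (fun j => Bnorm q (fun z => T (u (phi j)) z - h z)) @ \oo --> (0 : R).

Definition bloch (alpha : R) (f : C -> C) : Prop :=
  analytic f /\ exists M : R, forall z, disc z ->
    cabs (f z) * (1 - cabs z ^+ 2) `^ alpha <= M.

Definition little_bloch (alpha : R) (f : C -> C) : Prop :=
  analytic f /\ forall e : R, 0 < e -> exists2 r : R, r < 1 &
    forall z, disc z -> r < cabs z -> cabs (f z) * (1 - cabs z ^+ 2) `^ alpha < e.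

End Defs.

(* Main.v *)
(** Write d(z) = 1 - |z| and a_k = n - k - 2/p + 2/q; the conditions on g_k say that
    |g_k| d^(a_k) is bounded, respectively tends to 0 at the boundary.

    Sufficiency. The n-th derivative of F = I_g f is H = sum_k f^(k) g_k. A subharmonicity
    argument bounds |f^(k)(w)|^p d(w)^(kp + 2) by the integral of |f|^p over the disc of radius
    d(w)/2 around w, hence |H(w)|^q d(w)^(nq + 2) by a constant times that integral. Integrating
    H n times along [0, z] bounds |F(z)|^q by d(z)^(-1/2) times the integral of
    |f(u)|^p d(u)^(-3/2) over the cone |z - u| <= 3 d(u), and Tonelli's theorem finishes the
    proof. For compactness one extracts a locally uniformly convergent subsequence and splits
    the disc into |w| <= r, where the differences of H are small, and |w| > r, where
    |g_k| d^(a_k) is small.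

    Necessity. Test on the j-th power of the disc automorphism vanishing at a, times a
    normalized kernel function at a. Its derivatives of order less than j vanish at a, so
    evaluating H at a bounds |g_j(a)| d(a)^(a_j) by the norm of the image plus the terms with
    k > j, and one concludes by descending induction on j. If the exponent a_k is negative (or
    zero, in the compact case), g_k tends to 0 at the boundary and hence vanishes. *)
Require Import Defs.
From HB Require Import structures.
From mathcomp Require Import all_boot all_order all_algebra.
From mathcomp Require Import all_classical all_reals all_analysis.
From mathcomp Require Import complex.
From mathcomp Require Import measurable_realfun ring lra.
Import Order.TTheory GRing.Theory Num.Theory.
Import numFieldNormedType.Exports.
Set Implicit Arguments. Unset Strict Implicit. Unset Printing Implicit Defensive.
Local Open Scope classical_set_scope.
Local Open Scope ring_scope.

(** * Complex derivatives *)

(** Since p and q may be less than 1, the norms need not satisfy a triangle inequality, and neither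
    duality nor Minkowski's inequality is available; every estimate is a pointwise bound followed by
    one exchange of integrals. This dictates the exponents. The n integrations may lose a factor
    d^(-1/(2q)), since its q-th power d^(-1/2) is integrable over the disc; integrated over the
    points whose cone contains u it gives a multiple of d(u)^(3/2), which the weight d(u)^(-3/2)
    cancels. The hypothesis p <= q enters sufficiency when the local bound is raised to the power
    q/p >= 1: the integral I of |f|^p over a small disc satisfies I^(q/p) <= E^(q/p - 1) I, where E
    bounds the integral over the whole disc, so the estimate stays linear in I and Tonelli's theorem
    applies. Constants are never sharp: complex quantities are often estimated through their real
    and imaginary parts, at the price of factors 2. Contour integrals occur only over rectangles,
    which the exponential map turns into annuli, and areas are bounded by slicing. *)

Section ComplexDerivatives.
Variable R : realType.
Local Notation C := R[i].
Implicit Types (f g : C -> C) (z w : C).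

Lemma creD z w : cre (z + w) = cre z + cre w. Proof. by case: z; case: w. Qed.

Lemma cimD z w : cim (z + w) = cim z + cim w. Proof. by case: z; case: w. Qed.

Lemma creN z : cre (- z) = - cre z. Proof. by case: z. Qed.

Lemma cimN z : cim (- z) = - cim z. Proof. by case: z. Qed.

Lemma creB z w : cre (z - w) = cre z - cre w. Proof. by rewrite creD creN. Qed.

Lemma cimB z w : cim (z - w) = cim z - cim w. Proof. by rewrite cimD cimN. Qed.

Lemma creM z w : cre (z * w) = cre z * cre w - cim z * cim w.
Proof. by case: z; case: w. Qed.

Lemma cimM z w : cim (z * w) = cre z * cim w + cim z * cre w.
Proof. by case: z => x y; case: w. Qed.

Lemma cabsE z : cabs z = Normc.normc z. Proof. by case: z. Qed.

Lemma cabs_norm z : `|z| = (cabs z)%:C%C. Proof. by rewrite cabsE. Qed.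

Lemma cabs_ge0 z : 0 <= cabs z. Proof. exact: sqrtr_ge0. Qed.

Lemma cabsM z w : cabs (z * w) = cabs z * cabs w.
Proof. by rewrite !cabsE Normc.normcM. Qed.

Lemma cabsV z : cabs z^-1 = (cabs z)^-1.
Proof. by rewrite !cabsE Normc.normcV. Qed.

Lemma cabsf z w : cabs (z / w) = cabs z / cabs w.
Proof. by rewrite cabsM cabsV. Qed.

Lemma cabsN z : cabs (- z) = cabs z.
Proof. by rewrite /cabs creN cimN !sqrrN. Qed.

Lemma cabsBC z w : cabs (z - w) = cabs (w - z). Proof. by rewrite -cabsN opprB. Qed.

Lemma cabs0 : cabs (0 : C) = 0.
Proof. by rewrite /cabs /= expr0n /= addr0 sqrtr0. Qed.

Lemma cabs1 : cabs (1 : C) = 1.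
Proof. by rewrite /cabs /= expr0n /= addr0 expr1n sqrtr1. Qed.

Lemma cabs_eq0 z : (cabs z == 0) = (z == 0).
Proof.
apply/eqP/eqP => [|->]; last exact: cabs0.
by rewrite cabsE => /Normc.eq0_normc.
Qed.

Lemma cabs_gt0 z : (0 < cabs z) = (z != 0).
Proof. by rewrite lt_def cabs_ge0 andbT cabs_eq0. Qed.

Lemma cabsX z n : cabs (z ^+ n) = cabs z ^+ n.
Proof. by elim: n => [|n IH]; rewrite ?expr0 ?cabs1 // !exprS cabsM IH. Qed.

Lemma cabsD z w : cabs (z + w) <= cabs z + cabs w.
Proof.
have := ler_normD z w; rewrite !cabs_norm -rmorphD /=.
by rewrite lecE /= eqxx.
Qed.

Lemma cabsB z w : cabs (z - w) <= cabs z + cabs w.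
Proof. by rewrite -(cabsN w) cabsD. Qed.

Lemma cabs_triB z w (a : C) : cabs (z - w) <= cabs (z - a) + cabs (a - w).
Proof. by rewrite (le_trans _ (cabsD _ _)) // addrA subrK. Qed.

Lemma cabs_sub z w : cabs z - cabs w <= cabs (z - w).
Proof. by rewrite lerBlDr (le_trans _ (cabsD _ _)) // subrK. Qed.

Lemma cabs_real (x : R) : cabs (x%:C%C) = `|x|.
Proof. by rewrite /cabs /= expr0n /= addr0 sqrtr_sqr. Qed.

Lemma cabs_natr n : cabs (n%:R : C) = n%:R.
Proof. by rewrite -(rmorph_nat (real_complex R)) cabs_real ger0_norm. Qed.

Lemma cabs_sum (I : Type) (r : seq I) (P : pred I) (F : I -> C) :
  cabs (\sum_(i <- r | P i) F i) <= \sum_(i <- r | P i) cabs (F i).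
Proof.
elim/big_ind2: _ => [|x1 x2 y1 y2 h1 h2|//]; first by rewrite cabs0.
by rewrite (le_trans (cabsD _ _)) // lerD.
Qed.

Lemma cabs_sqr z : cabs z ^+ 2 = cre z ^+ 2 + cim z ^+ 2.
Proof. by rewrite sqr_sqrtr // addr_ge0 ?sqr_ge0. Qed.

Lemma cre_le z : `|cre z| <= cabs z.
Proof.
by rewrite -sqrtr_sqr ler_sqrt ?addr_ge0 ?sqr_ge0 // lerDl sqr_ge0.
Qed.

Lemma cim_le z : `|cim z| <= cabs z.
Proof.
by rewrite -sqrtr_sqr ler_sqrt ?addr_ge0 ?sqr_ge0 // lerDr sqr_ge0.
Qed.

Lemma cabs_le z : cabs z <= `|cre z| + `|cim z|.
Proof.
rewrite -(@ler_pXn2r _ 2) ?nnegrE ?addr_ge0 ?cabs_ge0 // cabs_sqr.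
rewrite sqrrD !real_normK ?num_real //.
have := mulr_ge0 (normr_ge0 (cre z)) (normr_ge0 (cim z)); lra.
Qed.

Lemma cplxE z : z = (cre z +i* cim z)%C. Proof. by case: z. Qed.

Lemma ceqP z w : cre z = cre w -> cim z = cim w -> z = w.
Proof. by rewrite {3}(cplxE z) {3}(cplxE w) => -> ->. Qed.

Lemma cre_real (x : R) : cre (x%:C%C) = x. Proof. by []. Qed.

Lemma cim_real (x : R) : cim (x%:C%C) = 0. Proof. by []. Qed.

Definition ccont f z := forall e : R, 0 < e -> exists2 d : R, 0 < d &
  forall w, cabs (w - z) < d -> cabs (f w - f z) < e.

Lemma ccont_cst c z : ccont (fun=> c) z.
Proof. by move=> e e0; exists 1 => // w _; rewrite subrr cabs0. Qed.

Lemma ccont_id z : ccont id z.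
Proof. by move=> e e0; exists e. Qed.

Lemma ccontD f g z : ccont f z -> ccont g z -> ccont (fun w => f w + g w) z.
Proof.
move=> hf hg e e0; have e2 : 0 < e / 2 by rewrite divr_gt0.
have [d d0 fd] := hf _ e2; have [d' d'0 gd] := hg _ e2.
exists (Num.min d d'); first by rewrite lt_min d0.
move=> w; rewrite lt_min => /andP[/fd h1 /gd h2].
have -> : f w + g w - (f z + g z) = (f w - f z) + (g w - g z) by ring.
by rewrite (le_lt_trans (cabsD _ _)) // (splitr e) ltrD.
Qed.

Lemma ccontM f g z : ccont f z -> ccont g z -> ccont (fun w => f w * g w) z.
Proof.
move=> hf hg e e0.
pose K := 1 + cabs (f z) + cabs (g z).
have K0 : 0 < K by rewrite /K; have := cabs_ge0 (f z); have := cabs_ge0 (g z); lra.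
pose e' := Num.min 1 (e / (2 * K)).
have e'0 : 0 < e' by rewrite lt_min ltr01 divr_gt0 // mulr_gt0.
have e'1 : e' <= 1 by rewrite ge_min lexx.
have e'K : e' * K <= e / 2.
  rewrite -ler_pdivlMr // ge_min; apply/orP; right.
  by rewrite invfM mulrA.
have [d d0 fd] := hf _ e'0; have [d' d'0 gd] := hg _ e'0.
exists (Num.min d d'); first by rewrite lt_min d0.
move=> w; rewrite lt_min => /andP[/fd h1 /gd h2].
have -> : f w * g w - f z * g z =
  (f w - f z) * (g w - g z) + (f w - f z) * g z + f z * (g w - g z) by ring.
rewrite (le_lt_trans (cabsD _ _)) // (le_lt_trans (lerD (cabsD _ _) (lexx _))) //.
rewrite !cabsM.
have := cabs_ge0 (f w - f z); have := cabs_ge0 (g w - g z).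
have := cabs_ge0 (f z); have := cabs_ge0 (g z).
rewrite /K in e'K *; move: (cabs _) (cabs (g z)) (cabs (g w - g z)) (cabs (f w - f z)) h1 h2 e'K.
by move=> p q r s; nra.
Qed.

Lemma ccont_comp f g z : ccont f z -> ccont g (f z) -> ccont (fun w => g (f w)) z.
Proof.
move=> hf hg e e0; have [d d0 gd] := hg _ e0; have [d' d'0 fd] := hf _ d0.
by exists d' => // w /fd /gd.
Qed.

Lemma ccontV z : z != 0 -> ccont (fun w => w^-1) z.
Proof.
move=> z0 e e0; have az : 0 < cabs z by rewrite cabs_gt0.
pose d := Num.min (cabs z / 2) (e * cabs z ^+ 2 / 2).
have d0 : 0 < d by rewrite lt_min !divr_gt0 // mulr_gt0 // exprn_gt0.
exists d => // w; rewrite lt_min => /andP[h1 h2].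
have hw : cabs z / 2 < cabs w.
  by have := cabs_sub z w; rewrite cabsBC; lra.
have w0 : w != 0 by rewrite -cabs_gt0; lra.
have -> : w^-1 - z^-1 = (z - w) / (w * z) by field; rewrite w0 z0.
rewrite cabsf cabsBC cabsM ltr_pdivrMr; last by rewrite mulr_gt0 // cabs_gt0.
rewrite (lt_le_trans h2) //.
rewrite -mulrA ler_pM2l // expr2 -[_ * _ / 2]mulrA.
by rewrite mulrC ler_pM2r // ltW.
Qed.

(** Carathéodory's form of the derivative, through a slope function continuous at z. The sum,
    product and chain rules become algebraic identities between slope functions, with no division
    and no separate case w = z. *)
Lemma has_cderivP f z l : has_cderiv f z l <->
  exists phi, [/\ ccont phi z, phi z = l & forall w, f w = f z + phi w * (w - z)].
Proof.
split=> [h|[phi [cphi <- hphi]] e e0].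
  exists (fun w => if w == z then l else (f w - f z) / (w - z)); split.
  - move=> e e0; have [d d0 hd] := h _ e0; exists d => // w wz.
    rewrite eqxx; case: eqP => [_|/eqP wz0]; first by rewrite subrr cabs0.
    have /hd := wz; rewrite subr_eq0 => /(_ wz0).
    by rewrite [z + _]addrC subrK.
  - by rewrite eqxx.
  - move=> w; case: eqP => [->|/eqP wz0]; first by rewrite subrr mulr0 addr0.
    by rewrite divfK ?subr_eq0// addrC subrK.
have [d d0 hd] := cphi _ e0; exists d => // h h0 hh.
have := hd (z + h); rewrite [z + h - z]addrC addKr => /(_ hh).
rewrite (hphi (z + h)) [z + h - z]addrC addKr.
by rewrite [f z + _ - _]addrC addKr mulfK.
Qed.

Lemma has_cderiv_ccont f z l : has_cderiv f z l -> ccont f z.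
Proof.
move=> /has_cderivP[phi [cphi _ hphi]].
have : ccont (fun w => f z + phi w * (w - z)) z.
  apply: ccontD; first exact: ccont_cst.
  apply: ccontM => //; apply: ccontD; [exact: ccont_id|exact: ccont_cst].
by rewrite (_ : (fun w => _) = f) //; apply/funext => w; rewrite -hphi.
Qed.

Lemma has_cderiv_unique f z l l' : has_cderiv f z l -> has_cderiv f z l' -> l = l'.
Proof.
move=> h h'; apply/eqP; rewrite -subr_eq0 -cabs_eq0; apply/negPn/negP => ll'.
have e0 : 0 < cabs (l - l') / 2 by rewrite divr_gt0 // lt_def ll' cabs_ge0.
have [d d0 hd] := h _ e0; have [d' d'0 hd'] := h' _ e0.
pose t : R := Num.min d d' / 2.
have t0 : 0 < t by rewrite divr_gt0 // lt_min d0.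
have tt : t < Num.min d d' by rewrite /t ltr_pdivrMr // ltr_pMr ?ltr1n // lt_min d0.
have th0 : t%:C%C != 0 :> C by rewrite -cabs_gt0 cabs_real normr_gt0 gt_eqF.
move: tt; rewrite lt_min => /andP[td td'].
have h1 := hd _ th0; have h2 := hd' _ th0; rewrite cabs_real gtr0_norm // in h1 h2.
have := h1 td; have := h2 td'; set q := _ / _ => h3 h4.
have := cabs_triB l l' q; rewrite (cabsBC l q); lra.
Qed.

Lemma cderivE f z l : has_cderiv f z l -> cderiv f z = l.
Proof.
move=> h; rewrite /cderiv.
by case: xgetP => [y _ /= hy|/(_ l)/(_ h)//]; apply: has_cderiv_unique hy h.
Qed.

Lemma has_cderiv_cderiv f z l : has_cderiv f z l -> has_cderiv f z (cderiv f z).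
Proof. by move=> h; rewrite (cderivE h). Qed.

Lemma has_cderiv_near f g z l (r : R) : 0 < r ->
  (forall w, cabs (w - z) < r -> f w = g w) -> has_cderiv f z l -> has_cderiv g z l.
Proof.
move=> r0 fg h e e0; have [d d0 hd] := h _ e0.
exists (Num.min d r); first by rewrite lt_min d0.
move=> k k0; rewrite lt_min => /andP[/(hd _ k0) ? kr].
by rewrite -!fg // ?subrr ?cabs0 // [z + _]addrC addrK.
Qed.

Lemma has_cderiv_cst c z : has_cderiv (fun=> c) z 0.
Proof.
apply/has_cderivP; exists (fun=> 0); split=> //; first exact: ccont_cst.
by move=> w; rewrite mul0r addr0.
Qed.

Lemma has_cderiv_id z : has_cderiv id z 1.
Proof.
apply/has_cderivP; exists (fun=> 1); split=> //; first exact: ccont_cst.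
by move=> w /=; ring.
Qed.

Lemma has_cderivD f g z l l' : has_cderiv f z l -> has_cderiv g z l' ->
  has_cderiv (fun w => f w + g w) z (l + l').
Proof.
move=> /has_cderivP[p [cp <- hp]] /has_cderivP[q [cq <- hq]]; apply/has_cderivP.
exists (fun w => p w + q w); split => //; first exact: ccontD.
by move=> w; rewrite (hp w) (hq w); ring.
Qed.

Lemma has_cderivM f g z l l' : has_cderiv f z l -> has_cderiv g z l' ->
  has_cderiv (fun w => f w * g w) z (l * g z + f z * l').
Proof.
move=> hf hg; have cg := has_cderiv_ccont hg.
move: hf hg => /has_cderivP[p [cp <- hp]] /has_cderivP[q [cq <- hq]]; apply/has_cderivP.
exists (fun w => p w * g w + f z * q w); split => //.
  by apply: ccontD; apply: ccontM => //; exact: ccont_cst.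
by move=> w; rewrite (hp w) (hq w); ring.
Qed.

Lemma has_cderivZ c f z l : has_cderiv f z l -> has_cderiv (fun w => c * f w) z (c * l).
Proof.
by move=> h; have := has_cderivM (has_cderiv_cst c z) h; rewrite mul0r add0r.
Qed.

Lemma has_cderivB f g z l l' : has_cderiv f z l -> has_cderiv g z l' ->
  has_cderiv (fun w => f w - g w) z (l - l').
Proof.
move=> hf hg; have := has_cderivD hf (has_cderivZ (-1) hg).
rewrite mulN1r (_ : (fun w => _) = (fun w => f w - g w)) //.
by apply/funext => w; rewrite mulN1r.
Qed.

Lemma has_cderiv_comp f g z l l' : has_cderiv f z l -> has_cderiv g (f z) l' ->
  has_cderiv (fun w => g (f w)) z (l' * l).
Proof.
move=> hf hg; have cf := has_cderiv_ccont hf.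
move: hf hg => /has_cderivP[p [cp <- hp]] /has_cderivP[q [cq <- hq]]; apply/has_cderivP.
exists (fun w => q (f w) * p w); split => //.
  by apply: ccontM => //; apply: ccont_comp.
by move=> w; rewrite (hq (f w)); congr (_ + _); rewrite -mulrA; congr (_ * _); rewrite (hp w); ring.
Qed.

Lemma has_cderivV z : z != 0 -> has_cderiv (fun w => w^-1) z (- z^-1 ^+ 2).
Proof.
(* The slope identity must hold at every w, including w = 0, where the inverse is 0 by convention.
   There the function is replaced by its tangent line at z, which does not affect the derivative at
   z. *)
move=> z0; apply: (@has_cderiv_near (fun w => if w == 0 then z^-1 - z^-1 ^+ 2 * (w - z) else w^-1) _ _ _ (cabs z)).
- by rewrite cabs_gt0.
- move=> w wz; case: eqP => // w0; move: wz.
  by rewrite w0 sub0r cabsN ltxx.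
apply/has_cderivP.
exists (fun w => if w == 0 then - z^-1 ^+ 2 else - (z^-1 * w^-1)); split => //.
- have h : ccont (fun w => -1 * (z^-1 * w^-1)) z.
    apply: ccontM; first exact: ccont_cst.
    by apply: ccontM; [exact: ccont_cst|exact: ccontV].
  move=> e e0; have [d d0 hd] := h e e0.
  exists (Num.min d (cabs z)); first by rewrite lt_min d0 cabs_gt0.
  move=> w; rewrite lt_min => /andP[/hd h1 h2].
  have w0 : w != 0 by apply: contraTneq h2 => ->; rewrite sub0r cabsN ltxx.
  by rewrite (negPf w0) (negPf z0); rewrite !mulN1r in h1.
- by rewrite (negPf z0) expr2.
- move=> w; rewrite (negPf z0); case: eqP => [->|/eqP w0].
    by rewrite mulNr.
  by field; rewrite z0 w0.
Qed.

Lemma has_cderivX f z l n : has_cderiv f z l ->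
  has_cderiv (fun w => f w ^+ n.+1) z (n.+1%:R * f z ^+ n * l).
Proof.
move=> h; elim: n => [|n IH].
  by rewrite expr0 !mul1r; apply: h.
have := has_cderivM h IH.
rewrite (_ : (fun w => _) = (fun w => f w ^+ n.+2)); last by apply/funext => w; rewrite -exprS.
congr has_cderiv; rewrite [f z ^+ n.+1]exprS -[in RHS]natr1; ring.
Qed.

Lemma has_cderiv_sum (I : Type) (r : seq I) (F : I -> C -> C) (L : I -> C) z :
  (forall i, has_cderiv (F i) z (L i)) ->
  has_cderiv (fun w => \sum_(i <- r) F i w) z (\sum_(i <- r) L i).
Proof.
move=> h; elim: r => [|i r IH].
  rewrite big_nil (_ : (fun w => _) = fun=> 0); first exact: has_cderiv_cst.
  by apply/funext => w; rewrite big_nil.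
rewrite big_cons (_ : (fun w => _) = fun w => F i w + \sum_(j <- r) F j w).
  exact: has_cderivD.
by apply/funext => w; rewrite big_cons.
Qed.

Section filter.
Context {T : Type} {F : set_system T} {FF : Filter F}.
(** The bridge from moduli to real limits: [cint01] integrates real and imaginary parts separately,
    so continuity along a curve is needed componentwise. *)
Lemma ccont_cvg f z (gam : T -> C) : ccont f z ->
  cre (gam x) @[x --> F] --> cre z -> cim (gam x) @[x --> F] --> cim z ->
  forall e : R, 0 < e -> \forall x \near F, cabs (f (gam x) - f z) < e.
Proof.
move=> cf hr hi e e0; have [d d0 hd] := cf _ e0.
have d2 : 0 < d / 2 by rewrite divr_gt0.
have /cvgrPdist_lt /(_ _ d2) h1 := hr; have /cvgrPdist_lt /(_ _ d2) h2 := hi.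
near=> x; apply: hd; rewrite cabsBC (le_lt_trans (cabs_le _)) // (splitr d) creB cimB ltrD //.
  by near: x.
by near: x.
Unshelve. all: by end_near. Qed.

Lemma ccont_cvg_re f z (gam : T -> C) : ccont f z ->
  cre (gam x) @[x --> F] --> cre z -> cim (gam x) @[x --> F] --> cim z ->
  cre (f (gam x)) @[x --> F] --> cre (f z).
Proof.
move=> cf hr hi; apply/cvgrPdist_lt => e e0; near=> x.
rewrite -creB (le_lt_trans (cre_le _)) // cabsBC; near: x.
exact: ccont_cvg.
Unshelve. all: by end_near. Qed.

Lemma ccont_cvg_im f z (gam : T -> C) : ccont f z ->
  cre (gam x) @[x --> F] --> cre z -> cim (gam x) @[x --> F] --> cim z ->
  cim (f (gam x)) @[x --> F] --> cim (f z).
Proof.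
move=> cf hr hi; apply/cvgrPdist_lt => e e0; near=> x.
rewrite -cimB (le_lt_trans (cim_le _)) // cabsBC; near: x.
exact: ccont_cvg.
Unshelve. all: by end_near. Qed.
End filter.

End ComplexDerivatives.

(** * Integrals of complex functions over real segments *)

Section SegmentIntegrals.
Variable R : realType.
Local Notation C := R[i].
Implicit Types (f g : C -> C) (z w : C).

Lemma creZ (x : R) z : cre (x%:C%C * z) = x * cre z.
Proof. by rewrite creM cre_real cim_real mul0r subr0. Qed.

Lemma cimZ (x : R) z : cim (x%:C%C * z) = x * cim z.
Proof. by rewrite cimM cre_real cim_real mul0r addr0. Qed.

(** Continuity is two-sided also at the endpoints, which avoids one-sided limits; the integrands are
    continuous at all points near the curves considered. *)
Definition icts (a b : R) (h : R -> C) := forall t, a <= t <= b ->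
  (cre (h s) @[s --> t] --> cre (h t)) /\ (cim (h s) @[s --> t] --> cim (h t)).

Definition cint (a b : R) (h : R -> C) : C :=
  ((\int[@lebesgue_measure R]_(t in `[a, b]) cre (h t))%R
  +i* (\int[@lebesgue_measure R]_(t in `[a, b]) cim (h t))%R)%C.

Lemma within_cts (a b : R) (f : R -> R) :
  (forall t, a <= t <= b -> f s @[s --> t] --> f t) -> {within `[a, b], continuous f}.
Proof.
move=> H; apply: continuous_in_subspaceT => t.
by rewrite inE /= in_itv /= => /H.
Qed.

Lemma icts_re a b h : icts a b h -> {within `[a, b], continuous (@cre R \o h)}.
Proof. by move=> H; apply: within_cts => t /H[]. Qed.

Lemma icts_im a b h : icts a b h -> {within `[a, b], continuous (@cim R \o h)}.
Proof. by move=> H; apply: within_cts => t /H[]. Qed.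

Lemma itv_integrable (a b : R) (f : R -> R) : {within `[a, b], continuous f} ->
  lebesgue_measure.-integrable `[a, b] (EFin \o f).
Proof. exact/continuous_compact_integrable/segment_compact. Qed.

Lemma icts_int_re a b h : icts a b h ->
  lebesgue_measure.-integrable `[a, b] (EFin \o (fun t => cre (h t))).
Proof. by move=> /icts_re; apply: itv_integrable. Qed.

Lemma icts_int_im a b h : icts a b h ->
  lebesgue_measure.-integrable `[a, b] (EFin \o (fun t => cim (h t))).
Proof. by move=> /icts_im; apply: itv_integrable. Qed.

Lemma icts_cst a b c : icts a b (fun=> c).
Proof. by move=> t _; split; apply: cvg_cst. Qed.

Lemma ictsD a b h k : icts a b h -> icts a b k -> icts a b (fun t => h t + k t).
Proof.
move=> H K t ab; have [h1 h2] := H t ab; have [k1 k2] := K t ab; split.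
- under eq_fun do rewrite creD.
  by rewrite creD; apply: cvgD.
- under eq_fun do rewrite cimD.
  by rewrite cimD; apply: cvgD.
Qed.

Lemma ictsM a b h k : icts a b h -> icts a b k -> icts a b (fun t => h t * k t).
Proof.
move=> H K t ab; have [h1 h2] := H t ab; have [k1 k2] := K t ab; split.
- under eq_fun do rewrite creM.
  by rewrite creM; apply: cvgB; apply: cvgM.
- under eq_fun do rewrite cimM.
  by rewrite cimM; apply: cvgD; apply: cvgM.
Qed.

Lemma ictsB a b h k : icts a b h -> icts a b k -> icts a b (fun t => h t - k t).
Proof.
move=> H K t ab; have [h1 h2] := H t ab; have [k1 k2] := K t ab; split.
- under eq_fun do rewrite creB.
  by rewrite creB; apply: cvgB.
- under eq_fun do rewrite cimB.
  by rewrite cimB; apply: cvgB.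
Qed.

Lemma eq_cint a b h k : (forall t, a <= t <= b -> h t = k t) -> cint a b h = cint a b k.
Proof.
by move=> hk; rewrite /cint; congr (_ +i* _)%C; apply: eq_Rintegral => t;
  rewrite inE /= in_itv /= => /hk ->.
Qed.

Lemma cintD a b h k : icts a b h -> icts a b k ->
  cint a b (fun t => h t + k t) = cint a b h + cint a b k.
Proof.
move=> H K; apply: ceqP.
- rewrite creD /= -RintegralD //; [|exact: icts_int_re..].
  by apply: eq_Rintegral => t _; rewrite creD.
- rewrite cimD /= -RintegralD //; [|exact: icts_int_im..].
  by apply: eq_Rintegral => t _; rewrite cimD.
Qed.

Lemma cintZ a b c h : icts a b h -> cint a b (fun t => c * h t) = c * cint a b h.
Proof.
move=> H; have ir := icts_int_re H; have ii := icts_int_im H.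
have Z (f : R -> R) (r : R) : lebesgue_measure.-integrable `[a, b] (EFin \o f) ->
    lebesgue_measure.-integrable `[a, b] (EFin \o (fun t => r * f t)).
  by move=> If; rewrite (_ : _ \o _ = fun t => r%:E * (EFin \o f) t)%E //; apply: integrableZl.
apply: ceqP.
- rewrite creM /= -!RintegralZl // -RintegralB //; [|exact: Z..].
  by apply: eq_Rintegral => t _; rewrite creM.
- rewrite cimM /= -!RintegralZl // -RintegralD //; [|exact: Z..].
  by apply: eq_Rintegral => t _; rewrite cimM.
Qed.

Lemma cintB a b h k : icts a b h -> icts a b k ->
  cint a b (fun t => h t - k t) = cint a b h - cint a b k.
Proof.
move=> H K; rewrite -mulN1r -cintZ // -cintD //.
  by apply: eq_cint => t _; rewrite mulN1r.
by apply: ictsM K; exact: icts_cst.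
Qed.

Lemma cint_cst a b c : a <= b -> cint a b (fun=> c) = (b - a)%:C%C * c.
Proof.
move=> ab; apply: ceqP; case: c => x y; rewrite /= Rintegral_cst //= lebesgue_measure_itv /= lte_fin;
  case: ltgtP ab => //= [ab _|-> _]; rewrite ?subrr /=; ring.
Qed.

Lemma Rint_split (f : R -> R) a c b : a <= c <= b ->
  {within `[a, b], continuous f} ->
  \int[lebesgue_measure]_(t in `[a, b]) f t =
  \int[lebesgue_measure]_(t in `[a, c]) f t + \int[lebesgue_measure]_(t in `[c, b]) f t.
Proof.
move=> /andP[ac cb] /itv_integrable If.
have Icb : lebesgue_measure.-integrable `]c, b] (EFin \o f).
  by apply: integrableS If => // t /=; rewrite !in_itv /= => /andP[/ltW/(le_trans ac) -> ->].
rewrite -(Rintegral_itv_obnd_cbnd Icb).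
have E : `[a, b]%classic = `[a, c]%classic `|` `]c, b]%classic.
  by rewrite -itv_bndbnd_setU // ?bnd_simp.
rewrite E Rintegral_setU // -?E //.
rewrite disj_set2E; apply/eqP; rewrite -subset0 => t [] /=.
by rewrite !in_itv /= => /andP[_ tc] /andP[ct _]; move: (lt_le_trans ct tc); rewrite ltxx.
Qed.

Lemma cint_split a c b h : a <= c <= b -> icts a b h ->
  cint a b h = cint a c h + cint c b h.
Proof.
move=> acb H; apply: ceqP.
- by rewrite creD /=; apply: (Rint_split acb); apply: icts_re.
- by rewrite cimD /=; apply: (Rint_split acb); apply: icts_im.
Qed.

Lemma Rint_bound (f : R -> R) a b M : a <= b -> {within `[a, b], continuous f} ->
  (forall t, a <= t <= b -> `|f t| <= M) ->
  `|\int[lebesgue_measure]_(t in `[a, b]) f t| <= (b - a) * M.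
Proof.
move=> ab cf fM; have If := itv_integrable cf.
rewrite (le_trans (le_normr_Rintegral _ If)) //.
have -> : (b - a) * M = \int[@lebesgue_measure R]_(t in `[a, b]) (cst M t).
  rewrite Rintegral_cst // /= lebesgue_measure_itv /= lte_fin.
  case: ltgtP ab => //= [ab _|-> _]; rewrite ?subrr /=; ring.
apply: le_Rintegral => //.
  exact: (integrable_norm If).
  by apply: itv_integrable; apply: within_cts => t _; apply: cvg_cst.
Qed.

(** The factor 2 comes from bounding real and imaginary parts separately; it is carried through
    Cauchy's estimates. *)
Lemma cint_bound a b h M : a <= b -> icts a b h ->
  (forall t, a <= t <= b -> cabs (h t) <= M) -> cabs (cint a b h) <= 2 * (b - a) * M.
Proof.
move=> ab H hM; rewrite (le_trans (cabs_le _)) //=.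
have -> : 2 * (b - a) * M = (b - a) * M + (b - a) * M by ring.
apply: lerD; apply: Rint_bound => //; first exact: icts_re.
- by move=> t /hM; apply: le_trans; exact: cre_le.
- exact: icts_im.
- by move=> t /hM; apply: le_trans; exact: cim_le.
Qed.

Lemma icts_comp a b (gam : R -> C) f : icts a b gam ->
  (forall t, a <= t <= b -> ccont f (gam t)) -> icts a b (fun t => f (gam t)).
Proof.
move=> H cf t ab; have [h1 h2] := H t ab; split.
- exact: ccont_cvg_re (cf _ ab) h1 h2.
- exact: ccont_cvg_im (cf _ ab) h1 h2.
Qed.

Lemma icts_line a b (z v : C) : icts a b (fun t => z + t%:C%C * v).
Proof.
apply: ictsD; first exact: icts_cst.
apply: ictsM; last exact: icts_cst.
by move=> t _; split; [exact: cvg_id|exact: cvg_cst].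
Qed.

Lemma is_derive_line f z v t l : has_cderiv f (z + t%:C%C * v) l ->
  is_derive t 1 (fun s : R => cre (f (z + s%:C%C * v))) (cre (l * v)) /\
  is_derive t 1 (fun s : R => cim (f (z + s%:C%C * v))) (cim (l * v)).
Proof.
move=> /has_cderivP[phi [cphi <- hphi]].
(* The slope function gives the increment along the line exactly, so the real difference quotients
   are values of a function continuous at t. *)
have E (h : R) : h != 0 -> f (z + (h *: 1 + t)%:C%C * v) - f (z + t%:C%C * v) =
    h%:C%C * (phi (z + (h *: 1 + t)%:C%C * v) * v).
  move=> h0; rewrite hphi /GRing.scale /= mulr1 rmorphD /=; ring.
have L : icts (t - 1) (t + 1) (fun s => z + s%:C%C * v) by exact: icts_line.
have tt : t - 1 <= t <= t + 1 by lra.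
have [l1 l2] := L t tt.
have [C1 C2] : (cre (phi (z + s%:C%C * v) * v) @[s --> t] --> cre (phi (z + t%:C%C * v) * v)) /\
         (cim (phi (z + s%:C%C * v) * v) @[s --> t] --> cim (phi (z + t%:C%C * v) * v)).
  split.
  - exact: (@ccont_cvg_re _ _ _ _ (fun w => phi w * v) _ _ (ccontM cphi (ccont_cst v _)) l1 l2).
  - exact: (@ccont_cvg_im _ _ _ _ (fun w => phi w * v) _ _ (ccontM cphi (ccont_cst v _)) l1 l2).
have shift (F : R -> R) : F s @[s --> t] --> F t -> F (h *: 1 + t) @[h --> 0^'] --> F t.
  move=> cF; apply: cvg_comp cF.
  have : (fun h : R => h *: 1 + t) h @[h --> 0^'] --> 0 *: 1 + t.
    apply: cvg_within_filter.
    apply: cvgD; last exact: cvg_cst.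
    by apply: cvgZr_tmp; exact: cvg_id.
  by rewrite scale0r add0r.
split.
- have K : h^-1 *: ((fun s : R => cre (f (z + s%:C%C * v))) (h *: 1 + t) - cre (f (z + t%:C%C * v)))
      @[h --> 0^'] --> cre (phi (z + t%:C%C * v) * v).
    apply: cvg_trans (shift _ C1); apply: near_eq_cvg; near=> h.
    have h0 : h != 0 by near: h; exact: nbhs_dnbhs_neq.
    by rewrite -creB E // creZ /GRing.scale /= mulrA mulVf // mul1r.
  by apply: DeriveDef; [apply/cvg_ex; eexists; exact: K|apply: cvg_lim => //; exact: K].
- have K : h^-1 *: ((fun s : R => cim (f (z + s%:C%C * v))) (h *: 1 + t) - cim (f (z + t%:C%C * v)))
      @[h --> 0^'] --> cim (phi (z + t%:C%C * v) * v).
    apply: cvg_trans (shift _ C2); apply: near_eq_cvg; near=> h.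
    have h0 : h != 0 by near: h; exact: nbhs_dnbhs_neq.
    by rewrite -cimB E // cimZ /GRing.scale /= mulrA mulVf // mul1r.
  by apply: DeriveDef; [apply/cvg_ex; eexists; exact: K|apply: cvg_lim => //; exact: K].
Unshelve. all: by end_near. Qed.

(** The real mean value theorem is applied to the real and the imaginary part, at two different
    intermediate points; hence the factor 2. *)
Lemma mean_value_bound f z w L :
  (forall t : R, 0 <= t <= 1 -> exists2 l, has_cderiv f (z + t%:C%C * (w - z)) l & cabs l <= L) ->
  cabs (f w - f z) <= 2 * L * cabs (w - z).
Proof.
move=> H.
pose l (t : R) := cderiv f (z + t%:C%C * (w - z)).
have hl (t : R) : 0 <= t <= 1 -> has_cderiv f (z + t%:C%C * (w - z)) (l t) /\ cabs (l t) <= L.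
  by move=> /H[l0 h1 h2]; rewrite /l (cderivE h1).
have I (t : R) : t \in `]0%R, 1[ -> 0 <= t <= 1.
  by rewrite in_itv /= => /andP[/ltW -> /ltW ->].
have cf : icts 0 1 (fun t => f (z + t%:C%C * (w - z))).
  apply: icts_comp => [|t /hl[h _]]; first exact: icts_line.
  exact: has_cderiv_ccont h.
have [c1 /I c1I e1] := MVT ltr01 (fun t tI => (is_derive_line (hl t (I t tI)).1).1) (icts_re cf).
have [c2 /I c2I e2] := MVT ltr01 (fun t tI => (is_derive_line (hl t (I t tI)).1).2) (icts_im cf).
have z1 : z + 1%:C%C * (w - z) = w by rewrite rmorph1 mul1r addrC subrK.
have z0 : z + 0%:C%C * (w - z) = z by rewrite rmorph0 mul0r addr0.
rewrite z1 z0 subr0 mulr1 in e1 e2.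
have [|h1 L1] := hl c1; first by apply: c1I.
have [|h2 L2] := hl c2; first by apply: c2I.
rewrite (le_trans (cabs_le _)) // creB e1 cimB e2 mulr1 -mulrA mulr_natl mulr2n.
apply: lerD.
- rewrite (le_trans (cre_le _)) // cabsM ler_wpM2r ?cabs_ge0 //.
- rewrite (le_trans (cim_le _)) // cabsM ler_wpM2r ?cabs_ge0 //.
Qed.

End SegmentIntegrals.

(** * Goursat's lemma and Cauchy's estimates *)

Section Rectangles.
Variable R : realType.
Local Notation C := R[i].
Implicit Types (f g : C -> C) (z w : C).

(** Goursat's bisection for an arbitrary property: if P failed, nested rectangles on which it fails
    would shrink to a point, against the local hypothesis there. The proportions of the rectangles
    are preserved, which Goursat's lemma needs; the same principle yields compactness of closed
    discs. *)
Lemma rect_bisection (P : R -> R -> R -> R -> Prop) (a b c d : R) : a < b -> c < d ->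
  (forall a' b' c' d', a <= a' -> a' < b' -> b' <= b -> c <= c' -> c' < d' -> d' <= d ->
    P a' ((a' + b') / 2) c' ((c' + d') / 2) -> P ((a' + b') / 2) b' c' ((c' + d') / 2) ->
    P a' ((a' + b') / 2) ((c' + d') / 2) d' -> P ((a' + b') / 2) b' ((c' + d') / 2) d' ->
    P a' b' c' d') ->
  (forall x y, a <= x <= b -> c <= y <= d -> exists2 r, 0 < r &
    forall a' b' c' d', a <= a' <= x -> x <= b' <= b -> c <= c' <= y -> y <= d' <= d ->
      b' - a' < r -> d' - c' < r -> (b' - a') * (d - c) = (d' - c') * (b - a) ->
      P a' b' c' d') ->
  P a b c d.
Proof.
move=> ab cd Hdiv Hloc; apply: contrapT => NP.
pose good (q : R * R * R * R) := let: (a', b', c', d') := q in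
  [/\ a <= a' /\ a' < b' /\ b' <= b, c <= c' /\ c' < d' /\ d' <= d,
      (b' - a') * (d - c) = (d' - c') * (b - a) & ~ P a' b' c' d'].
pose nest (q' q : R * R * R * R) := let: (a', b', c', d') := q' in
  let: (a0, b0, c0, d0) := q in a0 <= a' /\ b' <= b0 /\ c0 <= c' /\ d' <= d0.
pose len (q : R * R * R * R) := q.1.1.2 - q.1.1.1.
(* [nx] sends a rectangle on which P fails to a quarter on which it still fails; by [Hdiv] one of
   the four quarters must do so. *)
have /choice[nx nxP] : forall q, exists q', good q -> [/\ good q', nest q' q & len q' = len q / 2].
  move=> [[[a' b'] c'] d'].
  case: (pselect (good (a', b', c', d'))) => [|ng]; last by exists (a, b, c, d).
  move=> [[h1 [h2 h3]] [h4 [h5 h6]] h7 h8].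
  have [p1|p1] := pselect (P a' ((a' + b') / 2) c' ((c' + d') / 2)); last first.
    by exists (a', (a' + b') / 2, c', (c' + d') / 2) => _; split; rewrite /= ?/len /=; [split => //; clear -h1 h2 h3 h4 h5 h6 h7; lra|clear -h1 h2 h3 h4 h5 h6 h7; lra|by clear; lra].
  have [p2|p2] := pselect (P ((a' + b') / 2) b' c' ((c' + d') / 2)); last first.
    by exists ((a' + b') / 2, b', c', (c' + d') / 2) => _; split; rewrite /= ?/len /=; [split => //; clear -h1 h2 h3 h4 h5 h6 h7; lra|clear -h1 h2 h3 h4 h5 h6 h7; lra|by clear; lra].
  have [p3|p3] := pselect (P a' ((a' + b') / 2) ((c' + d') / 2) d'); last first.
    by exists (a', (a' + b') / 2, (c' + d') / 2, d') => _; split; rewrite /= ?/len /=; [split => //; clear -h1 h2 h3 h4 h5 h6 h7; lra|clear -h1 h2 h3 h4 h5 h6 h7; lra|by clear; lra].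
  have [p4|p4] := pselect (P ((a' + b') / 2) b' ((c' + d') / 2) d'); last first.
    by exists ((a' + b') / 2, b', (c' + d') / 2, d') => _; split; rewrite /= ?/len /=; [split => //; clear -h1 h2 h3 h4 h5 h6 h7; lra|clear -h1 h2 h3 h4 h5 h6 h7; lra|by clear; lra].
  by case: h8; apply: Hdiv.
pose s n := iter n nx (a, b, c, d).
have gs n : good (s n).
  by elim: n => [|n IH] /=; [split => //; lra|have [] := nxP _ IH].
have ls n : len (s n) = (b - a) / 2 ^+ n.
  elim: n => [|n IH]; first by rewrite expr0 divr1.
  have [_ _] := nxP _ (gs n); rewrite -iterS -/(s n.+1) => ->; rewrite IH exprSr.
  by rewrite invfM mulrA.
have nest_trans q1 q2 q3 : nest q1 q2 -> nest q2 q3 -> nest q1 q3.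
  by case: q1 => [[[? ?] ?] ?]; case: q2 => [[[? ?] ?] ?]; case: q3 => [[[? ?] ?] ?] /=; lra.
have ns n m : (n <= m)%N -> nest (s m) (s n).
  move=> /subnK <-; elim: (m - n)%N => [|k IH].
    by rewrite add0n; case: (s n) => [[[? ?] ?] ?] /=; lra.
  by apply: nest_trans IH; have [_] := nxP _ (gs (k + n)%N).
pose A n := (s n).1.1.1; pose B n := (s n).1.1.2; pose Cc n := (s n).1.2; pose D n := (s n).2.
have AB n m : A n <= B m.
  have := ns _ _ (leq_maxl n m); have := ns _ _ (leq_maxr n m); have := gs (maxn n m).
  rewrite /A /B; case: (s (maxn n m)) => [[[? ?] ?] ?]; case: (s n) => [[[? ?] ?] ?];
  by case: (s m) => [[[? ?] ?] ?] /= [] *; lra.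
have CD n m : Cc n <= D m.
  have := ns _ _ (leq_maxl n m); have := ns _ _ (leq_maxr n m); have := gs (maxn n m).
  rewrite /Cc /D; case: (s (maxn n m)) => [[[? ?] ?] ?]; case: (s n) => [[[? ?] ?] ?];
  by case: (s m) => [[[? ?] ?] ?] /= [] *; lra.
have [x Ax] : exists x, forall n, A n <= x <= B n.
  exists (sup (range A)) => n; apply/andP; split.
    by apply: ub_le_sup; [exists (B 0%N) => _ [k _ <-]; exact: AB|exists n].
  by apply: ge_sup; [exists (A 0%N), 0%N|move=> _ [k _ <-]; exact: AB].
have [y Cy] : exists y, forall n, Cc n <= y <= D n.
  exists (sup (range Cc)) => n; apply/andP; split.
    by apply: ub_le_sup; [exists (D 0%N) => _ [k _ <-]; exact: CD|exists n].
  by apply: ge_sup; [exists (Cc 0%N), 0%N|move=> _ [k _ <-]; exact: CD].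
have [r r0 Hr] := Hloc x y (Ax 0%N) (Cy 0%N).
have [n hn] : exists n, (b - a) / 2 ^+ n < r /\ (d - c) / 2 ^+ n < r.
  (* Since n <= 2^n, an n above (b - a + (d - c)) / r makes both sides of the n-th rectangle shorter
     than r. *)
  have K0 : 0 <= (b - a + (d - c)) / r by rewrite divr_ge0 ?ltW //; lra.
  have := archi_boundP K0; set n := Num.bound _ => hn; exists n.
  have n2 : n%:R <= 2 ^+ n :> R by rewrite -natrX ler_nat ltnW // ltn_expl.
  have p2 : 0 < 2 ^+ n :> R by rewrite exprn_gt0.
  have : (b - a + (d - c)) < r * 2 ^+ n.
    by rewrite mulrC -ltr_pdivrMr // (lt_le_trans hn).
  by rewrite !ltr_pdivrMr //; lra.
have := gs n; have := Ax n; have := Cy n; have := ls n; rewrite /A /B /Cc /D /len.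
case: (s n) => [[[a' b'] c'] d'] /= l1 /andP[y1 y2] /andP[x1 x2].
move=> [[h1 [h2 h3]] [h4 [h5 h6]] h7 h8]; apply: h8; apply: Hr => //.
- by rewrite h1.
- by rewrite x2.
- by rewrite h4.
- by rewrite y2.
- by rewrite l1; case: hn.
- have -> : d' - c' = (d - c) / 2 ^+ n; last by lra.
  have ba0 : b - a != 0 by rewrite subr_eq0 gt_eqF.
  apply: (mulIf ba0); rewrite -h7 l1; ring.
Qed.

Definition imu : C := (0 +i* 1)%C.
Lemma cabs_imu : cabs imu = 1.
Proof. by rewrite /cabs /= expr0n /= add0r expr1n sqrtr1. Qed.

(** The counterclockwise integral over the boundary of [a, b] x [c, d], with opposite sides paired
    into one integrand. *)
Definition bint (F : C -> C) (a b c d : R) : C :=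
  cint a b (fun t => F (t +i* c)%C - F (t +i* d)%C) +
  imu * cint c d (fun s => F (b +i* s)%C - F (a +i* s)%C).

Definition rcont (F : C -> C) (a b c d : R) :=
  forall x y, a <= x <= b -> c <= y <= d -> ccont F (x +i* y)%C.

Lemma icts_hor (a b y : R) : icts a b (fun t => (t +i* y)%C).
Proof. by move=> t _; split; [exact: cvg_id|exact: cvg_cst]. Qed.

Lemma icts_ver (a b x : R) : icts a b (fun t => (x +i* t)%C).
Proof. by move=> t _; split; [exact: cvg_cst|exact: cvg_id]. Qed.

Section bint.
Variables (F : C -> C) (a b c d : R).
Hypothesis cF : rcont F a b c d.
Lemma rcont_hor y a' b' : a <= a' -> b' <= b -> c <= y <= d ->
  icts a' b' (fun t => F (t +i* y)%C).
Proof.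
move=> aa bb yc; apply: icts_comp; first exact: icts_hor.
by move=> t /andP[h1 h2]; apply: cF => //; rewrite (le_trans aa h1) (le_trans h2 bb).
Qed.

Lemma rcont_ver x c' d' : c <= c' -> d' <= d -> a <= x <= b ->
  icts c' d' (fun t => F (x +i* t)%C).
Proof.
move=> aa bb xc; apply: icts_comp; first exact: icts_ver.
by move=> t /andP[h1 h2]; apply: cF => //; rewrite (le_trans aa h1) (le_trans h2 bb).
Qed.

Lemma bint_splitx m : a <= m <= b -> c <= d ->
  bint F a b c d = bint F a m c d + bint F m b c d.
Proof.
move=> /andP[am mb] cd; have ab := le_trans am mb.
rewrite /bint (@cint_split R a m b) ?am //; last first.
  by apply: ictsB; apply: rcont_hor; rewrite ?lexx ?cd.
have -> : cint c d (fun s => F (b +i* s)%C - F (a +i* s)%C) =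
  cint c d (fun s => F (m +i* s)%C - F (a +i* s)%C) + cint c d (fun s => F (b +i* s)%C - F (m +i* s)%C).
  rewrite -cintD; [|by apply: ictsB; apply: rcont_ver; rewrite ?lexx ?am ?ab|by apply: ictsB; apply: rcont_ver; rewrite ?lexx ?am ?ab].
  by apply: eq_cint => t _; ring.
ring.
Qed.

Lemma bint_splity m : c <= m <= d -> a <= b ->
  bint F a b c d = bint F a b c m + bint F a b m d.
Proof.
move=> /andP[cm md] ab; have cd := le_trans cm md.
rewrite /bint (@cint_split R c m d) ?cm //; last first.
  by apply: ictsB; apply: rcont_ver; rewrite ?lexx ?ab.
have -> : cint a b (fun t => F (t +i* c)%C - F (t +i* d)%C) =
  cint a b (fun t => F (t +i* c)%C - F (t +i* m)%C) + cint a b (fun t => F (t +i* m)%C - F (t +i* d)%C).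
  rewrite -cintD; [|by apply: ictsB; apply: rcont_hor; rewrite ?lexx ?cm ?cd|by apply: ictsB; apply: rcont_hor; rewrite ?lexx ?cm ?cd].
  by apply: eq_cint => t _; ring.
ring.
Qed.
End bint.

Lemma rcont_sub F a b c d a' b' c' d' : a <= a' -> b' <= b -> c <= c' -> d' <= d ->
  rcont F a b c d -> rcont F a' b' c' d'.
Proof.
move=> h1 h2 h3 h4 cF x y /andP[x1 x2] /andP[y1 y2]; apply: cF.
- by rewrite (le_trans h1 x1) (le_trans x2 h2).
- by rewrite (le_trans h3 y1) (le_trans y2 h4).
Qed.

(* The two parallel sides of an affine function differ by constants, so its boundary integral vanishes. *)
Lemma bint_affine (F : C -> C) a b c d (z u v : C) E : a <= b -> c <= d ->
  rcont F a b c d ->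
  (forall x y, a <= x <= b -> c <= y <= d ->
    cabs (F (x +i* y)%C - (u + v * ((x +i* y)%C - z))) <= E) ->
  cabs (bint F a b c d) <= 4 * (b - a + (d - c)) * E.
Proof.
move=> ab cd cF H.
pose G w := F w - (u + v * (w - z)).
have cG : rcont G a b c d.
  move=> x y hx hy; apply: (@ccontD _ F (fun w => - (u + v * (w - z)))); first exact: cF.
  have h : ccont (fun w => -1 * (u + v * (w - z))) (x +i* y)%C.
    apply: ccontM; first exact: ccont_cst.
    apply: ccontD; first exact: ccont_cst.
    apply: ccontM; first exact: ccont_cst.
    by apply: ccontD; [exact: ccont_id|exact: ccont_cst].
  move=> e e0; have [r r0 hr] := h e e0; exists r => // w /hr.
  by rewrite !mulN1r.
have -> : bint F a b c d = bint G a b c d.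
  rewrite /bint.
  have -> : cint a b (fun t => F (t +i* c)%C - F (t +i* d)%C) =
     cint a b (fun t => G (t +i* c)%C - G (t +i* d)%C) + (b - a)%:C%C * (v * (imu * (c - d)%:C%C)).
    rewrite -(cint_cst _ ab) -cintD; last exact: icts_cst.
      apply: eq_cint => t _; rewrite /G.
      have -> : (t +i* c)%C = (t +i* d)%C + imu * (c - d)%:C%C.
        by rewrite /imu; apply: ceqP; rewrite ?creD ?cimD ?creM ?cimM /=; ring.
      ring.
    by apply: ictsB; apply: (rcont_hor cG); rewrite ?lexx ?cd ?ab.
  have -> : cint c d (fun s => F (b +i* s)%C - F (a +i* s)%C) =
     cint c d (fun s => G (b +i* s)%C - G (a +i* s)%C) + (d - c)%:C%C * (v * (b - a)%:C%C).
    rewrite -(cint_cst _ cd) -cintD; last exact: icts_cst.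
      apply: eq_cint => t _; rewrite /G.
      have -> : (b +i* t)%C = (a +i* t)%C + (b - a)%:C%C.
        by apply: ceqP; rewrite ?creD ?cimD /=; ring.
      ring.
    by apply: ictsB; apply: (rcont_ver cG); rewrite ?lexx ?cd ?ab.
  have -> : (c - d)%:C%C = - (d - c)%:C%C :> C by rewrite -rmorphN opprB.
  ring.
have Gh y t : c <= y <= d -> a <= t <= b -> cabs (G (t +i* y)%C) <= E by move=> ? ?; exact: H.
rewrite /bint (le_trans (cabsD _ _)) // cabsM cabs_imu mul1r.
have -> : 4 * (b - a + (d - c)) * E = 2 * (b - a) * (E + E) + 2 * (d - c) * (E + E) by ring.
apply: lerD; apply: cint_bound => //.
- by apply: ictsB; apply: (rcont_hor cG); rewrite ?lexx ?cd ?ab.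
- by move=> t tab; rewrite (le_trans (cabsB _ _)) // lerD // Gh ?lexx ?ab ?cd.
- by apply: ictsB; apply: (rcont_ver cG); rewrite ?lexx ?cd ?ab.
- by move=> t tab; rewrite (le_trans (cabsB _ _)) // lerD // Gh ?lexx ?ab ?cd.
Qed.

(** The bound to be proved, e times a fixed multiple of the area, is additive over quarters, so
    bisection reduces it to small rectangles, where F is affine up to e times the diameter. Then e
    tends to 0. *)
Lemma goursat F (a b c d : R) : a < b -> c < d ->
  (forall x y, a <= x <= b -> c <= y <= d -> exists l, has_cderiv F (x +i* y)%C l) ->
  bint F a b c d = 0.
Proof.
move=> ab cd H.
have cF : rcont F a b c d by move=> x y hx hy; have [l] := H x y hx hy; exact: has_cderiv_ccont.
apply/eqP; rewrite -cabs_eq0 eq_le cabs_ge0 andbT.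
pose W := b - a; pose V := d - c.
have W0 : 0 < W by rewrite subr_gt0.
have V0 : 0 < V by rewrite subr_gt0.
have WV : 0 < W * V by exact: mulr_gt0.
suff main (e : R) : 0 < e -> cabs (bint F a b c d) * (W * V) <= 4 * e * (W + V) ^+ 2 * ((b - a) * (d - c)).
  apply/ler_addgt0Pr => e e0; rewrite add0r.
  have S0 : 0 < 4 * (W + V) ^+ 2 by rewrite mulr_gt0 // exprn_gt0 // addr_gt0.
  have := main _ (divr_gt0 e0 S0).
  have -> : 4 * (e / (4 * (W + V) ^+ 2)) * (W + V) ^+ 2 = e.
    by field; rewrite gt_eqF // addr_gt0.
  by rewrite ler_pM2r.
move=> e0; apply: (@rect_bisection (fun a' b' c' d' =>
   cabs (bint F a' b' c' d') * (W * V) <= 4 * e * (W + V) ^+ 2 * ((b' - a') * (d' - c'))) a b c d) => //.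
- move=> a' b' c' d' h1 h2 h3 h4 h5 h6 p1 p2 p3 p4.
  have s1 := rcont_sub h1 h3 h4 h6 cF.
  pose m := (a' + b') / 2; pose k := (c' + d') / 2.
  have m1 : a' <= m <= b' by rewrite /m; clear -h2; lra.
  have k1 : c' <= k <= d' by rewrite /k; clear -h5; lra.
  have -> : bint F a' b' c' d' = bint F a' m c' k + bint F a' m k d' + (bint F m b' c' k + bint F m b' k d').
    have [am mb] := andP m1.
    rewrite (bint_splitx s1 m1 (ltW h5)).
    rewrite (bint_splity (rcont_sub (lexx _) mb (lexx _) (lexx _) s1) k1 am).
    by rewrite (bint_splity (rcont_sub am (lexx _) (lexx _) (lexx _) s1) k1 mb).
  apply: (@le_trans _ _ ((cabs (bint F a' m c' k) + cabs (bint F a' m k d') + (cabs (bint F m b' c' k) + cabs (bint F m b' k d'))) * (W * V))).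
    by rewrite ler_wpM2r ?(ltW WV) // (le_trans (cabsD _ _)) // lerD ?cabsD.
  rewrite -/m -/k in p1 p2 p3 p4.
  have -> : (b' - a') * (d' - c') = (m - a') * (k - c') + (b' - m) * (k - c') + (m - a') * (d' - k) + (b' - m) * (d' - k) by ring.
  rewrite mulrDl [X in X + _ <= _]mulrDl [X in _ + X <= _]mulrDl.
  apply: le_trans (lerD (lerD p1 p3) (lerD p2 p4)) _; rewrite le_eqVlt; apply/orP; left; apply/eqP.
  by clear; ring.
- move=> x y hx hy; have [l hl] := H x y hx hy.
  have /has_cderivP[phi [cphi phil hphi]] := hl.
  have [r r0 hr] := cphi _ e0.
  exists (r / 2); first by rewrite divr_gt0.
  move=> a' b' c' d' /andP[a1 a2] /andP[b1 b2] /andP[c1 c2] /andP[d1 d2] w1 w2 ratio.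
  have ab' : a' <= b' by exact: le_trans b1.
  have cd' : c' <= d' by exact: le_trans d1.
  have s1 := rcont_sub a1 b2 c1 d2 cF.
  have := @bint_affine F a' b' c' d' (x +i* y)%C (F (x +i* y)%C) l (e * (b' - a' + (d' - c'))) ab' cd' s1.
  have dist x' y' : a' <= x' <= b' -> c' <= y' <= d' ->
     cabs ((x' +i* y')%C - (x +i* y)%C) <= b' - a' + (d' - c').
    move=> hx' hy'; rewrite (le_trans (cabs_le _)) //= lerD // ler_norml; clear -hx' hy' a2 b1 c2 d1; lra.
  have hE x' y' : a' <= x' <= b' -> c' <= y' <= d' ->
    cabs (F (x' +i* y')%C - (F (x +i* y)%C + l * ((x' +i* y')%C - (x +i* y)%C))) <= e * (b' - a' + (d' - c')).
    move=> hx' hy'; rewrite (hphi (x' +i* y')%C).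
    have -> : F (x +i* y)%C + phi (x' +i* y')%C * ((x' +i* y')%C - (x +i* y)%C) -
      (F (x +i* y)%C + l * ((x' +i* y')%C - (x +i* y)%C)) =
      (phi (x' +i* y')%C - l) * ((x' +i* y')%C - (x +i* y)%C) by ring.
    rewrite cabsM ler_pM ?cabs_ge0 ?dist //.
    by rewrite -phil ltW // hr // (le_lt_trans (dist _ _ hx' hy')); clear -w1 w2; lra.
  move=> /(_ hE) B.
  apply: (le_trans (ler_wpM2r (ltW WV) B)).
  have -> : 4 * (b' - a' + (d' - c')) * (e * (b' - a' + (d' - c'))) * (W * V) =
    4 * e * ((b' - a' + (d' - c')) ^+ 2 * (W * V)) by ring.
  rewrite -!mulrA; do 2 (rewrite ler_pM2l //).
  (* All rectangles have the proportions of the first one, so the square of the half perimeter is a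
     fixed multiple of the area. *)
  have -> : b' - a' = (d' - c') / V * W.
    by apply: (mulIf (lt0r_neq0 V0)); rewrite ratio -/W mulrAC divfK ?gt_eqF.
  rewrite le_eqVlt; apply/orP; left; apply/eqP; field.
  by rewrite gt_eqF.
Qed.

End Rectangles.

(** * The exponential map and Cauchy's estimates *)

Section CauchyEstimates.
Variable R : realType.
Local Notation C := R[i].
Implicit Types (f g : C -> C) (z w : C).

Lemma has_cderiv_le f z l :
  (forall e : R, 0 < e -> exists2 d : R, 0 < d & forall h, cabs h < d ->
    cabs (f (z + h) - f z - l * h) <= e * cabs h) -> has_cderiv f z l.
Proof.
move=> H e e0; have [d d0 hd] := H _ (divr_gt0 e0 (ltr0n _ 2)); exists d => // h h0 hh.
have -> : (f (z + h) - f z) / h - l = (f (z + h) - f z - l * h) / h by field.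
rewrite cabsf ltr_pdivrMr ?cabs_gt0 // (le_lt_trans (hd _ hh)) //.
by rewrite ltr_pM2r ?cabs_gt0 // ltr_pdivrMr // ltr_pMr // ltr1n.
Qed.

Lemma derive0_le (F : R -> R) (l : R) : is_derive (0 : R) 1 F l ->
  forall e : R, 0 < e -> exists2 d : R, 0 < d & forall h, `|h| < d ->
    `|F h - F 0 - l * h| <= e * `|h|.
Proof.
move=> [] /[dup] dF /derivable_nbhsP _ <- e e0.
have : h^-1 *: (F (h *: 1 + 0) - F 0) @[h --> 0^'] --> 'D_1 F 0 by exact: dF.
move=> /cvgrPdist_lt/(_ _ e0) /nbhs_ballP[d /= d0 hd]; exists d => // h hh.
have [->|h0] := eqVneq h 0; first by rewrite subrr mulr0 subr0 normr0 mulr0.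
have := hd h; rewrite /ball /= sub0r normrN => /(_ hh h0).
rewrite /GRing.scale /= mulr1 addr0 => /ltW h1.
have -> : F h - F 0 - 'D_1 F 0 * h = - ('D_1 F 0 - h^-1 * (F h - F 0)) * h by field.
by rewrite normrM normrN ler_wpM2r.
Qed.

Definition cexp (w : C) : C := (expR (cre w) * cos (cim w) +i* (expR (cre w) * sin (cim w)))%C.
Lemma cexpD z w : cexp (z + w) = cexp z * cexp w.
Proof.
by rewrite /cexp creD cimD expRD cosD sinD; apply: ceqP; rewrite ?creM ?cimM /=; ring.
Qed.

Lemma cexp0 : cexp 0 = 1.
Proof. by rewrite /cexp /= expR0 cos0 sin0; apply: ceqP; rewrite /= ?mulr0 ?mulr1. Qed.

Lemma cabs_cexp w : cabs (cexp w) = expR (cre w).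
Proof.
rewrite /cabs /= !exprMn -mulrDr cos2Dsin2 mulr1 sqrtr_sqr gtr0_norm //.
exact: expR_gt0.
Qed.

Lemma cexp_neq0 w : cexp w != 0.
Proof. by rewrite -cabs_gt0 cabs_cexp expR_gt0. Qed.

Lemma cexp_2pi x : cexp (x +i* (pi *+ 2))%C = cexp (x +i* 0)%C.
Proof. by rewrite /cexp /= cos2pi sin2pi cos0 sin0. Qed.

(** By the addition formula [cexpD] the derivative at 0 determines the derivative everywhere, so
    first-order expansions of [expR], [cos] and [sin] at 0 suffice. *)
Lemma has_cderiv_cexp0 : has_cderiv cexp 0 1.
Proof.
(* The errors [A] and [B] below add up to 4 e |x| + 2 e |y| <= 6 e |h|. *)
apply: has_cderiv_le => e0 e0_gt; pose e := Num.min (e0 / 6) 1.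
have e_gt : 0 < e by rewrite lt_min divr_gt0 /=.
have e1 : e <= 1 by rewrite ge_min lexx orbT.
have e6 : 6 * e <= e0 by rewrite mulrC -ler_pdivlMr // ge_min lexx.
have [d1 d1_gt H1] := derive0_le (is_derive_expR 0) e_gt.
have [d2 d2_gt H2] := derive0_le (is_derive_cos 0) e_gt.
have [d3 d3_gt H3] := derive0_le (is_derive_sin 0) e_gt.
(* The bound e / 4 on |y| gives |sin y| <= (1 + e) |y| <= e / 2. *)
pose d := Num.min (Num.min d1 d2) (Num.min d3 (e / 4)).
exists d; first by rewrite !lt_min d1_gt d2_gt d3_gt divr_gt0.
move=> h hd; have := le_lt_trans (cre_le h) hd; have := le_lt_trans (cim_le h) hd.
rewrite !lt_min => /andP[/andP[_ y2] /andP[y3 y4]] /andP[/andP[x1 _] _].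
have := H1 _ x1; have := H2 _ y2; have := H3 _ y3.
rewrite add0r cexp0 mul1r expR0 cos0 sin0 oppr0 !mul0r subr0 !mul1r.
have := cre_le h; have := cim_le h; rewrite /cexp.
move: (cabs h) => H ; case: h {hd x1 y2 y3} y4 => x y /= y4 yH xH ey ey' ex.
rewrite (le_trans (cabs_le _)) //= subr0.
rewrite addr0 in ey.
have nx := normr_ge0 x; have ny := normr_ge0 y.
have ex2 : `|expR x - 1| <= 2 * `|x|.
  have -> : expR x - 1 = (expR x - 1 - x) + x by ring.
  by rewrite (le_trans (ler_normD _ _)) //; nra.
have sy2 : `|sin y| <= e / 2.
  have -> : sin y = (sin y - y) + y by ring.
  by rewrite (le_trans (ler_normD _ _)) //; nra.
have A : `|expR x * cos y - 1 - x| <= 3 * e * `|x| + e * `|y|.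
  have -> : expR x * cos y - 1 - x = (expR x - 1 - x) + ((cos y - 1) + (expR x - 1) * (cos y - 1)) by ring.
  rewrite (le_trans (ler_normD _ _)) // (le_trans (lerD (lexx _) (ler_normD _ _))) // normrM.
  have P : `|expR x - 1| * `|cos y - 1| <= 2 * `|x| * e by apply: ler_pM => //; nra.
  lra.
have B : `|expR x * sin y - y| <= e * `|y| + e * `|x|.
  have -> : expR x * sin y - y = (sin y - y) + (expR x - 1) * sin y by ring.
  rewrite (le_trans (ler_normD _ _)) // normrM.
  have P : `|expR x - 1| * `|sin y| <= 2 * `|x| * (e / 2) by apply: ler_pM.
  lra.
by rewrite (le_trans (lerD A B)) //; nra.
Qed.

Lemma has_cderiv_cexp w : has_cderiv cexp w (cexp w).
Proof.
have -> : cexp = fun v => cexp w * cexp (v - w).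
  by apply/funext => v; rewrite -cexpD addrC subrK.
rewrite -[X in has_cderiv _ _ X]mulr1 subrr cexp0 mulr1; apply: has_cderivZ.
rewrite -[X in has_cderiv _ _ X]mulr1.
apply: (@has_cderiv_comp R (fun v => v - w) cexp); last by rewrite subrr; exact: has_cderiv_cexp0.
rewrite -[X in has_cderiv _ _ X]subr0.
by apply: has_cderivB; [exact: has_cderiv_id|exact: has_cderiv_cst].
Qed.

Definition hol f (a : C) (r : R) := forall z, cabs (z - a) < r -> exists l, has_cderiv f z l.

Lemma hol_cderiv f a r z : hol f a r -> cabs (z - a) < r -> has_cderiv f z (cderiv f z).
Proof. by move=> H /H[l]; exact: has_cderiv_cderiv. Qed.

Lemma hol_sub f a b r s : (cabs (b - a) + s <= r) -> hol f a r -> hol f b s.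
Proof.
move=> abs H z zb; apply: H; rewrite (le_lt_trans (cabs_triB _ _ b)) //.
by rewrite addrC (lt_le_trans _ abs) // ltrD2l.
Qed.

Lemma analyticE f : analytic f <-> hol f 0 1.
Proof. by split=> H z zr; apply: H; move: zr; rewrite /disc /= ?subr0. Qed.

(* Goursat for u(a + e^w) / e^w on [x1, log r] x [0, 2 pi]: its circular mean does not depend
   on the radius, and tends to u'(a) when x1 -> -oo. *)
Lemma circle_bound (u : C -> C) (a : C) (r M : R) : 0 < r ->
  (forall z, cabs (z - a) <= r -> exists l, has_cderiv u z l) -> u a = 0 ->
  (forall z, cabs (z - a) = r -> cabs (u z) <= M) ->
  cabs (cderiv u a) <= 2 * (M / r).
Proof.
move=> r0 H ua uM; set l := cderiv u a.
have hl : has_cderiv u a l.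
  by have [|l0] := H a; [rewrite subrr cabs0 ltW|exact: has_cderiv_cderiv].
pose F w := u (a + cexp w) * (cexp w)^-1.
pose x2 := ln r.
have ex2 : expR x2 = r by rewrite lnK.
have hF w : cre w <= x2 -> exists l, has_cderiv F w l.
  move=> wx.
  have [k hk] : exists k, has_cderiv u (a + cexp w) k.
    by apply: H; rewrite addrC addKr cabs_cexp -ex2 ler_expR.
  eexists; apply: has_cderivM.
    apply: (@has_cderiv_comp R (fun w => a + cexp w) u); last exact: hk.
    by apply: has_cderivD; [exact: has_cderiv_cst|exact: has_cderiv_cexp].
  apply: (@has_cderiv_comp R cexp (fun w => w^-1)); first exact: has_cderiv_cexp.
  exact/has_cderivV/cexp_neq0.
have cF w : cre w <= x2 -> ccont F w by move=> /hF[k]; exact: has_cderiv_ccont.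
have pi2 : 0 < pi *+ 2 :> R by rewrite mulrn_wgt0 // pi_gt0.
have icF x : x <= x2 -> icts 0 (pi *+ 2) (fun s => F (x +i* s)%C).
  by move=> xx; apply: icts_comp; [exact: icts_ver|move=> t _; exact: cF].
apply/ler_addgt0Pr => e e0.
have e4 : 0 < e / 2 by rewrite divr_gt0.
have [d d0 hd] := hl _ e4.
(* The inner circle has radius e^x1 < d. As u a = 0, F is there a difference quotient of u at a,
   within e / 2 of l. *)
pose x1 := Num.min (ln (d / 2)) (x2 - 1).
have x12 : x1 < x2 by rewrite gt_min; apply/orP; right; lra.
have d2 : 0 < d / 2 by rewrite divr_gt0.
have ex1 : expR x1 < d.
  apply: (@le_lt_trans _ _ (d / 2)); last by rewrite ltr_pdivrMr // ltr_pMr // ltr1n.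
  by rewrite -[leRHS](@lnK _ (d / 2)) // ler_expR ge_min lexx.
have h1 s : cabs (F (x1 +i* s)%C - l) <= e / 2.
  have := hd (cexp (x1 +i* s)%C) (cexp_neq0 _); rewrite cabs_cexp /= => /(_ ex1).
  by rewrite ua subr0 => /ltW.
have G : bint F x1 x2 0 (pi *+ 2) = 0.
  by apply: goursat => // x y /andP[_ xx] _; exact: hF.
have G' : cint 0 (pi *+ 2) (fun s => F (x2 +i* s)%C - F (x1 +i* s)%C) = 0.
  (* The two horizontal sides cancel because [cexp] has period 2 pi i. *)
  move: G; rewrite /bint (_ : cint x1 x2 _ = 0); last first.
    rewrite (@eq_cint _ _ _ _ (fun=> 0)); first by rewrite cint_cst ?(ltW x12) // mulr0.
    by move=> t _; rewrite /F cexp_2pi subrr.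
  rewrite add0r => /eqP; rewrite mulf_eq0 => /orP[/eqP h|/eqP//].
  by have := cabs_imu R; rewrite h cabs0 => /eqP; rewrite eq_sym oner_eq0.
have E : (pi *+ 2)%:C%C * l = cint 0 (pi *+ 2) (fun s => F (x2 +i* s)%C - (F (x1 +i* s)%C - l)).
  have := @cint_cst _ 0 (pi *+ 2) l (ltW pi2); rewrite subr0 => <-.
  rewrite -[LHS]add0r -G' -cintD.
  - by apply: eq_cint => t _; ring.
  - by apply: ictsB; apply: icF; rewrite ?lexx ?ltW.
  - exact: icts_cst.
have : cabs ((pi *+ 2)%:C%C * l) <= 2 * (pi *+ 2 - 0) * (M / r + e / 2).
  rewrite E; apply: cint_bound; first exact: ltW.
    apply: ictsB; first by apply: icF.
    by apply: ictsB; [apply: icF; exact: ltW|exact: icts_cst].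
  move=> t _; rewrite (le_trans (cabsB _ _)) // lerD //.
  rewrite /F cabsf cabs_cexp /= ex2 ler_pM2r ?invr_gt0 //.
  by apply: uM; rewrite addrC addKr cabs_cexp /= ex2.
rewrite cabsM cabs_real gtr0_norm // subr0 [2 * _]mulrC -mulrA ler_pM2l //.
by rewrite mulrDr [2 * (e / 2)]mulrC divfK.
Qed.

(** [circle_bound] for (w - a) f(w), which vanishes at a and has derivative f(a) there. *)
Lemma cauchy_value f (a : C) (r M : R) : 0 < r ->
  (forall z, cabs (z - a) <= r -> exists l, has_cderiv f z l) ->
  (forall z, cabs (z - a) = r -> cabs (f z) <= M) ->
  cabs (f a) <= 2 * M.
Proof.
move=> r0 H fM; pose u w := (w - a) * f w.
have D z l : has_cderiv f z l -> has_cderiv u z (f z + (z - a) * l).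
  move=> h; rewrite -[X in X + _]mul1r -[X in X * f z]subr0.
  apply: has_cderivM => //.
  by apply: has_cderivB; [exact: has_cderiv_id|exact: has_cderiv_cst].
have := @circle_bound u a r (r * M) r0.
have [l hl] : exists l, has_cderiv f a l by apply: H; rewrite subrr cabs0 ltW.
rewrite (cderivE (D _ _ hl)) subrr mul0r addr0 mulrAC divff ?gt_eqF // mul1r; apply.
- by move=> z /H[k /D hk]; eexists; exact: hk.
- by rewrite /u subrr mul0r.
- by move=> z zr; rewrite cabsM zr ler_wpM2l ?(ltW r0) // fM.
Qed.

(** [circle_bound] for f - f(a) on the circle of radius r / 2, which lies inside the open disc; the
    function is at most 2 M there, and 2 (2 M) / (r / 2) = 8 M / r. *)
Lemma cauchy_deriv f (a : C) (r M : R) : 0 < r -> hol f a r ->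
  (forall z, cabs (z - a) < r -> cabs (f z) <= M) ->
  cabs (cderiv f a) <= 8 * M / r.
Proof.
move=> r0 H fM; pose u w := f w - f a.
have r2 : 0 < r / 2 by rewrite divr_gt0.
have rr z : cabs (z - a) <= r / 2 -> cabs (z - a) < r by lra.
have D z l : has_cderiv f z l -> has_cderiv u z l.
  move=> h; rewrite -[l]subr0.
  by apply: has_cderivB => //; exact: has_cderiv_cst.
have aa : cabs (a - a) < r by rewrite subrr cabs0.
have hl := hol_cderiv H aa.
have := @circle_bound u a (r / 2) (2 * M) r2.
rewrite (cderivE (D _ _ hl)).
have -> : 2 * (2 * M / (r / 2)) = 8 * M / r by field; rewrite gt_eqF.
apply.
- by move=> z /rr/H[k /D hk]; eexists; exact: hk.
- by rewrite /u subrr.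
- move=> z zr; have := fM a aa; have /rr/fM : cabs (z - a) <= r / 2 by rewrite zr.
  by have := cabsB (f z) (f a); rewrite /u; lra.
Qed.

End CauchyEstimates.

(** * Limits and derivatives of analytic functions *)

Section Weierstrass.
Variable R : realType.
Local Notation C := R[i].
Implicit Types (f g : C -> C) (z w : C).

Lemma has_cderiv_le' f z l : has_cderiv f z l -> forall e : R, 0 < e ->
  exists2 d : R, 0 < d & forall h, cabs h < d ->
    cabs (f (z + h) - f z - l * h) <= e * cabs h.
Proof.
move=> H e e0; have [d d0 hd] := H _ e0; exists d => // h hh.
have [->|h0] := eqVneq h 0; first by rewrite addr0 subrr mulr0 subr0 cabs0 mulr0.
have -> : f (z + h) - f z - l * h = ((f (z + h) - f z) / h - l) * h by field.
by rewrite cabsM ler_wpM2r ?cabs_ge0 // ltW // hd.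
Qed.

Lemma disc_convex (a z w : C) (r t : R) : cabs (z - a) < r -> cabs (w - a) < r ->
  0 <= t <= 1 -> cabs (z + t%:C%C * (w - z) - a) < r.
Proof.
move=> hz hw /andP[t0 t1].
have -> : z + t%:C%C * (w - z) - a = (1 - t)%:C%C * (z - a) + t%:C%C * (w - a).
  by rewrite rmorphB rmorph1; ring.
rewrite (le_lt_trans (cabsD _ _)) // !cabsM !cabs_real !ger0_norm ?subr_ge0 //.
set A := cabs (z - a) in hz *; set B := cabs (w - a) in hw *.
have Am : A <= Num.max A B by rewrite le_max lexx.
have Bm : B <= Num.max A B by rewrite le_max lexx orbT.
have mr : Num.max A B < r by rewrite gt_max hz.
have t1' : 0 <= 1 - t by lra.
have := ler_wpM2l t0 Bm; have := ler_wpM2l t1' Am; lra.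
Qed.

Lemma hol_lipschitz f (a : C) (r L : R) z w : hol f a r ->
  (forall z, cabs (z - a) < r -> cabs (cderiv f z) <= L) ->
  cabs (z - a) < r -> cabs (w - a) < r -> cabs (f w - f z) <= 2 * L * cabs (w - z).
Proof.
move=> H fL hz hw; apply: mean_value_bound => t t01.
have h := disc_convex hz hw t01.
by exists (cderiv f (z + t%:C%C * (w - z))); [exact: hol_cderiv H h|exact: fL].
Qed.

Lemma holB f g a r : hol f a r -> hol g a r -> hol (fun z => f z - g z) a r.
Proof. by move=> hf hg z zr; have [l hl] := hf z zr; have [k hk] := hg z zr; eexists; exact: has_cderivB hl hk. Qed.

Lemma cderivB f g a r z : hol f a r -> hol g a r -> cabs (z - a) < r ->
  cderiv (fun z => f z - g z) z = cderiv f z - cderiv g z.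
Proof. by move=> hf hg zr; apply/cderivE/has_cderivB; [apply: hol_cderiv hf zr|apply: hol_cderiv hg zr]. Qed.

(** Completeness for a family indexed by its own accuracy e > 0: the limit is the supremum of the
    lower bounds s e - K e. *)
Lemma approx_limit (s : R -> R) (K : R) :
  (forall e k, 0 < e -> 0 < k -> `|s e - s k| <= K * (e + k)) ->
  exists x, forall e, 0 < e -> `|s e - x| <= K * e.
Proof.
move=> H; pose A := [set s e - K * e | e in [set e : R | 0 < e]].
have ub k : 0 < k -> ubound A (s k + K * k).
  move=> k0 _ [e /= e0 <-]; have := H e k e0 k0; rewrite ler_norml; lra.
have A0 : A !=set0 by exists (s 1 - K * 1), 1 => //=; exact: ltr01.
exists (sup A) => e e0; have h1 : sup A <= s e + K * e by apply: ge_sup => //; exact: ub.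
have h2 : s e - K * e <= sup A.
  apply: ub_le_sup; last by exists e.
  by exists (s 1 + K * 1); apply: ub.
by rewrite ler_norml; lra.
Qed.

(* Cauchy's estimate turns uniform closeness of the approximants into closeness of their derivatives. *)
Lemma weierstrass (phi : C -> C) (a : C) (r : R) : 0 < r ->
  (forall e : R, 0 < e -> exists2 f, hol f a r & forall z, cabs (z - a) < r -> cabs (f z - phi z) <= e) ->
  exists l, has_cderiv phi a l.
Proof.
move=> r0 H.
have /choice[F FP] : forall e : R, exists f, 0 < e -> hol f a r /\
    forall z, cabs (z - a) < r -> cabs (f z - phi z) <= e.
  move=> e; have [e0|e0] := ltP 0 e; last by exists phi.
  by have [f h1 h2] := H e e0; exists f.
have FF e k z : 0 < e -> 0 < k -> cabs (z - a) < r -> cabs (F e z - F k z) <= e + k.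
  move=> e0 k0 zr; rewrite (le_trans (cabs_triB _ _ (phi z))) // lerD //.
    by apply: (FP e e0).2.
  by rewrite cabsBC; apply: (FP k k0).2.
have aa : cabs (a - a) < r by rewrite subrr cabs0.
have dF e k : 0 < e -> 0 < k -> cabs (cderiv (F e) a - cderiv (F k) a) <= 8 / r * (e + k).
  move=> e0 k0; rewrite -(cderivB (FP e e0).1 (FP k k0).1) //.
  rewrite mulrAC; apply: cauchy_deriv => //; first by apply: holB; [exact: (FP e e0).1|exact: (FP k k0).1].
  by move=> z; exact: FF.
have [x hx] : exists x, forall e, 0 < e -> `|cre (cderiv (F e) a) - x| <= 8 / r * e.
  by apply: approx_limit => e k e0 k0; rewrite -creB (le_trans (cre_le _)) // dF.
have [y hy] : exists y, forall e, 0 < e -> `|cim (cderiv (F e) a) - y| <= 8 / r * e.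
  by apply: approx_limit => e k e0 k0; rewrite -cimB (le_trans (cim_le _)) // dF.
pose l := (x +i* y)%C; exists l.
have hl e : 0 < e -> cabs (cderiv (F e) a - l) <= 16 / r * e.
  move=> e0; rewrite (le_trans (cabs_le _)) // creB cimB /=.
  have := hx e e0; have := hy e e0; rewrite (_ : 16 / r * e = 8 / r * e + 8 / r * e); last by field; rewrite gt_eqF.
  by lra.
have r2 : 0 < r / 2 by rewrite divr_gt0.
have FL e k h : 0 < e -> 0 < k -> cabs h < r / 2 ->
    cabs ((F e (a + h) - F k (a + h)) - (F e a - F k a)) <= 32 / r * (e + k) * cabs h.
  move=> e0 k0 hr.
  have HD : hol (fun z => F e z - F k z) a r by apply: holB; [exact: (FP e e0).1|exact: (FP k k0).1].
  have HD2 : hol (fun z => F e z - F k z) a (r / 2) by apply: hol_sub HD; rewrite subrr cabs0; lra.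
  have L z : cabs (z - a) < r / 2 -> cabs (cderiv (fun z => F e z - F k z) z) <= 16 / r * (e + k).
    move=> zr; have -> : 16 / r * (e + k) = 8 * (e + k) / (r / 2) by field; rewrite gt_eqF.
    apply: cauchy_deriv => //; first by apply: hol_sub HD; lra.
    move=> w wz; apply: FF => //; rewrite (le_lt_trans (cabs_triB _ _ z)) //; lra.
  have := @hol_lipschitz _ a (r / 2) _ a (a + h) HD2 L.
  rewrite subrr cabs0 addrC addKr => /(_ r2 hr) /le_trans; apply.
  by rewrite le_eqVlt; apply/orP; left; apply/eqP; field; rewrite gt_eqF.
(* [FL] with k tending to 0: the increments of F e - phi are at most a small multiple of |h|,
   although phi is not yet known to be differentiable. *)
have PL e h : 0 < e -> cabs h < r / 2 ->
    cabs ((F e (a + h) - phi (a + h)) - (F e a - phi a)) <= 32 / r * e * cabs h.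
  move=> e0 hr; apply/ler_addgt0Pr => k0 k0_gt.
  pose K := 2 + 32 / r * cabs h.
  have K0 : 0 < K by rewrite /K ltr_pwDl // mulr_ge0 ?cabs_ge0 // divr_ge0 // ltW.
  pose k := k0 / K; have k_gt : 0 < k by rewrite divr_gt0.
  have ar : cabs (a + h - a) < r by rewrite addrC addKr; lra.
  have -> : (F e (a + h) - phi (a + h)) - (F e a - phi a) =
     ((F e (a + h) - F k (a + h)) - (F e a - F k a)) + (F k (a + h) - phi (a + h)) - (F k a - phi a) by ring.
  rewrite (le_trans (cabsB _ _)) // (le_trans (lerD (cabsD _ _) (lexx _))) //.
  have := FL e k h e0 k_gt hr; have := (FP k k_gt).2 _ ar; have := (FP k k_gt).2 _ aa.
  have -> : k0 = k * 2 + k * (32 / r * cabs h) by rewrite -mulrDr divfK ?gt_eqF.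
  by rewrite mulrDr mulrDl; lra.
apply: has_cderiv_le => e e0.
(* 48 = 32 + 16, the constants of [PL] and [hl]; together these two errors use half of e, the
   derivative of F k the other half. *)
pose k := e / 2 / (48 / r).
have k0 : 0 < k by rewrite !divr_gt0.
have /has_cderiv_le'/(_ (e / 2)) := hol_cderiv (FP k k0).1 aa.
case; first by rewrite divr_gt0.
move=> d d0 hd; exists (Num.min d (r / 2)); first by rewrite lt_min d0.
move=> h; rewrite lt_min => /andP[h1 h2].
have -> : phi (a + h) - phi a - l * h = (F k (a + h) - F k a - cderiv (F k) a * h)
   - ((F k (a + h) - phi (a + h)) - (F k a - phi a)) + (cderiv (F k) a - l) * h by ring.
rewrite (le_trans (cabsD _ _)) // (le_trans (lerD (cabsB _ _) (lexx _))) // cabsM.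
have := hd h h1; have := PL k h k0 h2.
have := ler_wpM2r (cabs_ge0 h) (hl k k0).
have -> : e * cabs h = e / 2 * cabs h + 48 / r * k * cabs h.
  by rewrite /k; field; rewrite gt_eqF.
have -> : 48 / r * k * cabs h = 32 / r * k * cabs h + 16 / r * k * cabs h by field; rewrite gt_eqF.
lra.
Qed.

(** A quadratic remainder, obtained before f' is known to be differentiable. Near z the function w
    -> f(w + k) - f(w) is O(|k|) by the Lipschitz bound, so Cauchy's estimate for it bounds f'(z +
    k) - f'(z) by O(|k|); [mean_value_bound] for w -> f(w) - f'(z) w then gives the square. *)
Lemma taylor1 f (a z h : C) (r M : R) : 0 < r -> hol f a r ->
  (forall z, cabs (z - a) < r -> cabs (f z) <= M) ->
  cabs (z - a) < r / 8 -> cabs h < r / 8 ->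
  cabs (f (z + h) - f z - cderiv f z * h) <= 2048 * M / r ^+ 2 * cabs h ^+ 2.
Proof.
move=> r0 H fM zr hr.
have M0 : 0 <= M by apply: le_trans (cabs_ge0 _) (fM a _); rewrite subrr cabs0.
have inr z' b : cabs (b - a) < r / 2 -> cabs (z' - b) < r / 2 -> cabs (z' - a) < r.
  by move=> h1 h2; rewrite (le_lt_trans (cabs_triB _ _ b)) //; lra.
have r2 : 0 < r / 2 by rewrite divr_gt0.
have L1 w : cabs (w - a) < r / 2 -> cabs (cderiv f w) <= 16 * M / r.
  move=> wr; have -> : 16 * M / r = 8 * M / (r / 2) by field; rewrite gt_eqF.
  apply: cauchy_deriv => //; first by apply: hol_sub H; lra.
  by move=> z' h'; apply: fM; apply: inr wr h'.
have H2 : hol f a (r / 2) by apply: hol_sub H; rewrite subrr cabs0; lra.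
have Lip z' w : cabs (z' - a) < r / 2 -> cabs (w - a) < r / 2 ->
  cabs (f w - f z') <= 2 * (16 * M / r) * cabs (w - z') by exact: hol_lipschitz H2 L1.
have shift_hol k : cabs k < r / 8 -> hol (fun w => f (w + k)) z (r / 4).
  move=> kr w wz.
  have [|l hl] := H (w + k).
    rewrite (le_lt_trans (cabs_triB _ _ z)) //.
    have -> : w + k - z = (w - z) + k by ring.
    have := cabsD (w - z) k; lra.
  exists (l * 1); apply: (@has_cderiv_comp R (fun w => w + k) f) => //.
  by rewrite -[X in has_cderiv _ _ X]addr0; apply: has_cderivD; [exact: has_cderiv_id|exact: has_cderiv_cst].
have H4 : hol f z (r / 4) by apply: hol_sub H; lra.
have L2 k : cabs k < r / 8 -> cabs (cderiv f (z + k) - cderiv f z) <= 1024 * M / r ^+ 2 * cabs k.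
  move=> kr.
  have zz : cabs (z - z) < r / 4 by rewrite subrr cabs0 divr_gt0.
  have zka : cabs (z + k - a) < r.
    have -> : z + k - a = (z - a) + k by ring.
    have := cabsD (z - a) k; lra.
  have -> : cderiv f (z + k) - cderiv f z = cderiv (fun w => f (w + k) - f w) z.
    rewrite (cderivB (shift_hol k kr) H4 zz); congr (_ - _).
    symmetry; apply: cderivE; rewrite -[X in has_cderiv _ _ X]mulr1.
    apply: (@has_cderiv_comp R (fun w => w + k) f).
      by rewrite -[X in has_cderiv _ _ X]addr0; apply: has_cderivD; [exact: has_cderiv_id|exact: has_cderiv_cst].
    exact: hol_cderiv H zka.
  (* 8 from Cauchy's estimate, 32 from the Lipschitz constant, 4 from the radius r / 4. *)
  have -> : 1024 * M / r ^+ 2 * cabs k = 8 * (2 * (16 * M / r) * cabs k) / (r / 4).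
    by field; rewrite gt_eqF.
  apply: cauchy_deriv; first by rewrite divr_gt0.
    by apply: holB => //; exact: shift_hol.
  move=> w wz.
  have wa : cabs (w - a) < r / 2 by rewrite (le_lt_trans (cabs_triB _ _ z)) //; lra.
  have wka : cabs (w + k - a) < r / 2.
    have -> : w + k - a = (w - z) + (z - a) + k by ring.
    have := cabsD (w - z + (z - a)) k; have := cabsD (w - z) (z - a); lra.
  by have := Lip _ _ wa wka; rewrite addrAC subrr add0r.
pose v w := f w - cderiv f z * w.
have := @mean_value_bound R v z (z + h) (1024 * M / r ^+ 2 * cabs h).
rewrite /v [z + h - z]addrC addKr.
have -> : f (z + h) - cderiv f z * (z + h) - (f z - cderiv f z * z) = f (z + h) - f z - cderiv f z * h by ring.
have -> : 2 * (1024 * M / r ^+ 2 * cabs h) * cabs h = 2048 * M / r ^+ 2 * cabs h ^+ 2.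
  by field; rewrite gt_eqF.
apply => t /andP[t0 t1].
have th : cabs (t%:C%C * h) <= cabs h.
  by rewrite cabsM cabs_real ger0_norm // ler_piMl ?cabs_ge0.
have thr : cabs (t%:C%C * h) < r / 8 by lra.
exists (cderiv f (z + t%:C%C * h) - cderiv f z * 1).
  apply: has_cderivB.
    apply: (hol_cderiv H).
    have -> : z + t%:C%C * h - a = (z - a) + t%:C%C * h by ring.
    have := cabsD (z - a) (t%:C%C * h); lra.
  by apply: has_cderivZ; exact: has_cderiv_id.
have K0 : 0 <= 1024 * M / r ^+ 2.
  exact: divr_ge0 (mulr_ge0 (ler0n R 1024) M0) (exprn_ge0 _ (ltW r0)).
by rewrite mulr1; apply: (le_trans (L2 _ thr)); exact: ler_wpM2l.
Qed.

(** By [taylor1] the difference quotients with a fixed small real increment t converge to f'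
    uniformly near a, and they are holomorphic, so [weierstrass] applies. *)
Lemma cderiv_differentiable f a r : 0 < r -> hol f a r -> exists l, has_cderiv (cderiv f) a l.
Proof.
move=> r0 H; have aa : cabs (a - a) < r by rewrite subrr cabs0.
have [d d0 hd] := has_cderiv_ccont (hol_cderiv H aa) ltr01.
pose s := Num.min d r; have s0 : 0 < s by rewrite lt_min d0.
have sr : s <= r by rewrite ge_min lexx orbT.
have sd : s <= d by rewrite ge_min lexx.
have Hs : hol f a s by apply: hol_sub H; rewrite subrr cabs0 add0r.
pose M := cabs (f a) + 1.
have M0 : 0 < M by rewrite ltr_wpDl // cabs_ge0.
have fM z : cabs (z - a) < s -> cabs (f z) <= M.
  move=> zs; have := hd z (lt_le_trans zs sd); have := cabs_sub (f z) (f a); rewrite /M; lra.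
apply: (@weierstrass _ _ (s / 8)) => [|e e0]; first by rewrite divr_gt0.
pose K := 2048 * M / s ^+ 2.
have K0 : 0 < K.
  exact: divr_gt0 (mulr_gt0 (etrans (ltr0n R 2048) isT) M0) (exprn_gt0 _ s0).
have T z h : cabs (z - a) < s / 8 -> cabs h < s / 8 ->
  cabs (f (z + h) - f z - cderiv f z * h) <= K * cabs h ^+ 2 by exact: taylor1.
move: K K0 T => K K0 T.
pose t : R := Num.min (s / 16) (e / K).
have t0 : 0 < t by rewrite lt_min !divr_gt0.
have ts : t < s / 8 by rewrite (@le_lt_trans _ _ (s / 16)) // ?ge_min ?lexx //; lra.
have ht : cabs (t%:C%C : C) = t by rewrite cabs_real gtr0_norm.
have t0' : t%:C%C != 0 :> C by rewrite -cabs_gt0 ht.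
exists (fun z => (t%:C%C)^-1 * (f (z + t%:C%C) - f z)).
  move=> z za.
  have [|l hl] := Hs (z + t%:C%C).
    have -> : z + t%:C%C - a = (z - a) + t%:C%C by ring.
    have := cabsD (z - a) t%:C%C; rewrite ht; lra.
  have [|k hk] := Hs z; first by lra.
  eexists; apply: has_cderivZ; apply: has_cderivB; last exact: hk.
  apply: (@has_cderiv_comp R (fun w => w + t%:C%C) f); last exact: hl.
  by apply: has_cderivD; [exact: has_cderiv_id|exact: has_cderiv_cst].
move=> z za.
have := T z t%:C%C za; rewrite ht => /(_ ts) {}T.
have -> : (t%:C%C)^-1 * (f (z + t%:C%C) - f z) - cderiv f z =
  (t%:C%C)^-1 * (f (z + t%:C%C) - f z - cderiv f z * t%:C%C) by field.
rewrite cabsM cabsV ht mulrC ler_pdivrMr // (le_trans T) //.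
rewrite expr2 mulrA ler_wpM2r ?(ltW t0) // mulrC -ler_pdivlMr //.
by rewrite ge_min lexx orbT.
Qed.

Lemma analytic_cderiv f : analytic f -> analytic (cderiv f).
Proof.
move=> /analyticE H z zd; apply: (@cderiv_differentiable f z (1 - cabs z)).
  by rewrite subr_gt0.
by apply: hol_sub H; rewrite subr0 addrC subrK.
Qed.

Lemma analytic_cderivn f k : analytic f -> analytic (cderivn k f).
Proof. by move=> H; elim: k => //= k IH; exact: analytic_cderiv. Qed.

Lemma analytic_has f z : analytic f -> disc z -> has_cderiv f z (cderiv f z).
Proof. by move=> H zd; have [l] := H z zd; exact: has_cderiv_cderiv. Qed.

Lemma analytic_ccont f z : analytic f -> disc z -> ccont f z.
Proof. by move=> H zd; have [l] := H z zd; exact: has_cderiv_ccont. Qed.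

Lemma disc_open z : disc z -> forall w, cabs (w - z) < 1 - cabs z -> disc w.
Proof. by move=> _ w h; rewrite /disc /=; have := cabs_sub w z; lra. Qed.

Lemma eq_cderiv f g z : (forall w, disc w -> f w = g w) -> disc z -> cderiv f z = cderiv g z.
Proof.
move=> fg zd; have r0 : 0 < 1 - cabs z by rewrite subr_gt0.
have E w : cabs (w - z) < 1 - cabs z -> f w = g w by move=> /(disc_open zd); exact: fg.
congr (xget 0 _); apply/seteqP; split => l /=; apply: has_cderiv_near r0 _.
  exact: E.
by move=> w /E.
Qed.

Lemma eq_cderivn f g k z : (forall w, disc w -> f w = g w) -> disc z -> cderivn k f z = cderivn k g z.
Proof.
move=> fg; elim: k z => [|k IH] z zd /=; first exact: fg.
exact: eq_cderiv.
Qed.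

End Weierstrass.

(** * Analytic functions on the disc *)

Section DiscFunctions.
Variable R : realType.
Local Notation C := R[i].
Implicit Types (f g : C -> C) (z w : C).

(** Compactness of the closed disc by bisection, with [P] as the property to be propagated; small
    rectangles that miss the disc fall under [P set0]. It serves boundedness of analytic functions
    and uniformity in Montel's theorem. *)
Lemma closed_disc_cover (P : set C -> Prop) (r : R) :
  (forall A B, P A -> P B -> P (A `|` B)) -> (forall A B, A `<=` B -> P B -> P A) ->
  (forall z, cabs z <= r -> exists2 d : R, 0 < d & P [set w | cabs (w - z) < d]) ->
  0 <= r -> P [set w | cabs w <= r].
Proof.
move=> PU PS Ploc r0.
pose Q (a b c d : R) := P [set w | [/\ a <= cre w <= b, c <= cim w <= d & cabs w <= r]].
have P0 : P set0.
  by have [|d _ Pd] := Ploc 0; [rewrite cabs0|apply: PS Pd].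
(* Half side r + 1 rather than r, so that the square is nondegenerate when r = 0. *)
have : Q (- (r + 1)) (r + 1) (- (r + 1)) (r + 1).
  apply: rect_bisection; [lra|lra| |].
    move=> a b c d _ ab _ _ cd _ q1 q2 q3 q4.
    apply: PS (PU _ _ (PU _ _ q1 q2) (PU _ _ q3 q4)) => w /= [/andP[wa wb] /andP[wc wd] wr].
    have [h|/ltW h] := lerP (cre w) ((a + b) / 2); have [k|/ltW k] := lerP (cim w) ((c + d) / 2).
    - by left; left; rewrite ?wa ?wc ?h ?k.
    - by right; left; rewrite ?wa ?wd ?h ?k.
    - by left; right; rewrite ?wb ?wc ?h ?k.
    - by right; right; rewrite ?wb ?wd ?h ?k.
  move=> x y _ _; have [xr|xr] := lerP (cabs (x +i* y)%C) r.
    have [d d0 Pd] := Ploc _ xr; exists (d / 2); first by rewrite divr_gt0.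
    move=> a' b' c' e' /andP[_ ax] /andP[xb _] /andP[_ cy] /andP[yd _] l1 l2 _.
    apply: PS Pd => w /= [/andP[wa wb] /andP[wc wd] _].
    rewrite (le_lt_trans (cabs_le _)) // creB cimB /= (splitr d) ltrD // ltr_norml; lra.
  exists ((cabs (x +i* y)%C - r) / 2); first by rewrite divr_gt0 // subr_gt0.
  move=> a' b' c' e' /andP[_ ax] /andP[xb _] /andP[_ cy] /andP[yd _] l1 l2 _.
  apply: PS P0 => w /= [/andP[wa wb] /andP[wc wd] wr].
  have := cabs_sub (x +i* y)%C w.
  have : cabs ((x +i* y)%C - w) < cabs (x +i* y)%C - r.
    rewrite (le_lt_trans (cabs_le _)) // creB cimB /= (splitr (_ - r)) ltrD // ltr_norml; lra.
  lra.
apply: PS => w /= wr; split=> //; have := cre_le w; have := cim_le w;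
  rewrite !ler_norml; lra.
Qed.

Lemma analytic_bounded f (r : R) : analytic f -> r < 1 ->
  exists2 M, 0 <= M & forall z, cabs z <= r -> cabs (f z) <= M.
Proof.
move=> H r1; have [r0|r0] := lerP 0 r; last first.
  by exists 0 => // z zr; have := cabs_ge0 z; lra.
pose P (A : set C) := exists2 M, 0 <= M & forall z, A z -> cabs (f z) <= M.
apply: (@closed_disc_cover P) => //.
- move=> A B [M M0 AM] [N N0 BN]; exists (Num.max M N); first by rewrite le_max M0.
  by move=> z [/AM|/BN] h; rewrite le_max h ?orbT.
- by move=> A B AB [M M0 BM]; exists M => // z /AB/BM.
- move=> z zr; have zd : disc z by rewrite /disc /=; lra.
  have [d d0 hd] := analytic_ccont H zd ltr01.
  exists d => //; exists (cabs (f z) + 1); first by rewrite addr_ge0 ?cabs_ge0.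
  by move=> w /= /hd h; have := cabs_sub (f w) (f z); lra.
Qed.

Definition cj z : C := (cre z +i* - cim z)%C.
Lemma cabs_cj z : cabs (cj z) = cabs z.
Proof. by rewrite /cabs /= sqrrN. Qed.

Lemma mul_cj z : z * cj z = (cabs z ^+ 2)%:C%C.
Proof. by rewrite cabs_sqr; apply: ceqP; rewrite ?creM ?cimM /=; ring. Qed.

(** Divided by |1 + conj(a) w|^2, this computes 1 - |phi(w)|^2 for the disc automorphism phi(w) = (a
    + w) / (1 + conj(a) w). Replacing a by -a gives |z - a| <= |1 - conj(a) z|. *)
Lemma moebius_id (a w : C) :
  cabs (1 + cj a * w) ^+ 2 - cabs (a + w) ^+ 2 = (1 - cabs a ^+ 2) * (1 - cabs w ^+ 2).
Proof. by rewrite !cabs_sqr !creD !cimD creM cimM /=; ring. Qed.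

Lemma moebius_den (a w : C) : 1 - cabs a * cabs w <= cabs (1 + cj a * w).
Proof.
have := cabs_sub 1 (- (cj a * w)); rewrite cabs1 cabsN cabsM cabs_cj opprK; lra.
Qed.

(** Circles centred at a do not stay near the boundary, so f is composed with the automorphism phi
    that sends 0 to a. Then [cauchy_value] applies on a circle |w| = s with s close to 1, which phi
    maps close to the boundary. *)
Lemma boundary_vanish f : analytic f ->
  (forall e : R, 0 < e -> exists2 r : R, r < 1 & forall z, disc z -> r < cabs z -> cabs (f z) <= e) ->
  forall a, disc a -> f a = 0.
Proof.
move=> H fe a ad; apply/eqP; rewrite -cabs_eq0 eq_le cabs_ge0 andbT.
have a0 := cabs_ge0 a; rewrite /disc /= in ad.
have den w : cabs w < 1 -> 1 - cabs a <= cabs (1 + cj a * w).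
  by move=> w1; have := moebius_den a w; have := cabs_ge0 w; nra.
have den0 w : cabs w < 1 -> 1 + cj a * w != 0.
  by move=> /den w1; rewrite -cabs_gt0; lra.
pose phi w := (a + w) * (1 + cj a * w)^-1.
have phi_abs w : cabs w < 1 -> 1 - cabs (phi w) ^+ 2 = (1 - cabs a ^+ 2) * (1 - cabs w ^+ 2) / cabs (1 + cj a * w) ^+ 2.
  move=> w1; rewrite /phi cabsf exprMn exprVn -moebius_id.
  by field; rewrite cabs_eq0 den0.
have phi_disc w : cabs w < 1 -> disc (phi w).
  move=> w1; rewrite /disc /= -(@ltr_pXn2r _ 2) ?nnegrE ?cabs_ge0 // expr1n -subr_gt0 phi_abs //.
  have w0 := cabs_ge0 w.
  rewrite divr_gt0 ?mulr_gt0 ?exprn_gt0 ?cabs_gt0 ?den0 //; nra.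
have phi_der w : cabs w < 1 -> exists l, has_cderiv phi w l.
  move=> w1; eexists; apply: has_cderivM.
    by apply: has_cderivD; [exact: has_cderiv_cst|exact: has_cderiv_id].
  apply: (@has_cderiv_comp R (fun w => 1 + cj a * w) (fun w => w^-1)); last exact/has_cderivV/den0.
  by apply: has_cderivD; [exact: has_cderiv_cst|apply: has_cderivZ; exact: has_cderiv_id].
apply/ler_addgt0Pr => e e0; rewrite add0r.
have [r r1 hr] := fe _ (divr_gt0 e0 (ltr0n _ 2)).
pose r' := Num.max r 0.
have r'1 : r' < 1 by rewrite gt_max r1 ltr01.
have r'0 : 0 <= r' by rewrite le_max lexx orbT.
(* On |w| = s the identity [phi_abs] gives 1 - |phi(w)|^2 <= 2 (1 - s) / (1 - |a|)^2 <= (1 - r') /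
   2, which forces |phi(w)| > r'. The bound 1/2 keeps s positive. *)
pose s := Num.max (1 / 2) (1 - (1 - cabs a) ^+ 2 * (1 - r') / 4).
have a1 : 0 < (1 - cabs a) ^+ 2 by rewrite exprn_gt0 // subr_gt0.
have s1 : s < 1.
  rewrite gt_max; apply/andP; split; first by lra.
  by rewrite ltrBlDr ltrDl divr_gt0 // mulr_gt0 // subr_gt0.
have s0 : 1 / 2 <= s by rewrite le_max lexx.
have s2 : 1 - s <= (1 - cabs a) ^+ 2 * (1 - r') / 4.
  have : 1 - (1 - cabs a) ^+ 2 * (1 - r') / 4 <= s by rewrite le_max lexx orbT.
  by lra.
have phi0 : phi 0 = a by rewrite /phi mulr0 !addr0 invr1 mulr1.
have := @cauchy_value R (fun w => f (phi w)) 0 s (e / 2).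
rewrite phi0 [2 * _]mulrC divfK //; apply; first by lra.
- move=> w; rewrite subr0 => ws; have w1 : cabs w < 1 by lra.
  have [l hl] := phi_der w w1; have [k hk] := H _ (phi_disc w w1).
  by exists (k * l); exact: has_cderiv_comp hl hk.
- move=> w; rewrite subr0 => ws; have w1 : cabs w < 1 by lra.
  apply: hr; first exact: phi_disc.
  apply: (@le_lt_trans _ _ r'); first by rewrite le_max lexx.
  have : 1 - cabs (phi w) ^+ 2 <= (1 - r') / 2.
    rewrite phi_abs // ler_pdivrMr; last by rewrite exprn_gt0 // cabs_gt0 den0.
    apply: (@le_trans _ _ ((1 - r') / 2 * (1 - cabs a) ^+ 2)); last first.
      apply: ler_wpM2l; first by lra.
      rewrite ler_pXn2r ?nnegrE ?cabs_ge0 ?den //; lra.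
    rewrite ws; have : 1 - s ^+ 2 <= 2 * (1 - s) by nra.
    have : 0 <= cabs a ^+ 2 by rewrite exprn_ge0.
    move: s2; set q := (1 - cabs a) ^+ 2 * _ => s2 h1 h2.
    have h3 : 0 <= 1 - s ^+ 2 by nra.
    have : (1 - cabs a ^+ 2) * (1 - s ^+ 2) <= 1 - s ^+ 2 by nra.
    by rewrite mulrAC [(1 - r') * _]mulrC -/q; lra.
  by have := cabs_ge0 (phi w); nra.
Qed.

Lemma analyticD f g : analytic f -> analytic g -> analytic (fun z => f z + g z).
Proof. by move=> hf hg z zd; have [l hl] := hf z zd; have [k hk] := hg z zd; eexists; exact: has_cderivD hl hk. Qed.

Lemma analyticB f g : analytic f -> analytic g -> analytic (fun z => f z - g z).
Proof. by move=> hf hg z zd; have [l hl] := hf z zd; have [k hk] := hg z zd; eexists; exact: has_cderivB hl hk. Qed.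

Lemma analyticM f g : analytic f -> analytic g -> analytic (fun z => f z * g z).
Proof. by move=> hf hg z zd; have [l hl] := hf z zd; have [k hk] := hg z zd; eexists; exact: has_cderivM hl hk. Qed.

Lemma analytic_cst (c : C) : analytic (fun=> c).
Proof. by move=> z _; eexists; exact: has_cderiv_cst. Qed.

Lemma analytic_id : analytic (id : C -> C).
Proof. by move=> z _; eexists; exact: has_cderiv_id. Qed.

Lemma analyticX f n : analytic f -> analytic (fun z => f z ^+ n).
Proof.
move=> hf z zd; case: n => [|n]; last by have [l hl] := hf z zd; eexists; exact: has_cderivX hl.
by exists 0; apply: has_cderiv_cst.
Qed.

Lemma analyticV f : analytic f -> (forall z, disc z -> f z != 0) -> analytic (fun z => (f z)^-1).
Proof.
move=> hf f0 z zd; have [l hl] := hf z zd; eexists.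
exact: (has_cderiv_comp hl (has_cderivV (f0 z zd))).
Qed.

Lemma analytic_sum (I : finType) (F : I -> C -> C) :
  (forall i, analytic (F i)) -> analytic (fun z => \sum_i F i z).
Proof.
move=> hF z zd; exists (\sum_i cderiv (F i) z); apply: has_cderiv_sum => i.
exact: analytic_has.
Qed.

Lemma cderivnB f g k z : analytic f -> analytic g -> disc z ->
  cderivn k (fun z => f z - g z) z = cderivn k f z - cderivn k g z.
Proof.
move=> hf hg; elim: k z => //= k IH z zd.
rewrite (eq_cderiv IH zd); apply/cderivE/has_cderivB;
  by apply: analytic_has => //; apply: analytic_cderivn.
Qed.

(** Each derivative lowers the order of the zero at a by one and multiplies the cofactor's value at
    a by the current exponent. The test functions have this shape: derivatives of order k < j vanish
    at a, and the j-th is j! h(a). *)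
Lemma cderivn_factor (a : C) (h : C -> C) (j k : nat) : analytic h -> (k <= j)%N -> disc a ->
  exists hk, [/\ analytic hk, hk a = (j ^_ k)%:R * h a &
    forall z, disc z -> cderivn k (fun z => (z - a) ^+ j * h z) z = (z - a) ^+ (j - k) * hk z].
Proof.
move=> hh kj ad; elim: k kj => [|k IH] kj.
  by exists h; split => //; [rewrite ffactn0 mul1r|move=> z _; rewrite subn0].
have [hk [h1 h2 h3]] := IH (ltnW kj).
exists (fun z => (j - k)%:R * hk z + (z - a) * cderiv hk z); split.
- apply: analyticD; first by apply: analyticM => //; exact: analytic_cst.
  apply: analyticM; last exact: analytic_cderiv.
  by apply: analyticB; [exact: analytic_id|exact: analytic_cst].
- by rewrite subrr mul0r addr0 h2 mulrA -natrM mulnC ffactnSr.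
- move=> z zd /=; rewrite (eq_cderiv h3 zd).
  have jk : (j - k = (j - k.+1).+1)%N by rewrite subnSK.
  apply: cderivE; rewrite jk.
  have -> : (z - a) ^+ (j - k.+1) * ((j - k.+1).+1%:R * hk z + (z - a) * cderiv hk z) =
    ((j - k.+1).+1%:R * (z - a) ^+ (j - k.+1) * (1 - 0)) * hk z + (z - a) ^+ (j - k.+1).+1 * cderiv hk z.
    by rewrite exprS; ring.
  apply: has_cderivM; last exact: analytic_has.
  apply: (@has_cderivX _ (fun z => z - a)).
  by apply: has_cderivB; [exact: has_cderiv_id|exact: has_cderiv_cst].
Qed.

Lemma cint_FTC (G dG : C -> C) : (forall t : R, 0 <= t <= 1 -> has_cderiv G t%:C%C (dG t%:C%C)) ->
  icts 0 1 (fun t => dG t%:C%C) -> cint 0 1 (fun t => dG t%:C%C) = G 1 - G 0.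
Proof.
move=> H cd.
have D (t : R) : 0 <= t <= 1 -> is_derive t 1 (fun s : R => cre (G s%:C%C)) (cre (dG t%:C%C)) /\
    is_derive t 1 (fun s : R => cim (G s%:C%C)) (cim (dG t%:C%C)).
  move=> t01; have := @is_derive_line R G 0 1 t (dG t%:C%C).
  under [fun s : R => cre _]eq_fun do rewrite add0r mulr1.
  under [fun s : R => cim _]eq_fun do rewrite add0r mulr1.
  by rewrite add0r !mulr1; apply; exact: H.
have real_FTC (F f : R -> R) : (forall t : R, 0 <= t <= 1 -> is_derive t 1 F (f t)) ->
    {within `[0, 1], continuous f} -> \int[lebesgue_measure]_(t in `[0, 1]) f t = F 1 - F 0.
  move=> dF cf; rewrite /Rintegral (@continuous_FTC2 _ f F 0 1) //.
  - have cF (t : R) : 0 <= t <= 1 -> {for t, continuous F}.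
      by move=> /dF[d _]; apply: differentiable_continuous; apply/derivable1_diffP.
    split.
    + by move=> t; rewrite in_itv /= => /andP[/ltW t0 /ltW t1]; have [] := dF t _; rewrite ?t0.
    + by apply: cvg_at_right_filter; apply: cF; rewrite lexx ler01.
    + by apply: cvg_at_left_filter; apply: cF; rewrite lexx ler01.
  - move=> t; rewrite in_itv /= => /andP[/ltW t0 /ltW t1].
    by rewrite derive1E; have [|_ ->] := dF t; rewrite ?t0.
apply: ceqP.
- rewrite creB; apply: (real_FTC (fun s => cre (G s%:C%C)) (fun s => cre (dG s%:C%C))).
    by move=> t /D[].
  exact: icts_re cd.
- rewrite cimB; apply: (real_FTC (fun s => cim (G s%:C%C)) (fun s => cim (dG s%:C%C))).
    by move=> t /D[].
  exact: icts_im cd.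
Qed.

Lemma disc_scale z (t : R) : disc z -> 0 <= t <= 1 -> disc (t%:C%C * z).
Proof.
move=> zd /andP[t0 t1]; rewrite /disc /= cabsM cabs_real ger0_norm //.
by rewrite (le_lt_trans _ zd) // ler_piMl ?cabs_ge0.
Qed.

Lemma icts_radial f z : analytic f -> disc z -> icts 0 1 (fun t => f (t%:C%C * z)).
Proof.
move=> H zd; apply: icts_comp.
  have := @icts_line R 0 1 0 z; under [fun s : R => _ + _]eq_fun do rewrite add0r.
  by [].
by move=> t t01; apply: analytic_ccont => //; exact: disc_scale.
Qed.

Lemma IopE f z : Iop f z = z * cint 0 1 (fun t => f (t%:C%C * z)).
Proof. by []. Qed.

(** [Iop] integrates along rays, so its increment is not an integral over [z, z + h]. Instead f(z)
    is written as the integral over [0, 1] of the derivative of t f(t z); the whole error is then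
    one integral whose integrand is O(|h|^2) by [taylor1] and Cauchy's estimate. *)
Lemma Iop_has_cderiv f z : analytic f -> disc z -> has_cderiv (Iop f) z (f z).
Proof.
move=> H zd; have zd' := zd; rewrite /disc /= in zd'.
have z0 := cabs_ge0 z.
pose r := (1 - cabs z) / 2.
have r0 : 0 < r by rewrite divr_gt0 // subr_gt0.
have zr : cabs z + r < 1 by rewrite /r; lra.
have [M M0 fM] := analytic_bounded H zr.
pose K := 2048 * M / r ^+ 2.
have K0 : 0 <= K by exact: divr_ge0 (mulr_ge0 (ler0n R 2048) M0) (exprn_ge0 _ (ltW r0)).
have tz (t : R) : 0 <= t <= 1 -> cabs (t%:C%C * z) <= cabs z.
  by move=> /andP[t0 t1]; rewrite cabsM cabs_real ger0_norm // ler_piMl.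
have Ht (t : R) : 0 <= t <= 1 -> hol f (t%:C%C * z) r.
  move=> /tz h; have := iffLR (analyticE f) H; apply: hol_sub; rewrite subr0; lra.
have Hb (t : R) : 0 <= t <= 1 -> forall w, cabs (w - t%:C%C * z) < r -> cabs (f w) <= M.
  move=> /tz h w wr; apply: fM; have := cabs_sub w (t%:C%C * z); lra.
have T1 (t : R) h : 0 <= t <= 1 -> cabs h < r / 8 ->
    cabs (f (t%:C%C * z + h) - f (t%:C%C * z) - cderiv f (t%:C%C * z) * h) <= K * cabs h ^+ 2.
  move=> t01 hr; apply: taylor1 (Ht t t01) (Hb t t01) _ hr => //.
  by rewrite subrr cabs0 divr_gt0.
move: K K0 T1 => K K0 T1.
have D1 (t : R) : 0 <= t <= 1 -> cabs (cderiv f (t%:C%C * z)) <= 8 * M / r.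
  by move=> t01; apply: cauchy_deriv => //; [exact: Ht|exact: Hb].
have cz : icts 0 1 (fun t : R => f (t%:C%C * z)) by exact: icts_radial.
have cdz : icts 0 1 (fun t : R => cderiv f (t%:C%C * z)).
  by apply: icts_radial => //; exact: analytic_cderiv.
have ct (c : C) : icts 0 1 (fun t : R => t%:C%C * c).
  have := @icts_line R 0 1 0 c; under [fun s : R => _ + _]eq_fun do rewrite add0r.
  by [].
have cdz2 : icts 0 1 (fun t : R => f (t%:C%C * z) + t%:C%C * z * cderiv f (t%:C%C * z)).
  by apply: ictsD => //; apply: ictsM.
have E : f z = cint 0 1 (fun t : R => f (t%:C%C * z) + t%:C%C * z * cderiv f (t%:C%C * z)).
  rewrite (@cint_FTC (fun u => u * f (u * z)) (fun u => f (u * z) + u * z * cderiv f (u * z))) //.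
    by rewrite !mul1r mul0r subr0.
  move=> t t01.
  have -> : f (t%:C%C * z) + t%:C%C * z * cderiv f (t%:C%C * z) =
    1 * f (t%:C%C * z) + t%:C%C * (cderiv f (t%:C%C * z) * (1 * z + t%:C%C * 0)) by ring.
  apply: has_cderivM; first exact: has_cderiv_id.
  apply: (@has_cderiv_comp _ (fun u => u * z) f).
    by apply: has_cderivM; [exact: has_cderiv_id|exact: has_cderiv_cst].
  by apply: analytic_has => //; exact: disc_scale.
(* L |h|^2 bounds the integrand: |z| K from the Taylor remainder, K + 8 M / r from the increment of
   f, using |h| <= 1. *)
pose L := cabs z * K + (K + 8 * M / r).
have L0 : 0 <= L by rewrite !addr_ge0 ?mulr_ge0 ?invr_ge0 ?(ltW r0).
apply: has_cderiv_le => e e0.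
pose d := Num.min (Num.min (r / 8) 1) (e / (2 * L + 1)).
have L1 : 0 < 2 * L + 1 by lra.
exists d.
  by rewrite !lt_min ltr01 (divr_gt0 e0 L1) (divr_gt0 r0 (ltr0n _ 8)).
move=> h; rewrite !lt_min => /andP[/andP[h1 h1'] h2].
have h0 := cabs_ge0 h.
have zhd : disc (z + h).
  by rewrite /disc /=; have := cabsD z h; lra.
have czh : icts 0 1 (fun t : R => f (t%:C%C * (z + h))) by exact: icts_radial.
have -> : Iop f (z + h) - Iop f z - f z * h =
   cint 0 1 (fun t : R => (z + h) * f (t%:C%C * (z + h)) - z * f (t%:C%C * z) -
                  h * (f (t%:C%C * z) + t%:C%C * z * cderiv f (t%:C%C * z))).
  rewrite !IopE {1}E -!cintZ // [cint _ _ _ * h]mulrC -cintZ //.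
  have c1 : icts 0 1 (fun t : R => (z + h) * f (t%:C%C * (z + h))) by apply: ictsM => //; exact: icts_cst.
  have c2 : icts 0 1 (fun t : R => z * f (t%:C%C * z)) by apply: ictsM => //; exact: icts_cst.
  have c3 : icts 0 1 (fun t : R => h * (f (t%:C%C * z) + t%:C%C * z * cderiv f (t%:C%C * z))) by apply: ictsM => //; exact: icts_cst.
  by rewrite -cintB // -cintB //; exact: ictsB.
have BD : cabs (cint 0 1 (fun t : R => (z + h) * f (t%:C%C * (z + h)) - z * f (t%:C%C * z) -
                  h * (f (t%:C%C * z) + t%:C%C * z * cderiv f (t%:C%C * z)))) <= 2 * (1 - 0) * (L * cabs h ^+ 2).
  apply: cint_bound => //.
    by apply: ictsB; [apply: ictsB; apply: ictsM => //; exact: icts_cst|apply: ictsM => //; exact: icts_cst].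
  move=> t t01.
  have -> : (z + h) * f (t%:C%C * (z + h)) - z * f (t%:C%C * z) - h * (f (t%:C%C * z) + t%:C%C * z * cderiv f (t%:C%C * z)) =
    z * (f (t%:C%C * z + t%:C%C * h) - f (t%:C%C * z) - cderiv f (t%:C%C * z) * (t%:C%C * h)) +
    h * ((f (t%:C%C * z + t%:C%C * h) - f (t%:C%C * z) - cderiv f (t%:C%C * z) * (t%:C%C * h)) + cderiv f (t%:C%C * z) * (t%:C%C * h)).
    by rewrite mulrDr; ring.
  have th : cabs (t%:C%C * h) <= cabs h.
    by case/andP: t01 => t0 t1; rewrite cabsM cabs_real ger0_norm // ler_piMl.
  have := T1 t (t%:C%C * h) t01 (le_lt_trans th h1).
  set X := f _ - _ - _ => XB.
  have XB' : cabs X <= K * cabs h ^+ 2.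
    by rewrite (le_trans XB) // ler_wpM2l // ler_pXn2r ?nnegrE ?cabs_ge0.
  rewrite (le_trans (cabsD _ _)) // !cabsM.
  have XB'' : cabs X <= K * cabs h.
    by rewrite (le_trans XB') // ler_wpM2l // expr2 ler_piMl // ltW.
  have Y : cabs (X + cderiv f (t%:C%C * z) * (t%:C%C * h)) <= (K + 8 * M / r) * cabs h.
    rewrite (le_trans (cabsD _ _)) // mulrDl lerD // cabsM.
    by apply: ler_pM; rewrite ?cabs_ge0 ?D1.
  have -> : L * cabs h ^+ 2 = cabs z * (K * cabs h ^+ 2) + cabs h * ((K + 8 * M / r) * cabs h).
    by rewrite /L; ring.
  by rewrite lerD // ler_wpM2l.
rewrite (le_trans BD) // subr0 mulr1 mulrA expr2 mulrA ler_wpM2r //.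
have : (2 * L + 1) * cabs h <= e by rewrite mulrC -ler_pdivlMr // ltW.
lra.
Qed.

Lemma analytic_Iop f : analytic f -> analytic (Iop f).
Proof. by move=> H z zd; exists (f z); exact: Iop_has_cderiv. Qed.

Lemma analytic_iter_Iop f m : analytic f -> analytic (iter m (@Iop R) f).
Proof. by move=> H; elim: m => //= m IH; exact: analytic_Iop. Qed.

Lemma cderivn_iter_Iop f m z : analytic f -> disc z -> cderivn m (iter m (@Iop R) f) z = f z.
Proof.
move=> H; elim: m z => //= m IH z zd.
rewrite -IH // /cderivn -iterS iterSr -/(cderivn m _) -/(cderivn m _).
apply: eq_cderivn => // w wd; apply: cderivE; apply: Iop_has_cderiv => //.
exact: analytic_iter_Iop.
Qed.

Lemma IopB f g z : analytic f -> analytic g -> disc z ->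
  Iop (fun z => f z - g z) z = Iop f z - Iop g z.
Proof.
by move=> hf hg zd; rewrite !IopE cintB ?mulrBr //; exact: icts_radial.
Qed.

Lemma eq_Iop f g z : (forall w, disc w -> f w = g w) -> disc z -> Iop f z = Iop g z.
Proof.
move=> fg zd; rewrite !IopE; congr (_ * _); apply: eq_cint => t t01.
exact/fg/disc_scale.
Qed.

Lemma iter_IopB f g m z : analytic f -> analytic g -> disc z ->
  iter m (@Iop R) (fun z => f z - g z) z = iter m (@Iop R) f z - iter m (@Iop R) g z.
Proof.
move=> hf hg; elim: m z => //= m IH z zd.
by rewrite (eq_Iop IH zd) IopB //; exact: analytic_iter_Iop.
Qed.

End DiscFunctions.

(** * Area integrals *)

Section Area.
Variable R : realType.
Local Notation C := R[i].
Implicit Types (f g : C -> C) (z w : C).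

Local Notation RR := (measurableTypeR R * measurableTypeR R)%type.

(** Named in order to carry its own measure and sigma-finiteness instances, as required when
    Tonelli's theorem is used on pairs of points of the plane. *)
Definition area : set RR -> \bar R := (@lebesgue_measure R \x @lebesgue_measure R)%E.

Let area0 : area set0 = 0%E. Proof. exact: measure0. Qed.

Let area_ge0 A : (0 <= area A)%E. Proof. exact: measure_ge0. Qed.

Let area_sigma_additive : semi_sigma_additive area.
Proof. exact: measure_semi_sigma_additive. Qed.

HB.instance Definition _ := isMeasure.Build _ _ _ area area0 area_ge0 area_sigma_additive.

Lemma area_box (a b c d : R) : a <= b -> c <= d ->
  area (`[a, b]%classic `*` `[c, d]%classic) = ((b - a) * (d - c))%:E.
Proof.
move=> ab cd; rewrite /area product_measure1E //.
have E (u v : R) : u <= v -> lebesgue_measure `[u, v]%classic = (v - u)%:E.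
  move=> uv; rewrite lebesgue_measure_itv /= lte_fin.
  by case: ltgtP uv => //= -> _; rewrite subrr.
by rewrite EFinM; congr (_ * _)%E; exact: E.
Qed.

Let area_sigma_finite : sigma_finite setT area.
Proof.
exists (fun n => `[- n%:R, n%:R]%classic `*` `[- n%:R, n%:R]%classic).
  apply/esym; rewrite predeqE => -[x y]; split=> // _.
  have h0 : 0 <= `|x| + `|y| by rewrite addr_ge0.
  exists (Num.bound (`|x| + `|y|)) => //=; have := archi_boundP h0.
  have := ler_norm x; have := ler_norm (- x); have := ler_norm y; have := ler_norm (- y).
  by rewrite !normrN !in_itv /=; have := normr_ge0 x; have := normr_ge0 y; move=> *; split; apply/andP; split; lra.
move=> n; split; first exact: measurableX.
by rewrite area_box ?ltry // ge0_cp.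
Qed.

HB.instance Definition _ := Measure_isSigmaFinite.Build _ _ _ area area_sigma_finite.

End Area.

(** * Measurability in the plane; areas by slices and dyadic layers *)

Section Measurability.
Variable R : realType.
Local Notation C := R[i].
Implicit Types (f g : C -> C) (z w : C).

Local Notation RR := (measurableTypeR R * measurableTypeR R)%type.
Local Notation area := (@area R).

Definition pt (xy : RR) : C := (xy.1 +i* xy.2)%C.
Definition DD : set RR := [set xy | disc (pt xy)].

Lemma area_intE (F : C -> R) :
  area_int F = (\int[area]_(xy in DD) (F (pt xy))%:E * (pi^-1)%:E)%E.
Proof.
rewrite /area_int; congr (_ * _)%E; congr integral.
apply/seteqP; split => -[x y]; rewrite /DD /= /disc /= /cabs /= => h.
  by rewrite -sqrtr1 ltr_sqrt.
by move: h; rewrite -[X in _ < X]sqrtr1 ltr_sqrt.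
Qed.

Lemma rat_near (x e : R) : 0 < e -> exists q : rat, x - e < ratr q < x + e.
Proof.
move=> e0; have [|q] := @rat_in_itvoo R (x - e) (x + e); first by lra.
by rewrite in_itv; exists q.
Qed.

Definition ropen (U : set RR) := forall xy, U xy -> exists2 e : R, 0 < e &
  forall xy' : RR, `|xy'.1 - xy.1| < e -> `|xy'.2 - xy.2| < e -> U xy'.

(** U is the union of the boxes it contains with rational centre and half side 1 / (n + 1). The
    other boxes are replaced by the empty set, so that the union runs over a countable type. *)
Lemma ropen_measurable U : ropen U -> measurable U.
Proof.
move=> oU.
have between (s t i : R) : s - i < t -> t < s + i -> t - i < s /\ s < t + i by lra.
have near2 (s s' t i e : R) : i * 2 < e -> t - i < s' -> s' < t + i -> s - i < t -> t < s + i ->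
  `|s' - s| < e by move=> *; rewrite ltr_norml; lra.
pose box (i : rat * rat * nat) : set RR :=
  `](ratr i.1.1 - i.2.+1%:R^-1), (ratr i.1.1 + i.2.+1%:R^-1)[%classic `*`
  `](ratr i.1.2 - i.2.+1%:R^-1), (ratr i.1.2 + i.2.+1%:R^-1)[%classic.
pose F i := if asbool (box i `<=` U) then box i else set0.
have -> : U = \bigcup_i F i.
  apply/seteqP; split => [[x y] Uxy|xy [i _]]; last first.
    by rewrite /F; case: asboolP => // h /h.
  have [e e0 he] := oU _ Uxy.
  have e2 : 0 <= 2 / e by rewrite divr_ge0 // ltW.
  pose n := Num.bound (2 / e).
  have n0 : 0 < n.+1%:R^-1 :> R by rewrite invr_gt0.
  have ne : n.+1%:R^-1 * 2 < e.
    rewrite mulrC ltr_pdivrMr // -ltr_pdivrMl // mulrC.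
    by apply: lt_le_trans (archi_boundP e2) _; rewrite ler_nat.
  have [q1 /andP[x1 x2]] := rat_near x n0.
  have [q2 /andP[y1 y2]] := rat_near y n0.
  exists (q1, q2, n) => //; rewrite /F; case: asboolP => [_|[]].
    have [B1 B2] := between _ _ _ x1 x2; have [B3 B4] := between _ _ _ y1 y2.
    by split; rewrite /= in_itv /=; apply/andP; split.
  move=> [x' y'] [] /=; rewrite !in_itv /= => /andP[a1 a2] /andP[b1 b2].
  by apply: he; [apply: (near2 _ _ _ _ _ ne a1 a2 x1 x2)|apply: (near2 _ _ _ _ _ ne b1 b2 y1 y2)].
apply: countable_bigcupT_measurable; first exact: countableP.
move=> i; rewrite /F; case: asboolP => _ //.
by apply: measurableX; exact: measurable_itv.
Qed.

Definition rcts (phi : C -> R) z := forall e : R, 0 < e -> exists2 d : R, 0 < d &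
  forall w, cabs (w - z) < d -> `|phi w - phi z| < e.

Lemma pt_dist (xy xy' : RR) (d : R) : `|xy'.1 - xy.1| < d / 2 -> `|xy'.2 - xy.2| < d / 2 ->
  cabs (pt xy' - pt xy) < d.
Proof.
by move=> h1 h2; rewrite (le_lt_trans (cabs_le _)) // creB cimB /= (splitr d) ltrD.
Qed.

Lemma ropen_DD : ropen DD.
Proof.
move=> xy; rewrite /DD /disc /= => h; exists ((1 - cabs (pt xy)) / 2).
  by rewrite divr_gt0 // subr_gt0.
move=> xy' h1 h2; have := pt_dist h1 h2; have := cabs_sub (pt xy') (pt xy); lra.
Qed.

Lemma measurable_DD : measurable DD.
Proof. apply: ropen_measurable; exact: ropen_DD. Qed.

Lemma rcts_measurable U phi : ropen U -> (forall xy, U xy -> rcts phi (pt xy)) ->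
  measurable_fun U (phi \o pt).
Proof.
move=> oU cphi; apply: (measurability _ (RGenOInfty.measurableE R)) => _ [_ [x ->] <-].
apply: ropen_measurable => xy [Uxy /=]; rewrite in_itv /= andbT => hx.
have [e e0 he] := oU _ Uxy.
have hx' : 0 < phi (pt xy) - x by rewrite subr_gt0.
have [d d0 hd] := cphi _ Uxy _ hx'.
exists (Num.min e (d / 2)); first by rewrite lt_min e0 divr_gt0.
move=> xy'; rewrite !lt_min => /andP[h1 h1'] /andP[h2 h2']; split; first exact: he.
rewrite /= in_itv /= andbT.
by have := hd _ (pt_dist h1' h2'); rewrite ltr_norml; lra.
Qed.

Lemma rcts_cabs f z : ccont f z -> rcts (fun w => cabs (f w)) z.
Proof.
move=> cf e e0; have [d d0 hd] := cf e e0; exists d => // w /hd h.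
rewrite ltr_norml; have := cabs_sub (f w) (f z); have := cabs_sub (f z) (f w).
rewrite (cabsBC (f z)); lra.
Qed.

Lemma measurable_cabs_pt : measurable_fun setT (fun xy : RR => cabs (pt xy)).
Proof.
apply: (@rcts_measurable setT (fun z => cabs z)).
  by move=> xy _; exists 1.
by move=> xy _; apply: (@rcts_cabs id); exact: ccont_id.
Qed.

Lemma measurable_analytic f : analytic f -> measurable_fun DD (fun xy => cabs (f (pt xy))).
Proof.
move=> H; apply: (@rcts_measurable DD (fun z => cabs (f z))); first exact: ropen_DD.
by move=> xy xyD; apply: rcts_cabs; apply: analytic_ccont.
Qed.

Lemma measurable_analytic_powR f (p : R) : analytic f ->
  measurable_fun DD (fun xy => cabs (f (pt xy)) `^ p).
Proof.
move=> H; exact: (measurableT_comp (measurable_powR p) (measurable_analytic H)).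
Qed.

Lemma measurable_gap : measurable_fun setT (fun xy : RR => 1 - cabs (pt xy)).
Proof. by apply: measurable_funB => //; exact: measurable_cabs_pt. Qed.

Lemma measurable_gap_powR (p : R) : measurable_fun setT (fun xy : RR => (1 - cabs (pt xy)) `^ p).
Proof. exact: (measurableT_comp (measurable_powR p) measurable_gap). Qed.

Lemma measurable_dist : measurable_fun setT (fun zu : RR * RR => cabs (pt zu.1 - pt zu.2)).
Proof.
have -> : (fun zu : RR * RR => cabs (pt zu.1 - pt zu.2)) =
   (fun xy : RR => cabs (pt xy)) \o (fun zu : RR * RR => (zu.1.1 - zu.2.1, zu.1.2 - zu.2.2) : RR).
  by apply/funext => -[[a b] [c d]].
apply: measurableT_comp; first exact: measurable_cabs_pt.
apply: measurable_fun_pair; apply: measurable_funB.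
- exact: (measurableT_comp measurable_fst measurable_fst).
- exact: (measurableT_comp measurable_fst measurable_snd).
- exact: (measurableT_comp measurable_snd measurable_fst).
- exact: (measurableT_comp measurable_snd measurable_snd).
Qed.

Lemma measurable_cone (K : R) :
  measurable [set zu : RR * RR | cabs (pt zu.1 - pt zu.2) <= K * (1 - cabs (pt zu.2))].
Proof.
have -> : [set zu : RR * RR | cabs (pt zu.1 - pt zu.2) <= K * (1 - cabs (pt zu.2))] =
  setT `&` (fun zu : RR * RR => cabs (pt zu.1 - pt zu.2) - K * (1 - cabs (pt zu.2))) @^-1` `]-oo, 0].
  by rewrite setTI; apply/seteqP; split => zu /=; rewrite in_itv /= subr_le0.
apply: (_ : measurable_fun setT _) => //; apply: measurable_funB; first exact: measurable_dist.
apply: measurable_funM => //.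
exact: (measurableT_comp measurable_gap measurable_snd).
Qed.

Lemma lebesgue_diam (B : set R) (tau : R) : measurable B -> 0 <= tau ->
  (forall y y', B y -> B y' -> `|y - y'| <= tau) ->
  (lebesgue_measure B <= (2 * tau)%:E)%E.
Proof.
move=> mB tau0 H; have [->|/set0P[y By]] := eqVneq B set0.
  by rewrite measure0 lee_fin mulr_ge0.
apply: (@le_trans _ _ (lebesgue_measure `[y - tau, y + tau]%classic)).
  apply: le_measure; rewrite ?inE //.
  by move=> y' By' /=; rewrite in_itv /=; have := H y y' By By'; rewrite ler_norml; lra.
rewrite lebesgue_measure_itv /= lte_fin; case: ifP => _; last by rewrite lee_fin mulr_ge0.
by rewrite -EFinB lee_fin; lra.
Qed.

Lemma integral_slices (s : R -> \bar R) (x0 L tau : R) : 0 <= L -> 0 <= tau ->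
  measurable_fun setT s -> (forall x, 0 <= s x)%E ->
  (forall x, s x <= (2 * tau)%:E)%E -> (forall x, ~ (`|x - x0| <= L) -> s x = 0%E) ->
  (\int[lebesgue_measure]_x s x <= (4 * tau * L)%:E)%E.
Proof.
move=> L0 tau0 ms s0 st sL.
apply: (@le_trans _ _ (\int[lebesgue_measure]_x ((2 * tau)%:E * (\1_(`[x0 - L, x0 + L]%classic : set R) x)%:E)))%E.
  apply: ge0_le_integral => //.
    apply: measurable_funeM; apply/measurable_EFinP.
    exact: measurable_indic.
  move=> x _; have [xL|xL] := pselect (`|x - x0| <= L); last first.
    by rewrite sL // mule_ge0 // lee_fin // mulr_ge0.
  rewrite indicE mem_set ?mule1 //= in_itv /=; move: xL; rewrite ler_norml; lra.
rewrite ge0_integralZl_EFin ?mulr_ge0 //; last first.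
  by apply/measurable_EFinP; exact: measurable_indic.
have E : lebesgue_measure `[x0 - L, x0 + L]%classic = (2 * L)%:E.
  rewrite lebesgue_measure_itv /= lte_fin; case: ltgtP => [_|h|h]; last 2 first.
  - by exfalso; lra.
  - by congr (_%:E); lra.
  - by rewrite -EFinB; congr (_%:E); ring.
have -> : (\int[lebesgue_measure]_x (\1_(`[x0 - L, x0 + L]%classic : set R) x)%:E)%E = (2 * L)%:E.
  by rewrite integral_indic // setIT; exact: E.
by rewrite -EFinM lee_fin; lra.
Qed.

(* Every section of A has diameter at most tau, hence length at most 2 tau. *)
Lemma area_slice1 (A : set RR) (x0 L tau : R) : measurable A -> 0 <= L -> 0 <= tau ->
  (forall x y, A (x, y) -> `|x - x0| <= L) ->
  (forall x y y', A (x, y) -> A (x, y') -> `|y - y'| <= tau) ->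
  (area A <= (4 * tau * L)%:E)%E.
Proof.
move=> mA L0 tau0 H1 H2; apply: (@integral_slices _ x0) => //.
- exact: measurable_fun_xsection.
- move=> x; apply: lebesgue_diam => //; first exact: measurable_xsection.
  by move=> y y'; rewrite /xsection /= !inE; exact: H2.
- move=> x nx; rewrite /= (_ : xsection A x = set0) ?measure0 //.
  by rewrite -subset0 => y; rewrite /xsection /= inE => /H1.
Qed.

Lemma area_slice2 (A : set RR) (y0 L tau : R) : measurable A -> 0 <= L -> 0 <= tau ->
  (forall x y, A (x, y) -> `|y - y0| <= L) ->
  (forall x x' y, A (x, y) -> A (x', y) -> `|x - x'| <= tau) ->
  (area A <= (4 * tau * L)%:E)%E.
Proof.
move=> mA L0 tau0 H1 H2.
(* Uniqueness of the product measure allows sections in the other direction. *)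
have -> : area A = (@lebesgue_measure R \x^ @lebesgue_measure R)%E A.
  apply: product_measure_unique => // B D mB mD; exact: product_measure2E.
apply: (@integral_slices _ y0) => //.
- exact: measurable_fun_ysection.
- move=> x; apply: lebesgue_diam => //; first exact: measurable_ysection.
  by move=> y y'; rewrite /ysection /= !inE; exact: H2.
- move=> x nx; rewrite /= (_ : ysection A x = set0) ?measure0 //.
  by rewrite -subset0 => y; rewrite /ysection /= inE => /H1.
Qed.

(** phi is dominated by the series of the [c k] times the indicators of the [A k], because each
    point has one layer where phi is at most [c k]; overlaps are harmless. The contributions K / 2^k
    sum to 2 K. *)
Lemma dyadic_bound (D : set RR) (A : (set RR)^nat) (phi : RR -> R) (c m : nat -> R) (K : R) :
  measurable D -> (forall k, measurable (A k)) -> measurable_fun D phi ->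
  (forall x, D x -> 0 <= phi x) -> (forall k, 0 <= c k) ->
  (forall k, (area (A k) <= (m k)%:E)%E) ->
  (forall k, c k * m k <= K / 2 ^+ k) ->
  (forall x, D x -> exists2 k, A k x & phi x <= c k) ->
  (\int[area]_(x in D) (phi x)%:E <= (2 * K)%:E)%E.
Proof.
move=> mD mA mphi phi0 c0 Am cm Dk.
have K0 : 0 <= K.
  have := cm 0%N; rewrite expr0 divr1; apply: le_trans; apply: mulr_ge0 => //.
  by rewrite -lee_fin (le_trans _ (Am 0%N)).
have mI k : measurable_fun D (fun x => ((c k)%:E * (\1_(A k) x)%:E)%E).
  apply: measurable_funeM; apply/measurable_EFinP/measurable_funTS.
  exact: measurable_indic.
apply: (@le_trans _ _ (\int[area]_(x in D) (\sum_(0 <= k <oo) ((c k)%:E * (\1_(A k) x)%:E))))%E.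
  apply: ge0_le_integral => //.
  - by apply/measurable_EFinP.
  - apply: ge0_emeasurable_sum => // k x _ _; by rewrite mule_ge0 // lee_fin.
  move=> x /Dk[k Akx phik].
  apply: (@le_trans _ _ ((c k)%:E * (\1_(A k) x)%:E)%E).
    by rewrite indicE mem_set // mule1 lee_fin.
  rewrite (nneseriesD1 (n := k)) //; last by move=> i _; rewrite mule_ge0 // lee_fin.
  by rewrite leeDl // nneseries_ge0 // => i _ _; rewrite mule_ge0 // lee_fin.
rewrite integral_nneseries //; last by move=> k x _; rewrite mule_ge0 // lee_fin.
(* Written as 0 + 2 K / 2^(k+1), the form in which [epsilon_trick] sums the series. *)
apply: (@le_trans _ _ (\sum_(0 <= k <oo) (0 + ((2 * K) / (2 ^ k.+1)%:R)%:E)))%E.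
  apply: lee_nneseries => [k _ _|k _].
    by apply: integral_ge0 => x _; rewrite mule_ge0 // lee_fin.
  rewrite add0e ge0_integralZl_EFin //; last first.
    by apply/measurable_EFinP/measurable_funTS; exact: measurable_indic.
  rewrite integral_indic // -/(area _).
  apply: (@le_trans _ _ ((c k)%:E * (m k)%:E)%E).
    apply: lee_wpmul2l; first by rewrite lee_fin.
    apply: (le_trans _ (Am k)).
    by apply: le_measure; rewrite ?inE //; apply: measurableI.
  rewrite -EFinM lee_fin (le_trans (cm k)) // natrX exprS.
  by rewrite le_eqVlt; apply/orP; left; apply/eqP; field; rewrite expf_neq0.
apply: (le_trans (epsilon_trick _ _ _)) => //; first by rewrite mulr_ge0.
by rewrite eseries0 ?add0e.
Qed.

End Measurability.

(** * Pointwise bounds by area integrals *)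

Section DerivativeEstimate.
Variable R : realType.
Local Notation C := R[i].
Implicit Types (f g : C -> C) (z w : C).

Local Notation RR := (measurableTypeR R * measurableTypeR R)%type.
Local Notation area := (@area R).
Local Notation DD := (@DD R).

Definition Dball (a : C) (r : R) : set RR := [set xy | cabs (pt xy - a) < r].
Lemma ropen_Dball a r : ropen (Dball a r).
Proof.
move=> xy; rewrite /Dball /= => h; exists ((r - cabs (pt xy - a)) / 2).
  by rewrite divr_gt0 // subr_gt0.
move=> xy' h1 h2; have := pt_dist h1 h2; have := cabs_triB (pt xy') a (pt xy); lra.
Qed.

Lemma measurable_Dball a r : measurable (Dball a r).
Proof. apply: ropen_measurable; exact: ropen_Dball. Qed.

Lemma Dball_DD a r : cabs a + r <= 1 -> Dball a r `<=` DD.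
Proof. by move=> ar xy; rewrite /Dball /DD /disc /=; have := cabs_sub (pt xy) a; lra. Qed.

Lemma powR2p (x p : R) : 0 < p -> 0 <= x -> (x `^ (2 / p)) `^ p = x ^+ 2.
Proof. by move=> p0 x0; rewrite -powRrM divfK ?gt_eqF // powR_mulrn. Qed.

(** The square of half side s around z has area 4 s^2 and lies in the disc of radius 2 s, so a lower
    bound for |f| on that disc is enough and no area of a disc is computed. *)
Lemma integral_box_lower f (p c s : R) (z : C) (B : set RR) :
  0 < s -> 0 <= c -> 0 < p -> measurable B -> B `<=` DD -> analytic f ->
  (forall w, cabs (w - z) <= 2 * s -> c <= cabs (f w)) ->
  (forall xy, cabs (pt xy - z) <= 2 * s -> B xy) ->
  ((c `^ p * (4 * s ^+ 2))%:E <= \int[area]_(xy in B) (cabs (f (pt xy)) `^ p)%:E)%E.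
Proof.
move=> s0 c0 p0 mB BD H fc Bz.
pose Q : set RR := `[cre z - s, cre z + s]%classic `*` `[cim z - s, cim z + s]%classic.
have mQ : measurable Q by apply: measurableX; exact: measurable_itv.
have Qz xy : Q xy -> cabs (pt xy - z) <= 2 * s.
  case: xy => x y [] /=; rewrite !in_itv /= => h1 h2.
  have -> : 2 * s = s + s by ring.
  rewrite (le_trans (cabs_le _)) // creB cimB /pt /=.
  have gen (a b : R) : a - s <= b <= a + s -> `|b - a| <= s by rewrite ler_norml; lra.
  by apply: lerD; apply: gen.
have mf : measurable_fun B (fun xy : RR => (cabs (f (pt xy)) `^ p)%:E).
  apply/measurable_EFinP; apply: measurable_funS (measurable_analytic_powR p H) => //.
  exact: measurable_DD.
apply: (@le_trans _ _ (\int[area]_(xy in Q) (cst (c `^ p)%:E xy))%E).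
  rewrite integral_cst // EFinM lee_wpmul2l ?lee_fin ?powR_ge0 //.
  have E : area Q = ((cre z + s - (cre z - s)) * (cim z + s - (cim z - s)))%:E.
    by rewrite /Q area_box //; lra.
  rewrite (_ : (4 * s ^+ 2) = (cre z + s - (cre z - s)) * (cim z + s - (cim z - s))); last by ring.
  by rewrite -E.
apply: (@le_trans _ _ (\int[area]_(xy in Q) (cabs (f (pt xy)) `^ p)%:E)%E).
  apply: ge0_le_integral => //.
  - by move=> xy _; rewrite lee_fin powR_ge0.
  - apply: measurable_funS mf => // xy /Qz; exact: Bz.
  - move=> xy /Qz/fc h; rewrite lee_fin ge0_ler_powR ?nnegrE ?(ltW p0) //.
    exact: cabs_ge0.
apply: ge0_subset_integral => //.
- by move=> xy _; rewrite lee_fin powR_ge0.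
- by move=> xy /Qz; exact: Bz.
Qed.

(* Take z nearly maximizing |f(z)| (r - |z - a|)^(2/p). Then |f| <= C |f(z)| on a disc around z
   of radius comparable to r - |z - a|, so by Cauchy's estimate |f| >= |f(z)| / 2 on a smaller
   comparable disc. This works for every p > 0. *)
Lemma subharmonic_bound (p : R) : 0 < p -> exists2 K : R, 0 < K &
  forall f (a : C) (r M : R), analytic f -> 0 < r -> cabs a + r <= 1 ->
   (forall z, cabs (z - a) < r -> cabs (f z) <= M) ->
   forall u, cabs (u - a) < r ->
   ((cabs (f u) `^ p * (r - cabs (u - a)) ^+ 2)%:E <=
     K%:E * \int[area]_(xy in Dball a r) (cabs (f (pt xy)) `^ p)%:E)%E.
Proof.
move=> p0.
(* 2 from the near maximality of z, 2^(2/p) from the distance to the circle being at least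
   halved. *)
pose C1 : R := 2 * 2 `^ (2 / p).
have C1_ge : 2 <= C1.
  rewrite /C1 ler_peMr // -[X in X <= _](powRr0 2) ler_powR ?ler1n //.
  by rewrite divr_ge0 // ltW.
(* Near z, f is Lipschitz with constant 64 C1 |f(z)| / d, so it varies by at most |f(z)| / 2 within
   distance 2 d / T. T is introduced by an equation to keep the arithmetic tactics from unfolding
   it. *)
have [T TE] : exists T : R, T = 256 * C1 by eexists.
have T1 : T / 64 = 4 * C1 by rewrite TE; field.
have T0 : 0 < T by lra.
(* One factor 2^p from S < 2 phi(z), another from |f| >= |f(z)| / 2, and T^2 / 4 from the area 4 (d
   / T)^2 of the square. *)
pose K : R := 4 `^ p * T ^+ 2 / 4.
have K0 : 0 < K by rewrite /K divr_gt0 // mulr_gt0 ?exprn_gt0 // powR_gt0.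
exists K => // f a r M H r0 ar fM u ur.
set I := (\int[area]_(xy in Dball a r) _)%E.
have I0 : (0 <= I)%E by apply: integral_ge0 => xy _; rewrite lee_fin powR_ge0.
pose phi w := cabs (f w) * (r - cabs (w - a)) `^ (2 / p).
have phip w : cabs (w - a) < r -> cabs (f w) `^ p * (r - cabs (w - a)) ^+ 2 = phi w `^ p.
  move=> wr; rewrite /phi powRM ?cabs_ge0 ?powR_ge0 // powR2p //; lra.
pose A := [set phi w | w in [set w | cabs (w - a) < r]].
have A0 : A !=set0 by exists (phi u), u.
have M0 : 0 <= M by apply: le_trans (cabs_ge0 _) (fM u ur).
have ubA : ubound A (M * r `^ (2 / p)).
  move=> _ [w /= wr <-]; rewrite /phi ler_pM ?cabs_ge0 ?powR_ge0 ?fM //.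
  rewrite ge0_ler_powR ?nnegrE ?divr_ge0 ?(ltW p0) ?(ltW r0) //; have := cabs_ge0 (w - a); lra.
have supA : has_sup A by split => //; eexists; exact: ubA.
set S := sup A.
have phiS w : cabs (w - a) < r -> phi w <= S.
  by move=> wr; apply: ub_le_sup; [eexists; exact: ubA|exists w].
have S0 : 0 <= S by apply: le_trans (phiS u ur); rewrite mulr_ge0 ?cabs_ge0 ?powR_ge0.
rewrite phip //.
have [Sle|Sgt] := lerP S 0.
  have -> : phi u = 0.
    by apply/eqP; rewrite eq_le (le_trans (phiS u ur) Sle) mulr_ge0 ?cabs_ge0 ?powR_ge0.
  by rewrite powR0 ?gt_eqF // mule_ge0 // lee_fin ltW.
have [_ [z /= zr <-] zS] := sup_adherent (divr_gt0 Sgt (ltr0n _ 2)) supA.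
pose d := r - cabs (z - a).
have d0 : 0 < d by rewrite subr_gt0.
have S2 : S < 2 * phi z by rewrite -/S in zS; lra.
have fz0 : 0 < cabs (f z).
  rewrite lt_def cabs_ge0 andbT; apply: contraTneq S2 => h.
  by rewrite /phi h mul0r mulr0 -leNgt.
have Hr : hol f a r by have := iffLR (analyticE f) H; apply: hol_sub; rewrite subr0 addrC; lra.
have fw w : cabs (w - z) < d / 2 -> cabs (f w) <= C1 * cabs (f z).
  move=> wz; have wa : d / 2 <= r - cabs (w - a).
    by move: wz; rewrite /d; have := cabs_triB w a z; clear; lra.
  have wr : cabs (w - a) < r by clear -wa d0; lra.
  have h1 := phiS w wr.
  have d2 : 0 < d / 2 by rewrite divr_gt0.
  have h2 : (d / 2) `^ (2 / p) <= (r - cabs (w - a)) `^ (2 / p).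
    by rewrite ge0_ler_powR ?nnegrE ?divr_ge0 ?(ltW p0) ?(ltW d0) //; clear -wa d2; lra.
  have h3 : cabs (f w) * (d / 2) `^ (2 / p) <= 2 * (cabs (f z) * d `^ (2 / p)).
    apply: le_trans (ltW (le_lt_trans h1 S2)).
    by rewrite ler_wpM2l ?cabs_ge0.
  have dE : d `^ (2 / p) = (d / 2) `^ (2 / p) * 2 `^ (2 / p).
    by rewrite -powRM ?(ltW d2) // divfK.
  rewrite -(ler_pM2r (powR_gt0 (2 / p) d2)) (le_trans h3) // dE /C1.
  by rewrite le_eqVlt; apply/orP; left; apply/eqP; ring.
have za w : cabs (w - z) < d -> cabs (w - a) < r.
  by have := cabs_triB w a z; rewrite /d; clear; lra.
have d4 : 0 < d / 4 by rewrite divr_gt0.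
have Hz : hol f z (d / 4) by apply: hol_sub Hr; rewrite /d; have := cabs_ge0 (z - a); clear -zr; lra.
have D1 w : cabs (w - z) < d / 4 -> cabs (cderiv f w) <= 8 * (C1 * cabs (f z)) / (d / 4).
  move=> wz; apply: cauchy_deriv => //.
    by apply: hol_sub Hr; move: wz d4; rewrite /d; have := cabs_triB w a z; clear; lra.
  by move=> v vw; apply: fw; have := cabs_triB v z w; clear -vw wz; lra.
pose s := d / T.
have s0 : 0 < s by rewrite divr_gt0.
have sT : s * T = d by rewrite /s divfK // gt_eqF.
have lower w : cabs (w - z) <= 2 * s -> cabs (f z) / 2 <= cabs (f w).
  move=> ws; have ws4 : cabs (w - z) < d / 4 by clear -ws sT s0 T1 C1_ge; nra.
  have zz : cabs (z - z) < d / 4 by rewrite subrr cabs0.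
  have := hol_lipschitz Hz D1 zz ws4.
  have -> : 2 * (8 * (C1 * cabs (f z)) / (d / 4)) * cabs (w - z) =
     cabs (f z) / 2 * ((T / 2) * cabs (w - z) / d).
    by rewrite TE; field; rewrite gt_eqF.
  have : T / 2 * cabs (w - z) / d <= 1 by rewrite ler_pdivrMr // mul1r; clear -ws sT T0; nra.
  move=> q1 q2.
  have q3 : cabs (f z) / 2 * (T / 2 * cabs (w - z) / d) <= cabs (f z) / 2.
    by rewrite ler_piMr // divr_ge0 // cabs_ge0.
  have := cabs_sub (f z) (f w); rewrite (cabsBC (f z)); clear -q2 q3; lra.
have := @integral_box_lower f p (cabs (f z) / 2) s z (Dball a r) s0.
rewrite -/I => /(_ _ p0 (@measurable_Dball a r) (Dball_DD ar) H lower) h.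
have {}h : (((cabs (f z) / 2) `^ p * (4 * s ^+ 2))%:E <= I)%E.
  apply: h; first by rewrite divr_ge0 ?cabs_ge0.
  move=> xy ws; apply: za; clear -ws sT s0 T1 C1_ge; nra.
apply: (@le_trans _ _ (K%:E * ((cabs (f z) / 2) `^ p * (4 * s ^+ 2))%:E)%E); last first.
  by rewrite lee_wpmul2l // lee_fin ltW.
rewrite -EFinM lee_fin.
apply: (@le_trans _ _ ((2 * phi z) `^ p)).
  rewrite ge0_ler_powR ?nnegrE ?(ltW p0) ?mulr_ge0 ?cabs_ge0 ?powR_ge0 //.
  by rewrite (le_trans (phiS u ur)) // ltW.
rewrite le_eqVlt; apply/orP; left; apply/eqP.
rewrite powRM ?mulr_ge0 ?cabs_ge0 ?powR_ge0 // -phip // -/d /K.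
have -> : (4 : R) `^ p = 2 `^ p * 2 `^ p by rewrite -powRM // -natrM.
have -> : cabs (f z) `^ p = (cabs (f z) / 2) `^ p * 2 `^ p by rewrite -powRM ?divfK // divr_ge0 ?cabs_ge0.
by rewrite -sT; field.
Qed.

(** Each derivative halves the radius: a disc of radius r / 2^(k+1) around w stays within distance r
    / 2^k of z, where the induction hypothesis holds. *)
Lemma cauchy_derivn k : exists2 K : R, 0 <= K &
  forall f (z : C) (r M : R), analytic f -> 0 < r -> cabs z + r <= 1 ->
   (forall w, cabs (w - z) < r -> cabs (f w) <= M) ->
   forall w, cabs (w - z) < r / 2 ^+ k -> cabs (cderivn k f w) <= K * M / r ^+ k.
Proof.
elim: k => [|k [K K0 IH]].
  by exists 1 => // f z r M _ _ _ fM w; rewrite !expr0 !divr1 mul1r; exact: fM.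
pose K' : R := 8 * K * 2 ^+ k.+1; exists K'; first by rewrite /K' !mulr_ge0 // exprn_ge0.
move=> f z r M H r0 zr fM w wz.
have k2 : 0 < 2 ^+ k :> R by rewrite exprn_gt0.
have rk : 0 < r / 2 ^+ k.+1 by rewrite divr_gt0 // exprn_gt0.
have E : r / 2 ^+ k = r / 2 ^+ k.+1 + r / 2 ^+ k.+1.
  by rewrite exprS; field; rewrite gt_eqF.
have -> : K' * M / r ^+ k.+1 = 8 * (K * M / r ^+ k) / (r / 2 ^+ k.+1).
  by rewrite /K' [r ^+ k.+1]exprS; field; rewrite !expf_neq0 ?gt_eqF.
apply: cauchy_deriv => //.
  have := iffLR (analyticE _) (analytic_cderivn k H); apply: hol_sub; rewrite subr0.
  have rk1 : r / 2 ^+ k <= r by rewrite ler_pdivrMr // ler_peMr ?(ltW r0) // exprn_ege1 // ler1n.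
  have := cabs_sub w z; lra.
move=> v vw; apply: (IH f z r M) => //; rewrite E (le_lt_trans (cabs_triB _ _ w)) //; lra.
Qed.

Lemma bounded_near f z : analytic f -> disc z -> exists M, forall w, cabs (w - z) < (1 - cabs z) / 2 -> cabs (f w) <= M.
Proof.
move=> H; rewrite /disc /= => zd; have [|M _ fM] := @analytic_bounded R f ((1 + cabs z) / 2) H; first by lra.
by exists M => w wz; apply: fM; have := cabs_sub w z; lra.
Qed.

(** [subharmonic_bound] controls |f| on the disc of radius d / 4 around z, then Cauchy's estimate
    controls the k-th derivative at z. The local bound M makes the supremum there finite and does
    not enter the constant. *)
Lemma derivn_bound (p : R) k : 0 < p -> exists2 K : R, 0 < K &
  forall f z, analytic f -> disc z ->
   ((cabs (cderivn k f z) `^ p * (1 - cabs z) `^ (k%:R * p + 2))%:E <=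
     K%:E * \int[area]_(xy in Dball z ((1 - cabs z) / 2)) (cabs (f (pt xy)) `^ p)%:E)%E.
Proof.
move=> p0; have [K0 K0_gt sub] := subharmonic_bound p0; have [c c0 cau] := cauchy_derivn k.
(* The summand 1 keeps K positive when c = 0. *)
pose K := (c * 4 ^+ k) `^ p * 16 * K0 + 1.
have cp0 : 0 <= (c * 4 ^+ k) `^ p * 16 * K0 by rewrite !mulr_ge0 ?powR_ge0 // ltW.
have Kgt : 0 < K by rewrite /K; lra.
exists K => // f z H zd; have zd' := zd; rewrite /disc /= in zd'.
set d := 1 - cabs z; have d0 : 0 < d by rewrite subr_gt0.
have [M fM] := bounded_near H zd.
have d2 : 0 < d / 2 by rewrite divr_gt0.
have zd2 : cabs z + d / 2 <= 1 by rewrite /d; have := cabs_ge0 z; lra.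
have S := sub f z (d / 2) M H d2 zd2 fM.
set I := (\int[area]_(xy in Dball z (d / 2)) _)%E in S *.
have I0 : (0 <= I)%E by apply: integral_ge0 => xy _; rewrite lee_fin powR_ge0.
case: (I) S I0 => [r| |] S; last by [].
- rewrite lee_fin => r0; rewrite -EFinM lee_fin.
  have d4 : 0 < d / 4 by rewrite divr_gt0.
  pose N := (16 * K0 * r / d ^+ 2) `^ p^-1.
  have N0 : 0 <= 16 * K0 * r / d ^+ 2.
    by rewrite divr_ge0 ?exprn_ge0 ?(ltW d0) // !mulr_ge0 // ltW.
  have Np : N `^ p = 16 * K0 * r / d ^+ 2.
    by rewrite /N -powRrM mulVf ?gt_eqF // powRr1.
  have fN w : cabs (w - z) < d / 4 -> cabs (f w) <= N.
    move=> wz; have := S w; rewrite -EFinM lee_fin.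
    have -> : cabs (w - z) < d / 2 by clear -wz d0; lra.
    move=> /(_ isT) h.
    have h1 : cabs (f w) `^ p <= N `^ p.
      rewrite Np ler_pdivlMr ?exprn_gt0 //.
      have : cabs (f w) `^ p * (d / 4) ^+ 2 <= K0 * r.
        apply: le_trans h; apply: ler_wpM2l; first exact: powR_ge0.
        by rewrite ler_pXn2r ?nnegrE //; clear -wz d0; lra.
      by rewrite expr_div_n; clear; lra.
    rewrite leNgt; apply/negP => /(gt0_ltr_powR p0) h2.
    have := h2 _ _; rewrite !nnegrE cabs_ge0 powR_ge0 => /(_ isT isT).
    by rewrite ltNge h1.
  have := cau f z (d / 4) N H d4 _ fN z; rewrite subrr cabs0.
  have -> : cabs z + d / 4 <= 1 by lra.
  rewrite divr_gt0 ?exprn_gt0 // => /(_ isT isT) h.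
  have E : c * N / (d / 4) ^+ k = c * 4 ^+ k * N / d ^+ k.
    by rewrite expr_div_n; field; rewrite !expf_neq0 // gt_eqF.
  have dk : d ^+ k > 0 by rewrite exprn_gt0.
  apply: (@le_trans _ _ ((c * 4 ^+ k * N / d ^+ k) `^ p * d `^ (k%:R * p + 2))).
    rewrite ler_wpM2r ?powR_ge0 // -E ge0_ler_powR ?nnegrE ?cabs_ge0 ?(ltW p0) //.
    exact: le_trans (cabs_ge0 _) h.
  have -> : d `^ (k%:R * p + 2) = (d ^+ k) `^ p * d ^+ 2.
    rewrite powRD; last by apply/implyP => _; rewrite gt_eqF.
    by rewrite powRrM !powR_mulrn // ltW.
  rewrite mulrA -powRM ?(ltW dk) //; last first.
    by rewrite divr_ge0 ?(ltW dk) // !mulr_ge0 ?exprn_ge0 ?powR_ge0.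
  rewrite divfK ?gt_eqF // powRM ?powR_ge0 ?mulr_ge0 ?exprn_ge0 // Np.
  rewrite /K; move: ((c * 4 ^+ k) `^ p) => X.
  have -> : X * (16 * K0 * r / d ^+ 2) * d ^+ 2 = X * 16 * K0 * r by field; rewrite gt_eqF.
  by move: (X * 16 * K0) => Y; rewrite mulrDl mul1r lerDl.
- by move=> _; rewrite mulry gtr0_sg // mul1e leey.
Qed.

End DerivativeEstimate.

(** * Integrals over discs and cones *)

Section BoundaryIntegrals.
Variable R : realType.
Local Notation C := R[i].
Implicit Types (f g : C -> C) (z w : C).

Local Notation RR := (measurableTypeR R * measurableTypeR R)%type.
Local Notation area := (@area R).
Local Notation DD := (@DD R).

Definition cball (w : C) (L : R) : set RR := [set xy | cabs (pt xy - w) <= L].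
Lemma measurable_sublevel (phi : C -> R) (b : R) : (forall z, rcts phi z) ->
  measurable [set xy : RR | phi (pt xy) <= b].
Proof.
move=> cphi; have := @rcts_measurable R setT phi _ (fun xy _ => cphi (pt xy)).
have o : ropen [set: RR] by move=> xy _; exists 1.
move=> /(_ o) m; have -> : [set xy : RR | phi (pt xy) <= b] = setT `&` (phi \o @pt R) @^-1` `]-oo, b].
  by rewrite setTI; apply/seteqP; split => xy /=; rewrite in_itv.
by apply: m => //; exact: measurable_itv.
Qed.

Lemma rcts_lin (f : C -> C) (c e : R) : (forall z, ccont f z) -> forall z, rcts (fun z => c * cabs (f z) + e) z.
Proof.
move=> cf z k k0; pose K := `|c| + 1; have K0 : 0 < K by rewrite /K ltr_wpDl.
have [d d0 hd] := rcts_cabs (cf z) (divr_gt0 k0 K0); exists d => // w /hd h.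
have -> : c * cabs (f w) + e - (c * cabs (f z) + e) = c * (cabs (f w) - cabs (f z)) by ring.
rewrite normrM (@le_lt_trans _ _ (K * `|cabs (f w) - cabs (f z)|)) //.
  by rewrite ler_wpM2r // /K lerDl.
by rewrite mulrC -ltr_pdivlMr.
Qed.

Lemma ccont_sub (c z : C) : ccont (fun w => w - c) z.
Proof. by apply: ccontD; [exact: ccont_id|exact: ccont_cst]. Qed.

Lemma measurable_cball w L : measurable (cball w L).
Proof.
have -> : cball w L = [set xy : RR | 1 * cabs (pt xy - w) + 0 <= L].
  by apply/seteqP; split => xy; rewrite /cball /= mul1r addr0.
by apply: (@measurable_sublevel (fun z => 1 * cabs (z - w) + 0)); apply: rcts_lin; exact: ccont_sub.
Qed.

Lemma measurable_gap_lt (t : R) : measurable [set xy : RR | 1 - cabs (pt xy) <= t].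
Proof.
have -> : [set xy : RR | 1 - cabs (pt xy) <= t] = [set xy : RR | (-1) * cabs (pt xy) + 1 <= t].
  by apply/seteqP; split => xy /=; rewrite mulN1r addrC.
by apply: (@measurable_sublevel (fun z => -1 * cabs z + 1)); apply: (@rcts_lin id); exact: ccont_id.
Qed.

Lemma cball_re (x y : R) w L : cball w L (x, y) -> `|x - cre w| <= L.
Proof. by apply: le_trans; have := cre_le (pt (x, y) - w); rewrite creB. Qed.

Lemma cball_im (x y : R) w L : cball w L (x, y) -> `|y - cim w| <= L.
Proof. by apply: le_trans; have := cim_le (pt (x, y) - w); rewrite cimB. Qed.

Lemma cball_diam_im (x y y' : R) w L : cball w L (x, y) -> cball w L (x, y') -> `|y - y'| <= 2 * L.
Proof. by move=> /cball_im + /cball_im; rewrite !ler_norml; lra. Qed.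

Lemma area_cball (A : set RR) w L : 0 <= L -> measurable A -> A `<=` cball w L ->
  (area A <= (8 * L ^+ 2)%:E)%E.
Proof.
move=> L0 mA AL; have -> : 8 * L ^+ 2 = 4 * (2 * L) * L by ring.
apply: (@area_slice1 _ _ (cre w)) => //; first by rewrite mulr_ge0.
- by move=> x y /AL; exact: cball_re.
- by move=> x y y' /AL h /AL; exact: cball_diam_im.
Qed.

Lemma area_setU (A B : set RR) (a b : \bar R) : measurable A -> measurable B ->
  (area A <= a -> area B <= b -> area (A `|` B) <= a + b)%E.
Proof.
move=> mA mB Aa Bb; apply: (@le_trans _ _ (area A + area B)%E); last exact: leeD.
exact: measureU2.
Qed.

(** x^2 - x'^2 < 2 t while x + x' >= 1: where |x| >= 1/2, horizontal sections of a thin annulus are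
    short. *)
Lemma annulus_diam (x x' y t : R) : 0 <= t -> 1 / 2 <= x -> 1 / 2 <= x' ->
  x ^+ 2 + y ^+ 2 < 1 -> 1 - 2 * t <= x' ^+ 2 + y ^+ 2 -> x - x' <= 2 * t.
Proof.
move=> t0 h1 h2 h3 h4; have h5 : (x - x') * (x + x') <= 2 * t by nra.
have [h|h] := lerP (x - x') 0; last by nra.
by rewrite (le_trans h) // mulr_ge0.
Qed.

Lemma small_center (x y t : R) : - (1 / 2) <= x -> x <= 1 / 2 -> - (1 / 2) <= y -> y <= 1 / 2 ->
  1 - 2 * t <= x ^+ 2 + y ^+ 2 -> 1 / 4 <= t.
Proof. by move=> *; nra. Qed.

Lemma powR_sqr_half (x : R) : 0 <= x -> (x ^+ 2) `^ (1 / 2) = x.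
Proof.
by move=> x0; rewrite -powR_mulrn // -powRrM (_ : 2%:R * (1 / 2) = 1) ?powRr1 //; lra.
Qed.

Lemma powR_half (x : R) : 0 < x -> x `^ (- (1 / 2)) * x = x `^ (1 / 2).
Proof.
move=> x0; rewrite -[X in _ * X = _](powRr1 (ltW x0)) -powRD; last by apply/implyP => _; rewrite gt_eqF.
by congr (_ `^ _); lra.
Qed.

Lemma pt_annulus (x y t : R) : DD (x, y) -> 1 - cabs (pt (x, y)) <= t ->
  x ^+ 2 + y ^+ 2 < 1 /\ 1 - 2 * t <= x ^+ 2 + y ^+ 2.
Proof.
rewrite /DD /disc /= => h1 h2; have := cabs_sqr (pt (x, y)); rewrite /= => <-.
have := cabs_ge0 (pt (x, y)); nra.
Qed.

(* The part of A in {x >= 1/2} has thin sections in the x direction, and so on for the four sides *)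
Lemma area_annulus (A : set RR) w L t : 0 <= L <= 3 -> 0 <= t -> measurable A ->
  A `<=` cball w L -> A `<=` DD -> (forall xy, A xy -> 1 - cabs (pt xy) <= t) ->
  (area A <= (128 * t * L)%:E)%E.
Proof.
move=> /andP[L0 L3] t0 mA AL AD At.
pose S1 := A `&` [set xy : RR | 1 / 2 <= xy.1].
pose S2 := A `&` [set xy : RR | xy.1 <= - (1 / 2)].
pose S3 := A `&` [set xy : RR | 1 / 2 <= xy.2].
pose S4 := A `&` [set xy : RR | xy.2 <= - (1 / 2)].
pose S5 := A `&` [set xy : RR | - (1 / 2) <= xy.1] `&` [set xy : RR | xy.1 <= 1 / 2]
             `&` [set xy : RR | - (1 / 2) <= xy.2] `&` [set xy : RR | xy.2 <= 1 / 2].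
have mge1 (c : R) : measurable [set xy : RR | c <= xy.1].
  have := @measurable_fst _ _ (measurableTypeR R) (measurableTypeR R) measurableT _ (@measurable_itv R `[c, +oo[).
  by rewrite setTI; congr measurable; apply/seteqP; split => xy /=; rewrite in_itv /= andbT.
have mle1 (c : R) : measurable [set xy : RR | xy.1 <= c].
  have := @measurable_fst _ _ (measurableTypeR R) (measurableTypeR R) measurableT _ (@measurable_itv R `]-oo, c]).
  by rewrite setTI; congr measurable; apply/seteqP; split => xy /=; rewrite in_itv.
have mge2 (c : R) : measurable [set xy : RR | c <= xy.2].
  have := @measurable_snd _ _ (measurableTypeR R) (measurableTypeR R) measurableT _ (@measurable_itv R `[c, +oo[).
  by rewrite setTI; congr measurable; apply/seteqP; split => xy /=; rewrite in_itv /= andbT.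
have mle2 (c : R) : measurable [set xy : RR | xy.2 <= c].
  have := @measurable_snd _ _ (measurableTypeR R) (measurableTypeR R) measurableT _ (@measurable_itv R `]-oo, c]).
  by rewrite setTI; congr measurable; apply/seteqP; split => xy /=; rewrite in_itv.
have m1 : measurable S1 by apply: measurableI.
have m2 : measurable S2 by apply: measurableI.
have m3 : measurable S3 by apply: measurableI.
have m4 : measurable S4 by apply: measurableI.
have m5 : measurable S5 by do 4 (apply: measurableI => //).
have E8 : 8 * t * L = 4 * (2 * t) * L by ring.
have t2 : 0 <= 2 * t by rewrite mulr_ge0.
have sq (x : R) : x ^+ 2 = (- x) ^+ 2 by rewrite sqrrN.
have b1 : (area S1 <= (8 * t * L)%:E)%E.
  rewrite E8; apply: (@area_slice2 _ _ (cim w)) => //.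
    by move=> x y [/AL/cball_im].
  move=> x x' y [Ax /= x2] [Ax' /= x2'].
  have [p1 p2] := pt_annulus (AD _ Ax) (At _ Ax); have [q1 q2] := pt_annulus (AD _ Ax') (At _ Ax').
  by have := annulus_diam t0 x2 x2' p1 q2; have := annulus_diam t0 x2' x2 q1 p2; rewrite ler_norml; clear; lra.
have b2 : (area S2 <= (8 * t * L)%:E)%E.
  rewrite E8; apply: (@area_slice2 _ _ (cim w)) => //.
    by move=> x y [/AL/cball_im].
  move=> x x' y [Ax /= x2] [Ax' /= x2'].
  have [p1 p2] := pt_annulus (AD _ Ax) (At _ Ax); have [q1 q2] := pt_annulus (AD _ Ax') (At _ Ax').
  rewrite sq in p1 p2; rewrite sq in q1 q2.
  have {}x2 : 1 / 2 <= - x by rewrite lerNr.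
  have {}x2' : 1 / 2 <= - x' by rewrite lerNr.
  by have := annulus_diam t0 x2 x2' p1 q2; have := annulus_diam t0 x2' x2 q1 p2; rewrite ler_norml; clear; lra.
have b3 : (area S3 <= (8 * t * L)%:E)%E.
  rewrite E8; apply: (@area_slice1 _ _ (cre w)) => //.
    by move=> x y [/AL/cball_re].
  move=> x y y' [Ax /= x2] [Ax' /= x2'].
  have [p1 p2] := pt_annulus (AD _ Ax) (At _ Ax); have [q1 q2] := pt_annulus (AD _ Ax') (At _ Ax').
  rewrite addrC in p1 p2; rewrite addrC in q1 q2.
  by have := annulus_diam t0 x2 x2' p1 q2; have := annulus_diam t0 x2' x2 q1 p2; rewrite ler_norml; clear; lra.
have b4 : (area S4 <= (8 * t * L)%:E)%E.
  rewrite E8; apply: (@area_slice1 _ _ (cre w)) => //.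
    by move=> x y [/AL/cball_re].
  move=> x y y' [Ax /= x2] [Ax' /= x2'].
  have [p1 p2] := pt_annulus (AD _ Ax) (At _ Ax); have [q1 q2] := pt_annulus (AD _ Ax') (At _ Ax').
  rewrite addrC sq in p1 p2; rewrite addrC sq in q1 q2.
  have {}x2 : 1 / 2 <= - y by rewrite lerNr.
  have {}x2' : 1 / 2 <= - y' by rewrite lerNr.
  by have := annulus_diam t0 x2 x2' p1 q2; have := annulus_diam t0 x2' x2 q1 p2; rewrite ler_norml; clear; lra.
(* The central square meets the annulus only if t >= 1/4, and then 8 L^2 <= 24 L <= 96 t L because L
   <= 3. *)
have b5 : (area S5 <= (96 * t * L)%:E)%E.
  have [->|/set0P[[x y] [[[[Axy /= h1] /= h2] /= h3] /= h4]]] := eqVneq S5 set0.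
    by rewrite measure0 lee_fin !mulr_ge0.
  have {h1 h2 h3 h4}t4 : 1 / 4 <= t.
    have [_] := pt_annulus (AD _ Axy) (At _ Axy).
    exact: small_center.
  apply: (le_trans (@area_cball S5 w L L0 m5 _)).
    by move=> xy [[[[/AL]]]].
  by rewrite lee_fin; clear -t4 L0 L3; nra.
apply: (@le_trans _ _ (area (((S1 `|` S2) `|` (S3 `|` S4)) `|` S5))).
  apply: le_measure; rewrite ?inE //; first by do ! apply: measurableU.
  move=> [x y] Axy.
  have [h1|h1] := lerP (1 / 2) x; first by do 3 left.
  have [h2|h2] := lerP x (- (1 / 2)); first by left; left; right.
  have [h3|h3] := lerP (1 / 2) y; first by left; right; left.
  have [h4|h4] := lerP y (- (1 / 2)); first by left; right; right.
  by right; do ! split => //=; exact: ltW.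
have -> : 128 * t * L = ((8 * t * L + 8 * t * L) + (8 * t * L + 8 * t * L)) + 96 * t * L by ring.
have m12 := measurableU _ _ m1 m2; have m34 := measurableU _ _ m3 m4.
rewrite !EFinD.
exact: (area_setU (measurableU _ _ m12 m34) m5 (area_setU m12 m34 (area_setU m1 m2 b1 b2) (area_setU m3 m4 b3 b4)) b5).
Qed.

(** Inside the ball, the layer where 1 - |z| is about L / 4^k has area O(L^2 / 4^k), so weight times
    area is O(L^(3/2) / 2^k); the ratio 4 leaves the 2^k that [dyadic_bound] expects. The range L <=
    3 covers the radii 3 d(u) that arise from cones. *)
Lemma integral_gap_cball_1024 (w : C) (L : R) : 0 < L <= 3 ->
  (\int[area]_(xy in DD `&` cball w L) ((1 - cabs (pt xy)) `^ (- (1 / 2)))%:E <=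
    (1024 * L `^ (3 / 2))%:E)%E.
Proof.
move=> /andP[L0 L3].
have -> : 1024 * L `^ (3 / 2) = 2 * (512 * L `^ (3 / 2)) by rewrite mulrA -natrM.
(* The index is shifted by one: for the least k with L / 4^k <= 1 - |z|, minimality gives 1 - |z| <=
   L / 4^(k-1) and puts z in [A k]. The shift turns the constant 128 of [area_annulus] into 512. *)
pose A k : set RR := if k is k'.+1 then DD `&` cball w L `&` [set xy | 1 - cabs (pt xy) <= L / 4 ^+ k']
   else DD `&` cball w L.
have m0 : measurable (DD `&` cball w L) by apply: measurableI; [exact: measurable_DD|exact: measurable_cball].
have mA k : measurable (A k).
  by case: k => [|k] //=; apply: measurableI => //; exact: measurable_gap_lt.
have p4 k : 0 < 4 ^+ k :> R by rewrite exprn_gt0.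
apply: (@dyadic_bound _ _ A _ (fun k => (L / 4 ^+ k) `^ (- (1 / 2))) (fun k => 512 * (L / 4 ^+ k) * L)) => //.
- apply: measurable_funTS; exact: measurable_gap_powR.
- by move=> xy _; exact: powR_ge0.
- by move=> k; exact: powR_ge0.
- case=> [|k] /=.
    apply: (le_trans (@area_cball _ w L (ltW L0) m0 _)); first by move=> xy [].
    rewrite lee_fin expr0 divr1; nra.
  have h := @area_annulus (A k.+1) w L (L / 4 ^+ k).
  apply: (le_trans (h _ _ (mA k.+1) _ _ _)).
  + by rewrite L3 ltW.
  + by rewrite divr_ge0 ?ltW.
  + by move=> xy [[]].
  + by move=> xy [[]].
  + by move=> xy [_].
  + by rewrite lee_fin le_eqVlt; apply/orP; left; apply/eqP; rewrite exprS; field; rewrite gt_eqF.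
- move=> k.
  have Lk : 0 < L / 4 ^+ k by rewrite divr_gt0.
  have -> : (L / 4 ^+ k) `^ (- (1 / 2)) * (512 * (L / 4 ^+ k) * L) =
     512 * ((L / 4 ^+ k) `^ (- (1 / 2)) * (L / 4 ^+ k)) * L by ring.
  rewrite powR_half //.
  have -> : 3 / 2 = 1 / 2 + 1 :> R by lra.
  rewrite [L `^ (1 / 2 + 1)]powRD; last by apply/implyP => _; rewrite gt_eqF.
  rewrite (powRr1 (ltW L0)) powRM ?(ltW L0) ?invr_ge0 ?(ltW (p4 k)) //.
  have -> : (4 ^+ k)^-1 `^ (1 / 2) = (2 ^+ k)^-1 :> R.
    have -> : (4 ^+ k)^-1 = (2 ^+ k)^-1 ^+ 2 :> R.
      have -> : (4 : R) = 2 ^+ 2 by rewrite expr2; lra.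
      by rewrite exprVn -!exprM mulnC.
    by rewrite powR_sqr_half // invr_ge0 exprn_ge0.
  by rewrite le_eqVlt; apply/orP; left; apply/eqP; ring.
- move=> xy xyD; have [/= d0 _] := xyD; rewrite /DD /disc /= -subr_gt0 in d0.
  have ex : exists k, L / 4 ^+ k <= 1 - cabs (pt xy).
    have h0 : 0 <= L / (1 - cabs (pt xy)) by rewrite divr_ge0 ?ltW.
    exists (Num.bound (L / (1 - cabs (pt xy)))); set n := Num.bound _.
    rewrite ler_pdivrMr // mulrC -ler_pdivrMr //.
    apply: le_trans (ltW (archi_boundP h0)) _; rewrite -/n -natrX ler_nat ltnW // ltn_expl //.
  exists (ex_minn ex).
    case: ex_minnP => -[|k] hk kmin //=; split => //=.
    by rewrite leNgt; apply/negP => /ltW /kmin; rewrite ltnn.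
  case: ex_minnP => k hk _.
  have Lk : 0 < L / 4 ^+ k by rewrite divr_gt0.
  rewrite !powRN lef_pV2 ?posrE ?powR_gt0 //.
  by rewrite ge0_ler_powR ?nnegrE ?(ltW Lk) ?(ltW d0).
Qed.

Lemma integral_gap_cball : exists2 K : R, 0 < K & forall (w : C) (L : R), 0 < L <= 3 ->
  (\int[area]_(xy in DD `&` cball w L) ((1 - cabs (pt xy)) `^ (- (1 / 2)))%:E <=
    (K * L `^ (3 / 2))%:E)%E.
Proof. by exists 1024; [rewrite ltr0n|exact: integral_gap_cball_1024]. Qed.

End BoundaryIntegrals.

(** * Cones, Tonelli's theorem and the kernel integral *)

Section Cones.
Variable R : realType.
Local Notation C := R[i].
Implicit Types (f g : C -> C) (z w : C).

Local Notation RR := (measurableTypeR R * measurableTypeR R)%type.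
Local Notation area := (@area R).
Local Notation DD := (@DD R).

Lemma integral_indicM (D : set RR) (phi : RR -> R) :
  (\int[area]_(x in D) (phi x)%:E = \int[area]_x (phi x * \1_D x)%:E)%E.
Proof.
rewrite integral_mkcond; apply: eq_integral => x _; rewrite patchE indicE.
by case: ifP => _; rewrite ?mulr1 ?mulr0.
Qed.

(** The aperture 3 comes from discs around points w of [0, z]: if |u - w| < d(w) / 2, then |z - u|
    <= d(w) + d(w) / 2 and d(u) >= d(w) / 2, hence |z - u| <= 3 d(u). *)
Definition cone (z : C) : set RR := [set xy | cabs (z - pt xy) <= 3 * (1 - cabs (pt xy))].

Lemma measurable_cone_at z : measurable (cone z).
Proof.
pose phi w := 1 * cabs (w - z) + 0 + (3 * cabs w + -3).
have -> : cone z = [set xy : RR | phi (pt xy) <= 0].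
  apply/seteqP; split => xy; rewrite /cone /phi /= cabsBC; lra.
apply: measurable_sublevel => w e e0; have e2 : 0 < e / 2 by rewrite divr_gt0.
have [d d0 hd] := rcts_lin 1 0 (fun w => @ccont_sub R z w) w e2.
have [d' d'0 hd'] := @rcts_lin R id 3 (-3) (fun w => @ccont_id R w) w _ e2.
exists (Num.min d d'); first by rewrite lt_min d0.
move=> v; rewrite lt_min => /andP[/hd h /hd' h'].
rewrite /phi (splitr e).
have -> (a b a' b' : R) : a + b - (a' + b') = (a - a') + (b - b') by ring.
by rewrite (le_lt_trans (ler_normD _ _)) // ltrD.
Qed.

Lemma powR_M3 (K d : R) : 0 < d -> 0 <= K -> d `^ (- (3 / 2)) * (K * (3 * d) `^ (3 / 2)) = K * 3 `^ (3 / 2).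
Proof.
move=> d0 K0; rewrite powRM ?(ltW d0) // powRN.
by field; rewrite gt_eqF // powR_gt0.
Qed.

(** The points v whose cone contains u form the ball of radius 3 d(u) around u, over which
    d(v)^(-1/2) has integral O(d(u)^(3/2)) by [integral_gap_cball]. Measurability in v is part of
    the conclusion because [main_estimate] integrates [X]. *)
Lemma tonelli_cone : exists2 K : R, 0 < K & forall h : RR -> R, measurable_fun DD h -> (forall xy, DD xy -> 0 <= h xy) ->
  let X (v : RR) := (\int[area]_(u in DD `&` cone (pt v)) (h u * (1 - cabs (pt u)) `^ (- (3 / 2)))%:E)%E in
  measurable_fun DD (fun v => ((1 - cabs (pt v)) `^ (- (1 / 2)))%:E * X v)%E /\
  (\int[area]_(v in DD) (((1 - cabs (pt v)) `^ (- (1 / 2)))%:E * X v) <=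
   K%:E * \int[area]_(u in DD) (h u)%:E)%E.
Proof.
have [K K0 gap] := @integral_gap_cball R.
have K30 : 0 < K * 3 `^ (3 / 2) by rewrite mulr_gt0 ?powR_gt0.
exists (K * 3 `^ (3 / 2)) => // h mh h0 X.
have mDD := @measurable_DD R.
(* h is measurable and nonnegative on the disc; extension by zero allows Tonelli's theorem on the
   whole plane. *)
pose hD := h \_ DD.
have hDE u : hD u = h u * \1_DD u.
  by rewrite /hD patchE indicE; case: ifP => _; rewrite ?mulr1 ?mulr0.
have mhD : measurable_fun setT hD by apply/(measurable_restrictT h mDD).
have hD0 u : 0 <= hD u.
  rewrite hDE indicE; case: (boolP (u \in DD)) => [|_]; last by rewrite mulr0.
  by rewrite inE => /h0; rewrite mulr1.
pose a (v : RR) := (1 - cabs (pt v)) `^ (- (1 / 2)) * \1_DD v.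
pose b (u : RR) := hD u * (1 - cabs (pt u)) `^ (- (3 / 2)).
have ma : measurable_fun setT a.
  by apply: measurable_funM; [exact: measurable_gap_powR|exact: measurable_indic].
have mb : measurable_fun setT b.
  by apply: measurable_funM => //; exact: measurable_gap_powR.
have a0 v : 0 <= a v by rewrite mulr_ge0 ?powR_ge0 // indicE.
have b0 u : 0 <= b u by rewrite mulr_ge0 ?powR_ge0.
pose KK := [set zu : RR * RR | cabs (pt zu.1 - pt zu.2) <= 3 * (1 - cabs (pt zu.2))].
have mKK : measurable KK by exact: measurable_cone.
pose F (zu : RR * RR) := (a zu.1 * b zu.2 * \1_KK zu)%:E.
have mF : measurable_fun setT F.
  apply/measurable_EFinP; apply: measurable_funM; last exact: measurable_indic.
  apply: measurable_funM.
    exact: (measurableT_comp ma measurable_fst).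
  exact: (measurableT_comp mb measurable_snd).
have F0 zu : (0 <= F zu)%E.
  by rewrite lee_fin; apply: mulr_ge0; [exact: mulr_ge0|rewrite indicE].
have KKE v u : \1_KK (v, u) = \1_(cone (pt v)) u :> R.
  by rewrite !indicE; congr ((nat_of_bool _)%:R); apply/idP/idP; rewrite !inE.
have EX v : (((1 - cabs (pt v)) `^ (- (1 / 2)))%:E * X v * (\1_DD v)%:E = \int[area]_u F (v, u))%E.
  transitivity (\int[area]_u ((a v)%:E * (b u * \1_(cone (pt v)) u)%:E))%E; last first.
    by apply: eq_integral => u _; rewrite /F /= KKE -EFinM mulrA.
  rewrite ge0_integralZl_EFin //; last 2 first.
  - by move=> u _; rewrite lee_fin mulr_ge0 // indicE.
  - apply/measurable_EFinP; apply: measurable_funM => //.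
    by apply: measurable_indic; exact: measurable_cone_at.
  rewrite /a EFinM -[in RHS]muleA [in RHS](muleC (\1_DD v)%:E) muleA; congr (_ * _ * _)%E.
  rewrite /X integral_indicM; apply: eq_integral => u _; congr (_%:E).
  by rewrite /b hDE indicI /= ; ring.
have EY u : (\int[area]_v F (v, u) = (b u)%:E * \int[area]_(v in DD `&` cball (pt u) (3 * (1 - cabs (pt u)))) ((1 - cabs (pt v)) `^ (- (1 / 2)))%:E)%E.
  rewrite [in RHS]integral_indicM -ge0_integralZl_EFin //; last 2 first.
  - by move=> v _; rewrite lee_fin mulr_ge0 ?powR_ge0 // indicE.
  - apply/measurable_EFinP; apply: measurable_funM; first exact: measurable_gap_powR.
    apply: measurable_indic; apply: measurableI => //; exact: measurable_cball.
  apply: eq_integral => v _; rewrite /F /= -EFinM; congr (_%:E).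
  rewrite indicI /a /=.
  have -> : \1_KK (v, u) = \1_(cball (pt u) (3 * (1 - cabs (pt u)))) v :> R.
    by rewrite !indicE; congr ((nat_of_bool _)%:R); apply/idP/idP; rewrite !inE.
  by ring.
split.
  have := measurable_fun_fubini_tonelli_F (m2 := area) F mF F0.
  move=> /(measurable_funS measurableT (@subsetT _ DD)); apply: eq_measurable_fun => v.
  by rewrite inE => zD; rewrite /fubini_F -EX indicE mem_set // mule1.
have -> : (\int[area]_(v in DD) (((1 - cabs (pt v)) `^ (- (1 / 2)))%:E * X v) = \int[area]_v \int[area]_u F (v, u))%E.
  rewrite integral_mkcond; apply: eq_integral => v _; rewrite patchE -EX indicE.
  by case: ifP => _; rewrite ?mule1 ?mule0.
rewrite (fubini_tonelli F mF F0).
rewrite integral_indicM -ge0_integralZl_EFin //; last 3 first.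
- by move=> u _; rewrite -hDE lee_fin.
- by apply/measurable_EFinP; under eq_fun do rewrite -hDE; exact: mhD.
- exact: ltW.
apply: ge0_le_integral => //.
- by move=> u _; apply: integral_ge0 => v _; exact: F0.
- exact: (measurable_fun_fubini_tonelli_G (m1 := area) F mF F0).
- apply: measurable_funeM; apply/measurable_EFinP; under eq_fun do rewrite -hDE; exact: mhD.
move=> u _; rewrite EY -hDE; have [uD|uD] := pselect (DD u); last first.
  have -> : hD u = 0 by rewrite hDE indicE memNset // mulr0.
  by rewrite mule0 /b hDE indicE memNset // mulr0 mul0r mul0e.
have d0 : 0 < 1 - cabs (pt u) by rewrite subr_gt0.
apply: (@le_trans _ _ ((b u)%:E * (K * (3 * (1 - cabs (pt u))) `^ (3 / 2))%:E)%E).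
  rewrite lee_wpmul2l ?lee_fin //; apply: gap.
  by have := cabs_ge0 (pt u); lra.
rewrite -!EFinM lee_fin /b -mulrA powR_M3 ?(ltW K0) //.
by rewrite mulrC.
Qed.

(** With L = d(a), points where |1 - conj(a) z| is about 2^k L lie in the ball of radius 2^(k+1) L
    around a, because |z - a| <= |1 - conj(a) z|. Their contribution is at most 32 (2^k L)^(2 - m)
    <= 32 L^(2 - m) / 2^k, where m >= 3 is used. *)
Lemma integral_kernel (a : C) (m : R) : disc a -> 3 <= m ->
  (\int[area]_(xy in DD) ((cabs (1 - cj a * pt xy)) `^ (- m))%:E <=
    (64 * (1 - cabs a) `^ (2 - m))%:E)%E.
Proof.
move=> ad m3; set L := 1 - cabs a; have L0 : 0 < L by rewrite subr_gt0.
have -> : 64 * L `^ (2 - m) = 2 * (32 * L `^ (2 - m)) by rewrite mulrA -natrM.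
pose A k : set RR := DD `&` cball a (2 * (2 ^+ k * L)).
have mA k : measurable (A k) by apply: measurableI; [exact: measurable_DD|exact: measurable_cball].
have p2 k : 0 < 2 ^+ k :> R by rewrite exprn_gt0.
have gL xy : DD xy -> L <= cabs (1 - cj a * pt xy).
  rewrite /DD /disc /= => h; have := moebius_den (- a) (pt xy).
  have -> : 1 + cj (- a) * pt xy = 1 - cj a * pt xy.
    by apply: ceqP; rewrite ?creB ?cimB ?creD ?cimD !(creM, cimM) /= ?creN ?cimN; ring.
  rewrite cabsN /L; have := cabs_ge0 (pt xy); have := cabs_ge0 a; nra.
have ga xy : DD xy -> cabs (pt xy - a) <= cabs (1 - cj a * pt xy).
  rewrite /DD /disc /= => h; have := moebius_id (- a) (pt xy).
  have -> : 1 + cj (- a) * pt xy = 1 - cj a * pt xy.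
    by apply: ceqP; rewrite ?creB ?cimB ?creD ?cimD !(creM, cimM) /= ?creN ?cimN; ring.
  rewrite cabsN [- a + _]addrC => E.
  rewrite -(@ler_pXn2r _ 2) ?nnegrE ?cabs_ge0 // -subr_ge0 E.
  rewrite /disc /= in ad; have := cabs_ge0 (pt xy); have := cabs_ge0 a => *.
  by apply: mulr_ge0; nra.
apply: (@dyadic_bound _ _ A _ (fun k => (2 ^+ k * L) `^ (- m)) (fun k => 32 * (2 ^+ k * L) ^+ 2)) => //.
- exact: measurable_DD.
- apply: (measurableT_comp (measurable_powR (- m))).
  apply: (@measurable_analytic R (fun z => 1 - cj a * z)).
  apply: analyticB; first exact: analytic_cst.
  by apply: analyticM; [exact: analytic_cst|exact: analytic_id].
- by move=> xy _; exact: powR_ge0.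
- by move=> k; exact: powR_ge0.
- move=> k; apply: (le_trans (@area_cball R _ a (2 * (2 ^+ k * L)) _ (mA k) _)).
  + by rewrite !mulr_ge0 ?ltW.
  + by move=> xy [].
  + by rewrite lee_fin exprMn; lra.
- move=> k.
  have kL : 0 < 2 ^+ k * L by rewrite mulr_gt0.
  have -> : (2 ^+ k * L) `^ (- m) * (32 * (2 ^+ k * L) ^+ 2) = 32 * (2 ^+ k * L) `^ (2 - m).
    rewrite mulrCA; congr (_ * _); rewrite -(powR_mulrn 2 (ltW kL)) -powRD; last first.
      by apply/implyP => _; rewrite gt_eqF.
    by rewrite addrC.
  rewrite powRM ?(ltW L0) ?(ltW (p2 k)) // -mulrA ler_pM2l // mulrC ler_wpM2l ?powR_ge0 //.
  rewrite -powR_inv1 ?(ltW (p2 k)) // ler_powR //; last by lra.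
  by rewrite exprn_ege1 // ler1n.
- move=> xy xyD; set D := cabs _.
  have ex : exists k, D <= 2 * (2 ^+ k * L).
    have h0 : 0 <= D / L by rewrite divr_ge0 ?cabs_ge0 ?ltW.
    exists (Num.bound (D / L)); set n := Num.bound _.
    have : D / L <= 2 ^+ n.
      apply: le_trans (ltW (archi_boundP h0)) _; rewrite -/n -natrX ler_nat ltnW // ltn_expl //.
    rewrite ler_pdivrMr // => h; rewrite (le_trans h) // ler_peMl ?ler1n //.
    by rewrite mulr_ge0 // ltW.
  exists (ex_minn ex).
    by case: ex_minnP => k hk _; split => //; rewrite /cball /= (le_trans (ga _ xyD)).
  case: ex_minnP => k hk kmin; have kL : 0 < 2 ^+ k * L by rewrite mulr_gt0.
  have kD : 2 ^+ k * L <= D.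
    case: k hk kmin {kL} => [|k] hk kmin; first by rewrite expr0 mul1r; exact: gL.
    rewrite leNgt; apply/negP => /ltW h; have /kmin : D <= 2 * (2 ^+ k * L).
      by rewrite mulrA -exprS.
    by rewrite ltnn.
  rewrite !powRN lef_pV2 ?posrE ?powR_gt0 //; last exact: lt_le_trans kL kD.
  by rewrite ge0_ler_powR ?nnegrE ?(ltW kL) ?cabs_ge0 //; lra.
Qed.

End Cones.

(** * The integral estimate for iterated integration *)

Section MainEstimate.
Variable R : realType.
Local Notation C := R[i].
Implicit Types (f g : C -> C) (z w : C).

Local Notation RR := (measurableTypeR R * measurableTypeR R)%type.
Local Notation area := (@area R).
Local Notation DD := (@DD R).

Lemma is_derive_continuous (G : R -> R) (t l : R) : is_derive t 1 G l -> G s @[s --> t] --> G t.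
Proof.
move=> [dG _]; have : {for t, continuous G} by apply: differentiable_continuous; apply/derivable1_diffP.
by [].
Qed.

Lemma derive_le (G g P P' : R -> R) :
  (forall t : R, 0 <= t <= 1 -> is_derive t 1 G (g t)) ->
  (forall t : R, 0 <= t <= 1 -> is_derive t 1 P (P' t)) ->
  (forall t : R, 0 <= t <= 1 -> g t <= P' t) -> G 1 - G 0 <= P 1 - P 0.
Proof.
move=> dG dP gP.
have I (t : R) : t \in `]0, 1[ -> 0 <= t <= 1 by rewrite in_itv /= => /andP[/ltW -> /ltW ->].
have d (t : R) : t \in `]0, 1[ -> is_derive t 1 (P - G) (P' t - g t).
  by move=> /I t01; apply: is_deriveB; [exact: dP|exact: dG].
have c : {within `[0, 1], continuous (P - G)}.
  apply: within_cts => t t01; apply: cvgB; [exact: is_derive_continuous (dP t t01)|exact: is_derive_continuous (dG t t01)].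
have [s /I sI E] := MVT ltr01 d c.
have := gP s sI; move: E; rewrite subr0 mulr1 !fctE; lra.
Qed.

(** The real and imaginary parts of t -> [Iop H] (t z), with either sign, have derivative at most
    P'(t), so [derive_le] compares them with the explicit antiderivative P. *)
Lemma Iop_growth (H : C -> C) (z : C) (b N : R) : analytic H -> disc z -> 0 < b -> 0 <= N ->
  (forall t : R, 0 <= t <= 1 -> cabs (H (t%:C%C * z)) <= N * (1 - t * cabs z) `^ (- (b + 1))) ->
  cabs (Iop H z) <= 2 * N / b * (1 - cabs z) `^ (- b).
Proof.
move=> HH zd b0 N0 HN; have zd' := zd; rewrite /disc /= in zd'.
have z0 := cabs_ge0 z.
pose P (t : R) := N / b * (1 - t * cabs z) `^ (- b).
pose P' (t : R) := N * (1 - t * cabs z) `^ (- (b + 1)) * cabs z.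
have dP (t : R) : 0 <= t <= 1 -> is_derive t 1 P (P' t).
  move=> /andP[t0 t1]; have pos : 0 < 1 - t * cabs z by nra.
  have d1 : is_derive t 1 (fun t : R => 1 - t * cabs z) (- cabs z).
    have -> : - cabs z = 0 - cabs z *: 1 by rewrite sub0r /GRing.scale /= mulr1.
    have -> : (fun t : R => 1 - t * cabs z) = cst 1 - cabs z *: id.
      by apply/funext => s; rewrite !fctE /GRing.scale /= mulrC.
    exact: is_deriveB.
  have d2 := @is_derive1_comp R (fun y => y `^ (- b)) _ t _ _ (is_derive1_powR (- b) pos) d1.
  have -> : P = (N / b) *: ((fun y => y `^ (- b)) \o (fun t : R => 1 - t * cabs z)) by [].
  have -> : P' t = (N / b) *: (- b * (1 - t * cabs z) `^ (- b - 1) * - cabs z).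
    rewrite /P' /GRing.scale /= opprD; field; by rewrite gt_eqF.
  exact: is_deriveZ.
have P0 : 0 <= P 0 by rewrite mulr_ge0 ?divr_ge0 ?powR_ge0 // ltW.
have E0 (t : R) : (0 + t%:C%C * z)%R = t%:C%C * z by rewrite add0r.
have dI (t : R) : 0 <= t <= 1 ->
    is_derive t 1 (fun s : R => cre (Iop H (0 + s%:C%C * z))) (cre (H (t%:C%C * z) * z)) /\
    is_derive t 1 (fun s : R => cim (Iop H (0 + s%:C%C * z))) (cim (H (t%:C%C * z) * z)).
  move=> t01; rewrite -(E0 t); apply: is_derive_line; rewrite E0.
  by apply: Iop_has_cderiv => //; exact: disc_scale.
have bnd (t : R) : 0 <= t <= 1 -> cabs (H (t%:C%C * z) * z) <= P' t.
  by move=> t01; rewrite cabsM /P' ler_wpM2r // HN.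
have Iop0 : Iop H 0 = 0 by rewrite IopE mul0r.
have e1 : (0 + 1%:C%C * z)%R = z by rewrite E0 rmorph1 mul1r.
have e2 : (0 + 0%:C%C * z)%R = 0 by rewrite E0 rmorph0 mul0r.
have N_der (G : R -> R) (t g : R) : is_derive t 1 G g -> is_derive t 1 (- G) (- g) by move=> h; exact: is_deriveN.
have c1 : cre (Iop H z) <= P 1.
  have := derive_le (fun t ti => (dI t ti).1) dP (fun t ti => le_trans (le_trans (ler_norm _) (cre_le _)) (bnd t ti)).
  by rewrite e1 e2 Iop0 /=; lra.
have c2 : - cre (Iop H z) <= P 1.
  have := derive_le (fun t ti => N_der _ _ _ (dI t ti).1) dP (fun t ti => le_trans (le_trans (ler_norm _) (eq_ind_r (fun x => x <= _) (cre_le _) (normrN _))) (bnd t ti)).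
  by rewrite !fctE e1 e2 Iop0 /= oppr0; lra.
have c3 : cim (Iop H z) <= P 1.
  have := derive_le (fun t ti => (dI t ti).2) dP (fun t ti => le_trans (le_trans (ler_norm _) (cim_le _)) (bnd t ti)).
  by rewrite e1 e2 Iop0 /=; lra.
have c4 : - cim (Iop H z) <= P 1.
  have := derive_le (fun t ti => N_der _ _ _ (dI t ti).2) dP (fun t ti => le_trans (le_trans (ler_norm _) (eq_ind_r (fun x => x <= _) (cim_le _) (normrN _))) (bnd t ti)).
  by rewrite !fctE e1 e2 Iop0 /= oppr0; lra.
have -> : 2 * N / b * (1 - cabs z) `^ (- b) = P 1 + P 1 by rewrite /P mul1r; ring.
by rewrite (le_trans (cabs_le _)) // lerD // ler_norml; lra.
Qed.

(** Each integration lowers the exponent by 1 and costs a factor 2 / b with b >= e. The surplus e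
    keeps the exponent positive down to the last integration, so that no logarithm appears. *)
Lemma iter_Iop_growth (m : nat) (H : C -> C) (e N : R) z : analytic H -> 0 < e -> 0 <= N -> disc z ->
  (forall t : R, 0 <= t <= 1 -> cabs (H (t%:C%C * z)) <= N * (1 - t * cabs z) `^ (- (m%:R + e))) ->
  cabs (iter m (@Iop R) H z) <= (2 / e) ^+ m * N * (1 - cabs z) `^ (- e).
Proof.
move=> HH e0 N0 zd HN.
suff S j : (j <= m)%N -> forall t : R, 0 <= t <= 1 -> cabs (iter j (@Iop R) H (t%:C%C * z)) <=
    (2 / e) ^+ j * N * (1 - t * cabs z) `^ (- ((m - j)%:R + e)).
  have := S m (leqnn m) 1; rewrite ler01 lexx rmorph1 !mul1r subnn add0r; exact.
elim: j => [|j IH] jm t t01; first by rewrite expr0 mul1r subn0 HN.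
have {}IH := IH (ltnW jm).
have tzd : disc (t%:C%C * z) by exact: disc_scale.
have tz : cabs (t%:C%C * z) = t * cabs z.
  by case/andP: t01 => t0 _; rewrite cabsM cabs_real ger0_norm.
pose b : R := (m - j.+1)%:R + e.
have b0 : 0 < b by rewrite ltr_wpDl.
have be : e <= b by rewrite lerDr.
have bE : (m - j)%:R + e = b + 1 by rewrite /b -subnSK // -natr1; ring.
have NJ : 0 <= (2 / e) ^+ j * N by rewrite mulr_ge0 // exprn_ge0 // divr_ge0 // ltW.
have := @Iop_growth (iter j (@Iop R) H) (t%:C%C * z) b ((2 / e) ^+ j * N) (analytic_iter_Iop j HH) tzd b0 NJ.
rewrite tz => /(_ _)/le_trans; apply.
  move=> s s01; rewrite -bE mulrA -rmorphM mulrA; apply: IH.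
  case/andP: s01 => s0 s1; case/andP: t01 => t0 t1.
  by rewrite mulr_ge0 //= mulr_ile1.
rewrite ler_wpM2r ?powR_ge0 // exprS.
have -> : 2 / e * (2 / e) ^+ j * N = 2 * ((2 / e) ^+ j * N) * e^-1 by ring.
by apply: ler_wpM2l; [rewrite mulr_ge0|rewrite lef_pV2 ?posrE].
Qed.

Lemma powR_scale (k d e : R) : 0 < k -> 0 < d -> d `^ (- e) = k `^ e * (k * d) `^ (- e).
Proof.
move=> k0 d0; rewrite powRM ?(ltW k0) ?(ltW d0) // mulrA -powRD; last by apply/implyP => _; rewrite gt_eqF.
by rewrite subrr powRr0 mul1r.
Qed.

(* h plays the role of |f|^p. Weighting sup_t |H(t z)| (1 - t|z|)^(n + e) with q e = 1/2 bounds
   |I^n H (z)|^q by (1 - |z|)^(-1/2) times an integral over a cone with vertex z. *)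
Lemma main_estimate (q : R) (n : nat) : 0 < q -> exists2 K : R, 0 < K &
  forall (H : C -> C) (h : RR -> R) (A B : R), analytic H -> measurable_fun DD h ->
   (forall xy, DD xy -> 0 <= h xy) -> 0 <= A -> 0 <= B ->
   (forall w, disc w -> ((cabs (H w) `^ q * (1 - cabs w) `^ (n%:R * q + 1 / 2))%:E <=
      A%:E * ((1 - cabs w) `^ (- (3 / 2)))%:E * \int[area]_(u in Dball w ((1 - cabs w) / 2)) (h u)%:E + B%:E)%E) ->
   (\int[area]_(v in DD) (cabs (iter n (@Iop R) H (pt v)) `^ q)%:E <=
     K%:E * (A%:E * \int[area]_(u in DD) (h u)%:E + B%:E))%E.
Proof.
move=> q0; have [Kt Kt0 tonelli] := @tonelli_cone R; have [Kg Kg0 gap] := @integral_gap_cball R.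
pose e : R := 1 / (2 * q).
have e0 : 0 < e by rewrite divr_gt0 // mulr_gt0.
(* For |u - w| < d(w) / 2 one has d(u) <= 3/2 d(w), hence d(w)^(-3/2) <= c3 d(u)^(-3/2). *)
pose c3 : R := (3 / 2) `^ (3 / 2).
pose K1 : R := ((2 / e) ^+ n) `^ q.
pose K2 : R := c3 * Kt.
have c30 : 0 < c3 by rewrite powR_gt0 // divr_gt0.
have K10 : 0 < K1 by rewrite powR_gt0 // exprn_gt0 // divr_gt0.
have K20 : 0 < K2 by rewrite mulr_gt0.
exists (K1 * (K2 + Kg)); first by rewrite mulr_gt0 // addr_gt0.
move=> H h A B HH mh h0 A0 B0 hyp.
have mDD := @measurable_DD R.
have [mX tX] := tonelli h mh h0.
set X := (fun v : RR => (\int[area]_(u in DD `&` cone (pt v)) (h u * (1 - cabs (pt u)) `^ (- (3 / 2)))%:E)%E) in mX tX.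
have X0 v : (0 <= X v)%E.
  by apply: integral_ge0 => u [/h0 hu _]; rewrite lee_fin mulr_ge0 ?powR_ge0.
have point v : DD v -> ((cabs (iter n (@Iop R) H (pt v)) `^ q)%:E <=
    K1%:E * (c3%:E * A%:E * (((1 - cabs (pt v)) `^ (- (1 / 2)))%:E * X v) + B%:E * ((1 - cabs (pt v)) `^ (- (1 / 2)))%:E))%E.
  move=> vD; have vD' := vD; rewrite /DD /disc /= in vD'.
  set z := pt v in vD' *; have z0 := cabs_ge0 z.
  have d0 : 0 < 1 - cabs z by rewrite subr_gt0.
  have tN (t : R) : 0 <= t <= 1 -> ((cabs (H (t%:C%C * z)) `^ q * (1 - t * cabs z) `^ (n%:R * q + 1 / 2))%:E <=
       A%:E * (c3%:E * X v) + B%:E)%E.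
    move=> t01; have tzd := disc_scale vD t01; have := hyp _ tzd.
    have tz : cabs (t%:C%C * z) = t * cabs z.
      by case/andP: t01 => t0 _; rewrite cabsM cabs_real ger0_norm.
    rewrite tz => /le_trans; apply; rewrite leeD2r // -muleA lee_wpmul2l ?lee_fin //.
    case/andP: t01 => t0 t1.
    set w := t%:C%C * z in tzd tz *; set dw := 1 - t * cabs z.
    have dw0 : 0 < dw by rewrite /dw; clear -t0 t1 z0 vD'; nra.
    have wr : cabs w + dw / 2 <= 1 by rewrite tz /dw; clear -t0 t1 z0 vD'; nra.
    have sub : Dball w (dw / 2) `<=` DD `&` cone (pt v).
      move=> u uw; split; first exact: Dball_DD wr _ uw.
      rewrite /Dball /= in uw; rewrite /cone /= -/z.
      have h1 : cabs (z - w) <= (1 - t) * cabs z.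
        have -> : z - w = (1 - t)%:C%C * z by rewrite /w rmorphB rmorph1; ring.
        by rewrite cabsM cabs_real ger0_norm // subr_ge0.
      have h2 := cabs_triB z (pt u) w; rewrite (cabsBC w) in h2.
      have h3 := cabs_sub (pt u) w; rewrite tz in h3.
      rewrite /dw in uw; clear -uw h1 h2 h3 t0 t1 z0 vD'; nra.
    have mD := @measurable_Dball R w (dw / 2).
    have mhD : measurable_fun (Dball w (dw / 2)) (fun u => (h u)%:E).
      by apply/measurable_EFinP; apply: measurable_funS mh => //; exact: Dball_DD wr.
    rewrite -ge0_integralZl_EFin ?powR_ge0 //; last first.
      by move=> u /(Dball_DD wr) /h0; rewrite lee_fin.
    rewrite -ge0_integralZl_EFin ?(ltW c30) //; last 3 first.
    - by apply: measurableI => //; exact: measurable_cone_at.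
    - by move=> u [/h0 hu _]; rewrite lee_fin mulr_ge0 ?powR_ge0.
    - apply/measurable_EFinP; apply: measurable_funM.
        by apply: measurable_funS mh => // u [].
      by apply: measurable_funTS; exact: measurable_gap_powR.
    apply: (@le_trans _ _ (\int[area]_(u in Dball w (dw / 2)) (c3%:E * (h u * (1 - cabs (pt u)) `^ (- (3 / 2)))%:E))%E).
      apply: ge0_le_integral => //.
      - by move=> u /(Dball_DD wr) /h0 hu; rewrite -EFinM lee_fin mulr_ge0 ?powR_ge0.
      - exact: measurable_funeM.
      - apply: measurable_funeM; apply/measurable_EFinP; apply: measurable_funM.
          by apply: measurable_funS mh => //; exact: Dball_DD wr.
        by apply: measurable_funTS; exact: measurable_gap_powR.
      move=> u uw; have uD := Dball_DD wr uw; have hu := h0 _ uD.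
      rewrite -!EFinM lee_fin [c3 * _]mulrCA [_ * h u]mulrC ler_wpM2l //.
      have du : 0 < 1 - cabs (pt u) by rewrite subr_gt0.
      have le : 1 - cabs (pt u) <= 3 / 2 * dw.
        by rewrite /Dball /= in uw; have := cabs_sub w (pt u); rewrite (cabsBC w) tz /dw in uw *; clear -uw; lra.
      have dE : dw `^ (- (3 / 2)) = c3 * (3 / 2 * dw) `^ (- (3 / 2)).
        by apply: powR_scale => //; rewrite divr_gt0.
      rewrite dE ler_wpM2l ?(ltW c30) // !powRN lef_pV2 ?posrE ?powR_gt0 // ?mulr_gt0 ?divr_gt0 //.
      by rewrite ge0_ler_powR ?nnegrE ?divr_ge0 ?(ltW du) // mulr_ge0 ?divr_ge0 // ltW.
    apply: ge0_subset_integral => //.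
    - by apply: measurableI => //; exact: measurable_cone_at.
    - apply: measurable_funeM; apply/measurable_EFinP; apply: measurable_funM.
        by apply: measurable_funS mh => // u [].
      by apply: measurable_funTS; exact: measurable_gap_powR.
    - by move=> u [/h0 hu _]; rewrite -EFinM lee_fin !mulr_ge0 ?powR_ge0 // ltW.
  have -> : (c3%:E * A%:E * (((1 - cabs z) `^ (- (1 / 2)))%:E * X v) + B%:E * ((1 - cabs z) `^ (- (1 / 2)))%:E
     = ((1 - cabs z) `^ (- (1 / 2)))%:E * (A%:E * (c3%:E * X v) + B%:E))%E.
    rewrite [RHS]ge0_muleDr ?lee_fin // ?mule_ge0 ?lee_fin ?(ltW c30) //.
    congr (_ + _)%E; last by rewrite muleC.
    by rewrite muleCA (muleC c3%:E) -muleA.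
  rewrite muleA.
  have Y0 : (0 <= A%:E * (c3%:E * X v) + B%:E)%E.
    by rewrite adde_ge0 ?lee_fin // !mule_ge0 ?lee_fin // ltW.
  have dp : 0 < (1 - cabs z) `^ (- (1 / 2)) by rewrite powR_gt0.
  (* The cone integral may be infinite, and the pointwise estimate is then trivial. *)
  move: tN Y0; case: (_ + _)%E => [y| |] tN y0; last by [].
  - rewrite lee_fin in y0.
    have tN' (t : R) : 0 <= t <= 1 -> cabs (H (t%:C%C * z)) <= y `^ q^-1 * (1 - t * cabs z) `^ (- (n%:R + e)).
      move=> t01; have := tN t t01; rewrite lee_fin.
      have dt : 0 < 1 - t * cabs z by case/andP: t01 => t0 t1; clear -t0 t1 z0 vD'; nra.
      have -> : n%:R * q + 1 / 2 = (n%:R + e) * q by rewrite /e; field; rewrite gt_eqF.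
      rewrite powRrM -powRM ?powR_ge0 ?cabs_ge0 // => hh.
      have : (cabs (H (t%:C%C * z)) * (1 - t * cabs z) `^ (n%:R + e)) <= y `^ q^-1.
        have qi : 0 <= q^-1 by rewrite invr_ge0 ltW.
        have := ge0_ler_powR qi _ _ hh; rewrite !nnegrE powR_ge0 y0 => /(_ isT isT).
        by rewrite -powRrM divff ?gt_eqF // powRr1 // mulr_ge0 ?cabs_ge0 ?powR_ge0.
      by rewrite powRN -ler_pdivlMr ?powR_gt0.
    have yq : 0 <= y `^ q^-1 by exact: powR_ge0.
    have := iter_Iop_growth HH e0 yq vD tN'; rewrite -/z => G.
    rewrite -!EFinM lee_fin.
    have := ge0_ler_powR (ltW q0) _ _ G; rewrite !nnegrE cabs_ge0.
    have e2n : 0 <= (2 / e) ^+ n by apply/exprn_ge0/ltW/divr_gt0.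
    have e2y : 0 <= (2 / e) ^+ n * y `^ q^-1 by exact: mulr_ge0.
    rewrite (mulr_ge0 e2y) ?powR_ge0 // => /(_ isT isT)/le_trans; apply.
    rewrite (powRM _ e2y) ?powR_ge0 // powRM //.
    rewrite -!powRrM mulVf ?gt_eqF // powRr1 // -/K1.
    have -> : - e * q = - (1 / 2) by rewrite /e; field; rewrite gt_eqF.
    by rewrite mulrAC.
  - by rewrite gt0_muley ?leey // lte_fin mulr_gt0.
have mF : measurable_fun DD (fun v => (cabs (iter n (@Iop R) H (pt v)) `^ q)%:E).
  by apply/measurable_EFinP; apply: measurable_analytic_powR; exact: analytic_iter_Iop.
have mgap : measurable_fun DD (fun v : RR => ((1 - cabs (pt v)) `^ (- (1 / 2)))%:E).
  by apply/measurable_EFinP; apply: measurable_funTS; exact: measurable_gap_powR.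
have gap_int : (\int[area]_(v in DD) ((1 - cabs (pt v)) `^ (- (1 / 2)))%:E <= Kg%:E)%E.
  have := gap 0 1; rewrite powR1 mulr1 => /(_ _).
  have -> : DD `&` cball 0 1 = DD.
    by apply/setIidl => v; rewrite /DD /cball /disc /= subr0 => /ltW.
  by apply; rewrite ltr01 ler1n.
have mf1 : measurable_fun DD (fun v => c3%:E * A%:E * (((1 - cabs (pt v)) `^ (- (1 / 2)))%:E * X v))%E.
  exact: measurable_funeM.
have mf2 : measurable_fun DD (fun v : RR => B%:E * ((1 - cabs (pt v)) `^ (- (1 / 2)))%:E)%E.
  exact: measurable_funeM.
have p1 v : (0 <= c3%:E * A%:E * (((1 - cabs (pt v)) `^ (- (1 / 2)))%:E * X v))%E.
  by rewrite !mule_ge0 ?lee_fin ?powR_ge0 // ltW.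
have p2 (v : RR) : (0 <= B%:E * ((1 - cabs (pt v)) `^ (- (1 / 2)))%:E)%E.
  by rewrite mule_ge0 ?lee_fin ?powR_ge0.
apply: (@le_trans _ _ (\int[area]_(v in DD) (K1%:E * (c3%:E * A%:E * (((1 - cabs (pt v)) `^ (- (1 / 2)))%:E * X v) + B%:E * ((1 - cabs (pt v)) `^ (- (1 / 2)))%:E)))%E).
  apply: ge0_le_integral => //.
  - by move=> v _; rewrite lee_fin powR_ge0.
  - by apply: measurable_funeM; apply: emeasurable_funD.
rewrite ge0_integralZl_EFin //; last 3 first.
- by move=> v _; rewrite adde_ge0.
- exact: emeasurable_funD.
- exact: ltW.
rewrite ge0_integralD //.
rewrite ge0_integralZl //; last 2 first.
- by move=> v _; rewrite mule_ge0 ?lee_fin ?powR_ge0.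
- by rewrite -EFinM lee_fin mulr_ge0 // ltW.
rewrite ge0_integralZl_EFin //; last by move=> v _; rewrite lee_fin powR_ge0.
have hI0 : (0 <= \int[area]_(u in DD) (h u)%:E)%E by apply: integral_ge0 => u /h0; rewrite lee_fin.
rewrite (EFinM K1) -[X in (_ <= X)%E]muleA; apply: lee_wpmul2l; first by rewrite lee_fin ltW.
have AI0 : (0 <= A%:E * \int[area]_(u in DD) (h u)%:E)%E by rewrite mule_ge0 ?lee_fin.
have B0' : (0 <= B%:E)%E by rewrite lee_fin.
rewrite (ge0_muleDr (K2 + Kg)%:E AI0 B0'); apply: leeD.
  apply: (@le_trans _ _ (c3%:E * A%:E * (Kt%:E * \int[area]_(u in DD) (h u)%:E))%E).
    by rewrite lee_wpmul2l // -EFinM lee_fin mulr_ge0 // ltW.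
  rewrite !muleA -!EFinM lee_wpmul2r // lee_fin /K2.
  have -> : c3 * A * Kt = c3 * Kt * A by ring.
  by rewrite ler_wpM2r // lerDl ltW.
apply: (@le_trans _ _ (B%:E * Kg%:E)%E).
  by rewrite lee_wpmul2l // lee_fin.
by rewrite -!EFinM lee_fin mulrC ler_wpM2r // lerDr ltW.
Qed.

End MainEstimate.

(** * Sufficiency *)

Section Boundedness.
Variable R : realType.
Local Notation C := R[i].
Implicit Types (f g : C -> C) (z w : C).

Local Notation RR := (measurableTypeR R * measurableTypeR R)%type.
Local Notation area := (@area R).
Local Notation DD := (@DD R).

(** pi times the p-th power of the A^p norm, kept in the extended reals so that finiteness can be a
    conclusion. *)
Definition mass (p : R) (f : C -> C) : \bar R := (\int[area]_(v in DD) (cabs (f (pt v)) `^ p)%:E)%E.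

Lemma mass_ge0 p f : (0 <= mass p f)%E.
Proof. by apply: integral_ge0 => v _; rewrite lee_fin powR_ge0. Qed.

Lemma eq_mass p f g : (forall z, disc z -> f z = g z) -> mass p f = mass p g.
Proof. by move=> fg; apply: eq_integral => v; rewrite inE => /fg ->. Qed.

Lemma area_int_mass p f : area_int (fun z => cabs (f z) `^ p) = (mass p f * (pi^-1)%:E)%E.
Proof. exact: area_intE. Qed.

Lemma mass_fin p f : Bergman p f -> mass p f \is a fin_num.
Proof.
case=> _; rewrite area_int_mass ge0_fin_numE ?mass_ge0 //.
case: (mass p f) (mass_ge0 p f) => [r _ _|_|//]; first by rewrite ltry.
by rewrite gt0_mulye // lte_fin invr_gt0 pi_gt0.
Qed.

Lemma Bergman_mass p f : analytic f -> (mass p f < +oo)%E -> Bergman p f.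
Proof.
move=> H fm; split => //; rewrite area_int_mass.
have : mass p f \is a fin_num by rewrite ge0_fin_numE // mass_ge0.
by move=> /fineK <-; rewrite -EFinM ltry.
Qed.

Lemma fine_mass_ge0 p f : 0 <= fine (mass p f).
Proof. by rewrite fine_ge0 // mass_ge0. Qed.

Lemma BnormE p f : Bergman p f -> Bnorm p f = (fine (mass p f) / pi) `^ p^-1.
Proof. by move=> /mass_fin fm; rewrite /Bnorm area_int_mass fineM. Qed.

Lemma mass_Bnorm p f : 0 < p -> Bergman p f -> mass p f = (pi * Bnorm p f `^ p)%:E.
Proof.
move=> p0 Bf; rewrite BnormE // -powRrM mulVf ?gt_eqF // powRr1; last first.
  by rewrite divr_ge0 ?fine_mass_ge0 ?pi_ge0.
by rewrite mulrC divfK ?gt_eqF ?pi_gt0 // fineK // mass_fin.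
Qed.

Lemma Bnorm_ge0 p f : 0 <= Bnorm p f.
Proof. exact: powR_ge0. Qed.

Lemma Bnorm_le q f (E : R) : 0 < q -> analytic f -> 0 <= E -> (mass q f <= (pi * E `^ q)%:E)%E ->
  Bergman q f /\ Bnorm q f <= E.
Proof.
move=> q0 H E0 hm; have Bf : Bergman q f by apply: Bergman_mass => //; apply: le_lt_trans hm _; rewrite ltry.
split => //; move: hm; rewrite mass_Bnorm // lee_fin ler_pM2l ?pi_gt0 // => hm.
rewrite leNgt; apply/negP => /(gt0_ltr_powR q0); rewrite !nnegrE E0 Bnorm_ge0 => /(_ isT isT).
by rewrite ltNge hm.
Qed.

Lemma mass_Dball p f z : analytic f -> disc z ->
  (\int[area]_(xy in Dball z ((1 - cabs z) / 2)) (cabs (f (pt xy)) `^ p)%:E <= mass p f)%E.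
Proof.
move=> H; rewrite /disc /= => zd; apply: ge0_subset_integral.
- exact: measurable_Dball.
- exact: measurable_DD.
- by apply/measurable_EFinP; exact: measurable_analytic_powR.
- by move=> v _; rewrite lee_fin powR_ge0.
- by apply: Dball_DD; have := cabs_ge0 z; lra.
Qed.

Lemma derivn_mass (p : R) k : 0 < p -> exists2 K : R, 0 < K & forall f z, analytic f -> disc z ->
  ((cabs (cderivn k f z) `^ p * (1 - cabs z) `^ (k%:R * p + 2))%:E <= K%:E * mass p f)%E.
Proof.
move=> p0; have [K K0 bnd] := @derivn_bound R p k p0; exists K => // f z H zd.
apply: (le_trans (bnd f z H zd)); apply: lee_wpmul2l; first by rewrite lee_fin ltW.
exact: mass_Dball.
Qed.

(** Valid for every q > 0, convex or not: each of the n summands is at most (sum of the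
    x_k^q)^(1/q). *)
Lemma sum_powR n (x : 'I_n -> R) (q : R) : 0 < q -> (forall k, 0 <= x k) ->
  (\sum_(k < n) x k) `^ q <= n%:R `^ q * \sum_(k < n) x k `^ q.
Proof.
move=> q0 x0; set S := \sum_(k < n) x k `^ q.
have S0 : 0 <= S by apply: sumr_ge0 => k _; exact: powR_ge0.
have xS k : x k <= S `^ q^-1.
  have -> : x k = (x k `^ q) `^ q^-1 by rewrite -powRrM divff ?gt_eqF // powRr1.
  rewrite ge0_ler_powR ?nnegrE ?powR_ge0 ?invr_ge0 ?(ltW q0) //.
  by rewrite /S (bigD1 k) //= lerDl sumr_ge0 // => i _; exact: powR_ge0.
have -> : S = (S `^ q^-1) `^ q by rewrite -powRrM mulVf ?gt_eqF // powRr1.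
rewrite -powRM ?powR_ge0 // ge0_ler_powR ?nnegrE ?(ltW q0) ?sumr_ge0 ?mulr_ge0 ?powR_ge0 //.
by rewrite mulr_natl -[n in _ *+ n]card_ord -sumr_const ler_sum.
Qed.

Lemma powRM_div (a b p q : R) : 0 < p -> 0 <= a -> 0 <= b ->
  (a * b `^ p) `^ (q / p) = a `^ (q / p) * b `^ q.
Proof.
by move=> p0 a0 b0; rewrite powRM ?powR_ge0 // -powRrM mulrCA divff ?gt_eqF // mulr1.
Qed.

Lemma powR_pred (r s : R) : 0 <= r -> 0 < s -> r `^ s = r `^ (s - 1) * r.
Proof.
move=> r0 s0; rewrite -{3}(powRr1 r0) -powRD ?subrK //.
by apply/implyP; rewrite gt_eqF.
Qed.

(** [derivn_bound] raised to the power q / p: one factor of the local integral is kept, the others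
    are absorbed into E^(q/p - 1). *)
Lemma derivn_bound_pq (p q : R) k : 0 < p -> p <= q -> exists2 K : R, 0 < K &
  forall f (E : R) z, analytic f -> (mass p f <= E%:E)%E -> disc z ->
   ((cabs (cderivn k f z) `^ q * (1 - cabs z) `^ (k%:R * q + 2 * q / p))%:E <=
     (K * E `^ (q / p - 1))%:E *
     \int[area]_(xy in Dball z ((1 - cabs z) / 2)) (cabs (f (pt xy)) `^ p)%:E)%E.
Proof.
move=> p0 pq; have q0 : 0 < q by exact: lt_le_trans pq.
have [K0 K00 bnd] := @derivn_bound R p k p0.
exists (K0 `^ (q / p)); first by rewrite powR_gt0.
move=> f E z H fE zd; have := bnd f z H zd; have zd' := zd; rewrite /disc /= in zd'.
set d := 1 - cabs z; have d0 : 0 < d by rewrite subr_gt0.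
set I := (\int[area]_(xy in Dball z (d / 2)) _)%E.
have I0 : (0 <= I)%E by apply: integral_ge0 => xy _; rewrite lee_fin powR_ge0.
have IE : (I <= E%:E)%E by apply: le_trans fE; exact: mass_Dball.
case: I I0 IE => [r| |] //; rewrite !lee_fin => r0 rE.
rewrite ?lee_fin => h.
have qp0 : 0 < q / p by rewrite divr_gt0.
have qp1 : 0 <= q / p - 1 by rewrite subr_ge0 ler_pdivlMr // mul1r.
have -> : k%:R * q + 2 * q / p = (k%:R * p + 2) * (q / p) by field; rewrite gt_eqF.
have -> : cabs (cderivn k f z) `^ q = (cabs (cderivn k f z) `^ p) `^ (q / p).
  by rewrite -powRrM; congr (_ `^ _); field; rewrite gt_eqF.
rewrite [d `^ _]powRrM -powRM ?powR_ge0 //.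
have Kr0 : 0 <= K0 * r by rewrite mulr_ge0 // ltW.
have := ge0_ler_powR (ltW qp0) _ _ h; rewrite !nnegrE Kr0 (mulr_ge0 (powR_ge0 _ _) (powR_ge0 _ _)).
move=> /(_ isT isT) /le_trans; apply; rewrite powRM ?(ltW K00) // -mulrA ler_wpM2l ?powR_ge0 //.
by rewrite (powR_pred r0 qp0) ler_wpM2r // ge0_ler_powR ?nnegrE // (le_trans r0).
Qed.

(* S is empty in the proof of boundedness and a closed disc in the proof of compactness. *)
Lemma operator_bound (p q : R) n : 0 < p -> p <= q -> exists2 K : R, 0 < K &
  forall (g : 'I_n -> C -> C) f (E M B : R) (S : set C),
  (forall k, analytic (g k)) -> analytic f -> 0 <= M -> 0 <= B -> (mass p f <= E%:E)%E ->
  (forall w k, disc w -> ~ S w -> cabs (g k w) * (1 - cabs w) `^ (n%:R - k%:R - 2 / p + 2 / q) <= M) ->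
  (forall w, disc w -> S w -> cabs (\sum_(k < n) cderivn k f w * g k w) `^ q <= B) ->
  (mass q (Ig g f) <= (K * (M `^ q * E `^ (q / p) + B))%:E)%E.
Proof.
move=> p0 pq; have q0 : 0 < q by exact: lt_le_trans pq.
have [Kf Kf0 bnd] := fin_all_exists2 (fun k : 'I_n => @derivn_bound_pq p q k p0 pq).
have [Km Km0 main] := @main_estimate R q n q0.
pose K1 : R := n%:R `^ q * \sum_(k < n) Kf k.
have K10 : 0 <= K1 by rewrite mulr_ge0 ?powR_ge0 ?sumr_ge0 // => k _; exact: ltW.
exists (Km * (K1 + 1)); first by rewrite mulr_gt0 // ltr_wpDl.
move=> g f E M B S Hg H M0 B0 fE gM fB.
have E0 : 0 <= E by rewrite -lee_fin (le_trans (mass_ge0 p f)).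
set Hf := fun z => \sum_(k < n) cderivn k f z * g k z.
have HH : analytic Hf.
  by apply: analytic_sum => k; apply: analyticM => //; exact: analytic_cderivn.
pose X := E `^ (q / p - 1); have X0 : 0 <= X by exact: powR_ge0.
pose A := K1 * M `^ q * X.
have A0 : 0 <= A by rewrite (mulr_ge0 _ X0) ?(mulr_ge0 K10) ?powR_ge0.
have mf : measurable_fun DD (fun v : RR => cabs (f (pt v)) `^ p) by exact: measurable_analytic_powR.
apply: (@le_trans _ _ (Km%:E * (A%:E * mass p f + B%:E))%E).
  apply: main => //; first by move=> v _; exact: powR_ge0.
  move=> w wd; have wd' := wd; rewrite /disc /= in wd'.
  set d := 1 - cabs w; have d0 : 0 < d by rewrite subr_gt0.
  set I := (\int[area]_(u in Dball w (d / 2)) _)%E.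
  have I0 : (0 <= I)%E by apply: integral_ge0 => xy _; rewrite lee_fin powR_ge0.
  have AI0 : (0 <= A%:E * (d `^ (- (3 / 2)))%:E * I)%E by rewrite !mule_ge0 ?lee_fin ?powR_ge0.
  have [Sw|Sw] := pselect (S w).
    (* On S the term B suffices, because d <= 1 and the exponent of d is nonnegative. *)
    apply: (@le_trans _ _ B%:E); last by rewrite leeDr.
    rewrite lee_fin -[X in _ <= X]mulr1 ler_pM ?powR_ge0 //; first exact: fB.
    have nq : 0 <= n%:R * q + 1 / 2 by rewrite addr_ge0 ?divr_ge0 // mulr_ge0 // ltW.
    apply: (@le_trans _ _ (1 `^ (n%:R * q + 1 / 2))); last by rewrite powR1.
    rewrite ge0_ler_powR ?nnegrE ?(ltW d0) //.
    by rewrite /d gerBl cabs_ge0.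
  apply: (@le_trans _ _ (A%:E * (d `^ (- (3 / 2)))%:E * I)%E); last by rewrite leeDl.
  have term (k : 'I_n) : (((cabs (cderivn k f w) * cabs (g k w)) `^ q * d `^ (n%:R * q + 1 / 2))%:E <=
      (Kf k * (M `^ q * X * d `^ (- (3 / 2))))%:E * I)%E.
    have b := bnd k f E w H fE wd; rewrite -/d -/X -/I in b.
    have gk := gM w k wd Sw; rewrite -/d in gk.
    have gq : cabs (g k w) `^ q * d `^ ((n%:R - k%:R - 2 / p + 2 / q) * q) <= M `^ q.
      rewrite powRrM -powRM ?cabs_ge0 ?powR_ge0 // ge0_ler_powR ?nnegrE ?(ltW q0) //.
      by rewrite mulr_ge0 ?cabs_ge0 ?powR_ge0.
    (* The weights of |g_k|^q and of the k-th derivative have exponents adding up to n q + 2; the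
       remaining -3/2 is the power of d in the hypothesis of [main_estimate]. *)
    have -> : n%:R * q + 1 / 2 = (n%:R - k%:R - 2 / p + 2 / q) * q + (k%:R * q + 2 * q / p) + (- (3 / 2)).
      by field; rewrite !gt_eqF.
    set al := (n%:R - k%:R - 2 / p + 2 / q) * q in gq *; set be := k%:R * q + 2 * q / p in b *.
    clearbody al be.
    rewrite !powRD ?(gt_eqF d0) ?implybT // powRM ?cabs_ge0 //.
    set a := cabs (cderivn k f w) `^ q in b *; set c := cabs (g k w) `^ q in gq *.
    set y := d `^ be in b *; set e := d `^ al in gq *.
    set x := d `^ (- (3 / 2)).
    have x0 : 0 <= x by exact: powR_ge0.
    have -> : a * c * (e * y * x) = (c * e) * ((a * y) * x) by ring.
    apply: (@le_trans _ _ ((M `^ q * x)%:E * (a * y)%:E)%E).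
      have -> : ((M `^ q * x)%:E * (a * y)%:E = (M `^ q * (a * y * x))%:E)%E by rewrite -EFinM; congr EFin; ring.
      by rewrite lee_fin ler_wpM2r // (mulr_ge0 _ x0) // mulr_ge0 ?powR_ge0.
    have -> : Kf k * (M `^ q * X * x) = M `^ q * x * (Kf k * X) by ring.
    rewrite (EFinM (M `^ q * x)) -muleA; apply: lee_wpmul2l => //.
    by rewrite lee_fin mulr_ge0 ?powR_ge0.
  apply: (@le_trans _ _ (\sum_(k < n) ((n%:R `^ q * ((cabs (cderivn k f w) * cabs (g k w)) `^ q * d `^ (n%:R * q + 1 / 2)))%:E))%E).
    rewrite sumEFin lee_fin -mulr_sumr -mulr_suml mulrA ler_wpM2r ?powR_ge0 //.
    apply: le_trans (sum_powR q0 _); last by move=> k; rewrite mulr_ge0 ?cabs_ge0.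
    rewrite ge0_ler_powR ?nnegrE ?(ltW q0) ?cabs_ge0 //; last first.
      by apply: le_trans (cabs_sum _ _ _) _; apply: ler_sum => k _; rewrite cabsM.
    by apply: sumr_ge0 => k _; rewrite mulr_ge0 ?cabs_ge0.
  apply: (@le_trans _ _ (\sum_(k < n) ((n%:R `^ q * Kf k * (M `^ q * X * d `^ (- (3 / 2))))%:E * I))%E).
    apply: lee_sum => k _; rewrite EFinM -mulrA (EFinM (n%:R `^ q)) -muleA.
    by apply: lee_wpmul2l; [rewrite lee_fin powR_ge0|exact: term].
  rewrite -ge0_sume_distrl; last by move=> k _; rewrite lee_fin !mulr_ge0 ?powR_ge0 // ltW.
  rewrite sumEFin -mulr_suml -mulr_sumr -/K1 -EFinM.
  by rewrite (_ : A * d `^ (- (3 / 2)) = K1 * (M `^ q * X * d `^ (- (3 / 2)))) // /A; ring.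
have XE : X * E = E `^ (q / p).
  by rewrite (powR_pred E0) ?divr_gt0.
apply: (@le_trans _ _ (Km%:E * (A * E + B)%:E)%E).
  apply: lee_wpmul2l; first by rewrite lee_fin ltW.
  rewrite EFinD leeD2r // (EFinM A); apply: lee_wpmul2l => //; by rewrite lee_fin.
rewrite -EFinM lee_fin -mulrA ler_wpM2l ?(ltW Km0) // /A -[_ * X * E]mulrA XE.
have : 0 <= M `^ q * E `^ (q / p) by rewrite mulr_ge0 ?powR_ge0.
rewrite -mulrA; move: (_ * E `^ _) => Y Y0; nra.
Qed.

(** 1 - |z|^2 = (1 + |z|) (1 - |z|) with 1 <= 1 + |z| <= 2, and |al| serves both signs of the
    exponent. This translates between the weights of the Bloch-type spaces and the powers of 1 - |z|
    in the estimates. *)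
Lemma gap_powR z (al : R) : disc z ->
  (1 - cabs z) `^ al <= 2 `^ `|al| * (1 - cabs z ^+ 2) `^ al /\
  (1 - cabs z ^+ 2) `^ al <= 2 `^ `|al| * (1 - cabs z) `^ al.
Proof.
rewrite /disc /= => zd; have z0 := cabs_ge0 z.
have d0 : 0 < 1 - cabs z by rewrite subr_gt0.
have E : 1 - cabs z ^+ 2 = (1 + cabs z) * (1 - cabs z) by ring.
have c0 : 0 < 1 + cabs z by lra.
rewrite E powRM ?(ltW c0) ?(ltW d0) // !mulrA.
have D0 : 0 <= (1 - cabs z) `^ al by exact: powR_ge0.
have c1 : 1 <= 1 + cabs z by lra.
have T1 : 1 <= (1 + cabs z) `^ `|al|.
  by rewrite -[X in X <= _](powRr0 (1 + cabs z)) ler_powR // normr_ge0.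
have T2 : (1 + cabs z) `^ `|al| <= 2 `^ `|al| by rewrite ge0_ler_powR ?nnegrE //; lra.
have Ti : 0 < (1 + cabs z) `^ `|al| by rewrite powR_gt0.
split.
  rewrite -[X in X <= _]mul1r ler_wpM2r //; have [al0|al0] := lerP 0 al.
    by rewrite mulr_ege1 ?(le_trans T1 T2) //; move: T1; rewrite ger0_norm.
  have -> : (1 + cabs z) `^ al = ((1 + cabs z) `^ `|al|)^-1.
    by rewrite -powRN ltr0_norm // opprK.
  by rewrite ler_pdivlMr // mul1r.
rewrite ler_wpM2r //; have [al0|al0] := lerP 0 al.
  by move: T2; rewrite ger0_norm.
have -> : (1 + cabs z) `^ al = ((1 + cabs z) `^ `|al|)^-1.
  by rewrite -powRN ltr0_norm // opprK.
by rewrite (le_trans _ (le_trans T1 T2)) // invf_le1.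
Qed.

Lemma bloch_gap (al : R) f : bloch al f ->
  exists2 M : R, 0 <= M & forall z, disc z -> cabs (f z) * (1 - cabs z) `^ al <= M.
Proof.
case=> _ [M fM]; exists (2 `^ `|al| * `|M|); first by rewrite mulr_ge0 ?powR_ge0.
move=> z zd; have [h _] := gap_powR al zd.
apply: (@le_trans _ _ (2 `^ `|al| * (cabs (f z) * (1 - cabs z ^+ 2) `^ al))).
  by rewrite mulrCA ler_wpM2l ?cabs_ge0.
by rewrite ler_wpM2l ?powR_ge0 // (le_trans (fM z zd)) // ler_norm.
Qed.

Lemma gap_bloch (al M : R) f : analytic f ->
  (forall z, disc z -> cabs (f z) * (1 - cabs z) `^ al <= M) -> bloch al f.
Proof.
move=> H fM; split => //; exists (2 `^ `|al| * M) => z zd; have [_ h] := gap_powR al zd.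
apply: (@le_trans _ _ (2 `^ `|al| * (cabs (f z) * (1 - cabs z) `^ al))).
  by rewrite mulrCA ler_wpM2l ?cabs_ge0.
by rewrite ler_wpM2l ?powR_ge0 // fM.
Qed.

Lemma analytic_Ig n (g : 'I_n -> C -> C) f : (forall k, analytic (g k)) -> analytic f -> analytic (Ig g f).
Proof.
move=> Hg H; apply: analytic_iter_Iop; apply: analytic_sum => k.
by apply: analyticM => //; exact: analytic_cderivn.
Qed.

Lemma gap_bounded n (g : 'I_n -> C -> C) (p q M : R) : (forall k, analytic (g k)) -> 0 < p -> p <= q -> 0 <= M ->
  (forall w k, disc w -> cabs (g k w) * (1 - cabs w) `^ (n%:R - k%:R - 2 / p + 2 / q) <= M) ->
  bounded_op p q (Ig g).
Proof.
move=> Hg p0 pq M0 gM; have q0 : 0 < q by exact: lt_le_trans pq.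
have [K K0 bnd] := @operator_bound p q n p0 pq.
have pi0 := pi_gt0 R.
(* The masses are pi times the powers of the norms, so c0 solves K M^q (pi |f|^p)^(q/p) = pi c0
   |f|^q, with |f| the norm. *)
pose c0 := K * M `^ q * pi `^ (q / p) / pi.
have c00 : 0 <= c0 by rewrite divr_ge0 ?mulr_ge0 ?powR_ge0 // ltW.
exists (c0 `^ q^-1) => f Bf.
have Hf : analytic f by case: Bf.
apply: Bnorm_le => //; first exact: analytic_Ig.
  by rewrite mulr_ge0 ?powR_ge0.
have := bnd g f (pi * Bnorm p f `^ p) M 0 set0 Hg Hf M0 (lexx 0).
rewrite -mass_Bnorm // => /(_ (lexx _) _ _) h.
apply: le_trans (h _ _) _ => //; first by move=> w k wd _; exact: gM.
have -> : (c0 `^ q^-1 * Bnorm p f) `^ q = c0 * Bnorm p f `^ q.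
  by rewrite powRM ?powR_ge0 // -powRrM mulVf ?gt_eqF // powRr1.
have -> : (pi * Bnorm p f `^ p) `^ (q / p) = pi `^ (q / p) * Bnorm p f `^ q.
  by apply: powRM_div => //; [exact: ltW|exact: Bnorm_ge0].
rewrite lee_fin le_eqVlt; apply/orP; left; apply/eqP.
rewrite addr0 /c0.
by move: (pi `^ (q / p)) (pi : R) (lt0r_neq0 pi0) => X P P0; field.
Qed.

End Boundedness.

(** * Normal families and compactness *)

Section Compactness.
Variable R : realType.
Local Notation C := R[i].
Implicit Types (f g : C -> C) (z w : C).

Local Notation RR := (measurableTypeR R * measurableTypeR R)%type.
Local Notation area := (@area R).
Local Notation DD := (@DD R).

(** The limit is the supremum of the y with y <= x_j for U-almost all j. The upper bound for x_j
    holds because an ultrafilter contains a set or its complement. *)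
Lemma ultra_limit (U : set_system nat) (x : nat -> R) (M : R) : UltraFilter U ->
  (forall j, `|x j| <= M) -> exists l : R, forall e : R, 0 < e -> U [set j | `|x j - l| < e].
Proof.
move=> UU xM; have PU := @ultra_proper _ _ UU.
pose S := [set y | U [set j | y <= x j]].
have S0 : S !=set0.
  by exists (- M); apply: filterS filterT => j _ /=; have := xM j; rewrite ler_norml => /andP[].
have ubS y : S y -> y <= M.
  by move=> /filter_ex[j /= yx]; rewrite (le_trans yx) // (le_trans _ (xM j)) // ler_norm.
have supS : has_sup S by split => //; exists M => y; exact: ubS.
exists (sup S) => e e0; have [y Sy ye] := sup_adherent e0 supS.
have nS : ~ S (sup S + e).
  move=> h; have : sup S + e <= sup S by apply: ub_le_sup => //; case: supS.
  by rewrite gerDl leNgt e0.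
have [//|h] := in_ultra_setVsetC [set j | sup S + e <= x j] UU.
apply: filterS (filterI Sy h) => j [] /= yx /negP; rewrite -ltNge ltr_norml; lra.
Qed.

Lemma cultra_limit (U : set_system nat) (x : nat -> C) (M : R) : UltraFilter U ->
  (forall j, cabs (x j) <= M) -> exists l : C, forall e : R, 0 < e -> U [set j | cabs (x j - l) < e].
Proof.
move=> UU xM; have PU := @ultra_proper _ _ UU.
have [a ha] := ultra_limit UU (fun j => le_trans (cre_le (x j)) (xM j)).
have [b hb] := ultra_limit UU (fun j => le_trans (cim_le (x j)) (xM j)).
exists (a +i* b)%C => e e0; have e2 : 0 < e / 2 by rewrite divr_gt0.
apply: filterS (filterI (ha _ e2) (hb _ e2)) => j [] /= h1 h2.
by rewrite (le_lt_trans (cabs_le _)) // creB cimB /= (splitr e) ltrD.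
Qed.

Lemma equi_lipschitz (u : nat -> C -> C) (r : R) : (forall j, analytic (u j)) -> r < 1 ->
  (forall s : R, s < 1 -> exists M : R, forall j z, cabs z <= s -> cabs (u j z) <= M) ->
  exists2 L : R, 0 <= L & forall j z w, cabs z <= r ->
    cabs (w - z) < (1 - r) / 4 -> cabs (u j w - u j z) <= L * cabs (w - z).
Proof.
move=> Hu r1 bnd; have [|M uM] := bnd ((1 + r) / 2); first by lra.
(* r + 2 d = (1 + r) / 2: discs of radius d around points within d of z stay where M bounds the
   family. *)
pose d := (1 - r) / 4; have d0 : 0 < d by rewrite divr_gt0 // subr_gt0.
exists (2 * (8 * `|M| / d)); first by rewrite !mulr_ge0 ?invr_ge0 ?(ltW d0).
move=> j z w zr wz.
have zz : cabs (z - z) < d by rewrite subrr cabs0.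
have Hz (v : C) : cabs (v - z) < d -> hol (u j) v d.
  move=> vz; have := iffLR (analyticE _) (Hu j); apply: hol_sub; rewrite subr0.
  by have := cabs_sub v z; rewrite /d in vz *; lra.
apply: (@hol_lipschitz R (u j) z d) => //; first exact: Hz.
move=> v vz; apply: cauchy_deriv => //; first exact: Hz.
move=> x xv; rewrite (le_trans (uM j x _)) ?ler_norm //.
have := cabs_sub x v; have := cabs_sub v z; rewrite /d in vz xv; lra.
Qed.

(* The limit is taken along an ultrafilter; the subsequence is only extracted at the end. *)
Lemma montel (u : nat -> C -> C) : (forall j, analytic (u j)) ->
  (forall r : R, r < 1 -> exists M : R, forall j z, cabs z <= r -> cabs (u j z) <= M) ->
  exists (phi : nat -> nat) (h : C -> C), [/\ {homo phi : i j / (i < j)%N}, analytic h &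
    forall m w, cabs w <= 1 - m.+1%:R^-1 -> cabs (u (phi m) w - h w) <= m.+1%:R^-1].
Proof.
move=> Hu bnd; have [U [UU oU]] := @ultraFilterLemma nat \oo _.
have PU := @ultra_proper _ _ UU.
have lim z : exists l : C, disc z -> forall e : R, 0 < e -> U [set j | cabs (u j z - l) < e].
  have [zd|] := pselect (disc z); last by exists 0.
  have [M uM] := bnd _ zd; have [l hl] := cultra_limit UU (fun j => uM j z (lexx _)).
  by exists l.
have [h hh] := choice lim.
(* Pointwise limits along U are uniform on |w| <= r: the property passes to finite unions because U
   is a filter, so [closed_disc_cover] leaves only small discs, where the family is
   equi-Lipschitz. *)
have unif (r e : R) : r < 1 -> 0 < e -> U [set j | forall w, cabs w <= r -> cabs (u j w - h w) <= e].
  move=> r1 e0; have [r0|r0] := lerP 0 r; last first.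
    by apply: filterS filterT => j _ w wr; have := cabs_ge0 w; lra.
  have [L L0 lip] := equi_lipschitz Hu r1 bnd.
  apply: (@closed_disc_cover R (fun A => U [set j | forall w, A w -> cabs (u j w - h w) <= e])) => //.
  - move=> A B UA UB; apply: filterS (filterI UA UB) => j [] /= h1 h2 w [/h1|/h2] //.
  - by move=> A B AB; apply: filterS => j /= hB w /AB/hB.
  move=> z zr; have zd : disc z by exact: le_lt_trans zr r1.
  have e4 : 0 < e / 5 by rewrite divr_gt0.
  have Le : 0 < e / (5 * (L + 1)) by rewrite divr_gt0 // mulr_gt0 // ltr_wpDl.
  exists (Num.min ((1 - r) / 4) (e / (5 * (L + 1)))).
    by rewrite lt_min Le divr_gt0 // subr_gt0.
  have := hh z zd _ e4; apply: filterS => j /= hj w; rewrite lt_min => /andP[w1 w2].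
  have wd : disc w by rewrite /disc /=; have := cabs_sub w z; lra.
  have small i : cabs (u i w - u i z) <= e / 5.
    apply: le_trans (lip i z w zr w1) _.
    have L1 : L + 1 != 0 by rewrite gt_eqF // ltr_wpDl.
    have : (L + 1) * cabs (w - z) <= e / 5.
      have -> : e / 5 = (L + 1) * (e / (5 * (L + 1))) by field.
      by rewrite ler_wpM2l ?(ltW w2) // ltW // ltr_wpDl.
    by have := cabs_ge0 (w - z); nra.
  (* The difference is split into five terms through u_j(z), h(z), u_i(z) and u_i(w). The auxiliary
     index i, which depends on w, is there because h is not yet known to be continuous. *)
  have [i [/= h1 h2]] := filter_ex (filterI (hh z zd _ e4) (hh w wd _ e4)).
  have s1 := small j; have s2 := small i.
  have t1 := cabs_triB (u j w) (h w) (u j z); have t2 := cabs_triB (u j z) (h w) (h z).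
  have t3 := cabs_triB (h z) (h w) (u i z); have t4 := cabs_triB (u i z) (h w) (u i w).
  rewrite (cabsBC (h z) (u i z)) (cabsBC (u i z) (u i w)) in t3 t4; lra.
have Hh : analytic h.
  move=> a ad; have ad' := ad; rewrite /disc /= in ad'.
  have r0 : 0 < (1 - cabs a) / 2 by rewrite divr_gt0 // subr_gt0.
  apply: (weierstrass r0) => e e0.
  have [|j hj] := filter_ex (@unif ((1 + cabs a) / 2) e _ e0); first by lra.
  exists (u j).
    have := iffLR (analyticE _) (Hu j); apply: hol_sub; rewrite subr0; lra.
  by move=> w wa; apply: hj; have := cabs_sub w a; lra.
have step (Nm : nat * nat) : exists j, (Nm.1 < j)%N /\
    forall w, cabs w <= 1 - Nm.2.+1%:R^-1 -> cabs (u j w - h w) <= Nm.2.+1%:R^-1.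
  have r1 : 1 - Nm.2.+1%:R^-1 < 1 :> R by rewrite ltrBlDr ltrDl invr_gt0.
  have e0 : 0 < Nm.2.+1%:R^-1 :> R by rewrite invr_gt0.
  have UN : U [set j | (Nm.1 < j)%N] by apply: oU; exact: nbhs_infty_ge.
  by have [j [/= h1 h2]] := filter_ex (filterI UN (unif _ _ r1 e0)); exists j.
have [c hc] := choice step.
(* A diagonal choice: each index exceeds the previous one and is accurate to 1 / (m + 1) on |w| <= 1
   - 1 / (m + 1). *)
pose phi := fix phi m := if m is m'.+1 then c (phi m', m) else c (0, 0)%N.
exists phi, h; split => //.
  apply: homo_ltn => [y x z|i]; first exact: ltn_trans.
  by case: (hc (phi i, i.+1)).
by case=> [|m]; [case: (hc (0, 0)%N)|case: (hc (phi m, m.+1))].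
Qed.

Lemma powR_add_le (x y p : R) : 0 <= x -> 0 <= y -> 0 < p -> (x + y) `^ p <= 2 `^ p * (x `^ p + y `^ p).
Proof.
move=> x0 y0 p0; wlog xy : x y x0 y0 / x <= y.
  by move=> W; have [/W|/ltW/W] := lerP x y; [|rewrite (addrC y) (addrC (y `^ p))]; apply.
apply: (@le_trans _ _ ((2 * y) `^ p)).
  by rewrite ge0_ler_powR ?nnegrE ?(ltW p0) ?addr_ge0 ?mulr_ge0 //; lra.
by rewrite powRM // ler_wpM2l ?powR_ge0 // lerDr powR_ge0.
Qed.

Lemma area_DD : (area DD <= 8%:E)%E.
Proof.
have := @area_cball R DD 0 1 ler01 (@measurable_DD R); rewrite expr1n mulr1; apply.
by move=> v; rewrite /DD /cball /disc /= subr0 => /ltW.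
Qed.

Lemma massB (p : R) f g : 0 < p -> analytic f -> analytic g ->
  (mass p (fun z => f z - g z)%R <= (2 `^ p)%:E * (mass p f + mass p g))%E.
Proof.
move=> p0 Hf Hg; have m0 := @measurable_DD R.
have mf := iffRL (measurable_EFinP _ _) (measurable_analytic_powR p Hf).
have mg := iffRL (measurable_EFinP _ _) (measurable_analytic_powR p Hg).
have nonneg h (v : RR) : DD v -> (0 <= (cabs (h (pt v)) `^ p)%:E)%E by rewrite lee_fin powR_ge0.
rewrite -(ge0_integralD _ m0 (nonneg f) mf (nonneg g) mg).
have mfg := emeasurable_funD mf mg.
rewrite -(ge0_integralZl_EFin _ m0 _ mfg (powR_ge0 _ _)); last by move=> v vD; rewrite adde_ge0 ?nonneg.
apply: (ge0_le_integral _ m0 (nonneg (fun z => f z - g z))).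
- by apply/measurable_EFinP; apply: (@measurable_analytic_powR R (fun z => f z - g z)); exact: analyticB.
- exact: measurable_funeM.
move=> v _; rewrite -EFinD -EFinM lee_fin.
apply: le_trans (powR_add_le _ _ p0); rewrite ?cabs_ge0 //.
by rewrite ge0_ler_powR ?nnegrE ?(ltW p0) ?addr_ge0 ?cabs_ge0 ?cabsB.
Qed.

Lemma limn_einf_le (a : nat -> \bar R) (E : \bar R) : (forall m, a m <= E)%E -> (limn_einf a <= E)%E.
Proof.
move=> aE; rewrite limn_einf_lim; apply: lime_le; first exact: is_cvg_einfs.
apply: nearW => m; apply: le_trans (aE m); apply: ereal_inf_lbound.
by exists m => /=.
Qed.

Lemma limn_einf_ge (a : nat -> \bar R) (E : \bar R) N : (forall m, (N <= m)%N -> E <= a m)%E -> (E <= limn_einf a)%E.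
Proof.
move=> aE; rewrite limn_einf_lim; apply: lime_ge; first exact: is_cvg_einfs.
exists N => // m /= Nm; apply: le_ereal_inf_tmp => _ [k /= mk <-].
by apply: aE; exact: leq_trans mk.
Qed.

(** Fatou's lemma for 2^p (|u_m|^p + 1), which eventually dominates |h|^p at each point since |u_m -
    h| <= 1 there. The constant 8 bounds the area of the disc. *)
Lemma mass_limit (p E : R) (u : nat -> C -> C) h : 0 < p -> (forall m, analytic (u m)) -> analytic h ->
  (forall m, mass p (u m) <= E%:E)%E ->
  (forall w, disc w -> exists N, forall m, (N <= m)%N -> cabs (u m w - h w) <= 1) ->
  (mass p h <= (2 `^ p * (E + 8))%:E)%E.
Proof.
move=> p0 Hu Hh uE uh; have m0 := @measurable_DD R.
pose F m (v : RR) := ((2 `^ p)%:E * ((cabs (u m (pt v)) `^ p)%:E + 1%:E))%E.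
have mu m : measurable_fun DD (fun v : RR => (cabs (u m (pt v)) `^ p)%:E).
  by apply/measurable_EFinP; exact: measurable_analytic_powR.
have mF m : measurable_fun DD (F m) by apply: measurable_funeM; apply: emeasurable_funD.
have F0 m v : (0 <= F m v)%E by rewrite /F -EFinD -EFinM lee_fin mulr_ge0 ?addr_ge0 ?powR_ge0.
apply: (@le_trans _ _ (\int[area]_(v in DD) limn_einf (F^~ v))%E).
  apply: ge0_le_integral => //.
  - by move=> v _; rewrite lee_fin powR_ge0.
  - by apply/measurable_EFinP; exact: measurable_analytic_powR.
  - apply: (emeasurable_fun_cvg (fun k v => einfs (F^~ v) k)); first exact: measurable_fun_einfs.
    by move=> v _; rewrite limn_einf_lim; exact: is_cvg_einfs.
  move=> v /uh[N uN]; apply: (@limn_einf_ge _ _ N) => m /uN h1.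
  rewrite /F -EFinD -EFinM lee_fin.
  rewrite -[X in _ + X](_ : 1 `^ p = 1); last by rewrite powR1.
  apply: le_trans (powR_add_le _ _ p0); rewrite ?cabs_ge0 //.
  rewrite ge0_ler_powR ?nnegrE ?(ltW p0) ?addr_ge0 ?cabs_ge0 //.
  by have := cabs_sub (h (pt v)) (u m (pt v)); rewrite (cabsBC (h _)); lra.
apply: le_trans (fatou _ _ _ _) _ => //; apply: limn_einf_le => m.
rewrite ge0_integralZl_EFin ?powR_ge0 //; last 2 first.
- by move=> v _; rewrite -EFinD lee_fin addr_ge0 ?powR_ge0.
- exact: emeasurable_funD.
rewrite ge0_integralD //; last by move=> v _; rewrite lee_fin powR_ge0.
rewrite EFinM lee_wpmul2l ?lee_fin ?powR_ge0 // EFinD; apply: leeD; first exact: uE.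
by rewrite integral_cst // mul1e; exact: area_DD.
Qed.

Lemma eq_iter_Iop m f g z : (forall w, disc w -> f w = g w) -> disc z ->
  iter m (@Iop R) f z = iter m (@Iop R) g z.
Proof.
by move=> fg; elim: m z => [|m IH] z zd /=; [exact: fg|exact: eq_Iop].
Qed.

Lemma IgB n (g : 'I_n -> C -> C) f h z : (forall k, analytic (g k)) -> analytic f -> analytic h -> disc z ->
  Ig g (fun w => f w - h w) z = Ig g f z - Ig g h z.
Proof.
move=> Hg Hf Hh zd; have HH (v : C -> C) : analytic v -> analytic (fun w => \sum_(k < n) cderivn k v w * g k w).
  by move=> Hv; apply: analytic_sum => k; apply: analyticM => //; exact: analytic_cderivn.
rewrite /Ig; transitivity (iter n (@Iop R) (fun w => \sum_(k < n) cderivn k f w * g k w - \sum_(k < n) cderivn k h w * g k w) z).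
  2: by apply: iter_IopB => //; exact: HH.
apply: eq_iter_Iop => // w wd; rewrite -sumrB; apply: eq_bigr => k _.
by rewrite cderivnB // mulrBl.
Qed.

(** Locally uniform convergence to 0 on the disc. *)
Definition tends0 (f : nat -> C -> C) := forall r e : R, r < 1 -> 0 < e ->
  exists N, forall m, (N <= m)%N -> forall w, cabs w <= r -> cabs (f m w) <= e.

Lemma derivn_tends0 k (f : nat -> C -> C) : (forall m, analytic (f m)) -> tends0 f -> tends0 (fun m => cderivn k (f m)).
Proof.
move=> Hf f0 r e r1 e0; have [r0|r0] := lerP 0 r; last first.
  by exists 0%N => m _ w wr; have := cabs_ge0 w; lra.
have [K K0 cau] := @cauchy_derivn R k.
pose d := (1 - r) / 2; have d0 : 0 < d by rewrite divr_gt0 // subr_gt0.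
have dk : 0 < d ^+ k by rewrite exprn_gt0.
pose t := e * d ^+ k / (K + 1); have t0 : 0 < t by rewrite divr_gt0 ?mulr_gt0 // ltr_wpDl.
have [|N fN] := f0 (1 - d) t _ t0; first by lra.
exists N => m Nm w wr; apply: (@le_trans _ _ (K * t / d ^+ k)).
  apply: (cau (f m) w d t) => //; first by rewrite /d; lra.
    by move=> v vw; apply: fN => //; have := cabs_sub v w; rewrite /d in vw *; lra.
  by rewrite subrr cabs0 divr_gt0 // exprn_gt0.
rewrite ler_pdivrMr // /t mulrA ler_pdivrMr ?ltr_wpDl //.
have : 0 < e * d ^+ k by rewrite mulr_gt0.
by move: (e * _) => X X0; nra.
Qed.

Definition vanishing_gap n (g : 'I_n -> C -> C) (p q : R) := forall e : R, 0 < e ->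
  exists2 r : R, r < 1 & forall w k, disc w -> r < cabs w ->
    cabs (g k w) * (1 - cabs w) `^ (n%:R - k%:R - 2 / p + 2 / q) <= e.

Lemma sum_tends0 n (F : 'I_n -> nat -> C -> C) (g : 'I_n -> C -> C) : (forall k, analytic (g k)) ->
  (forall k, tends0 (F k)) -> tends0 (fun m w => \sum_(k < n) F k m w * g k w).
Proof.
move=> Hg F0 r e r1 e0.
have [M M0 gM] := fin_all_exists2 (fun k => analytic_bounded (Hg k) r1).
pose S := \sum_(k < n) M k + 1.
have S1 : 0 < S by rewrite ltr_wpDl // sumr_ge0.
have [N FN] := fin_all_exists (fun k => F0 k r (e / S) r1 (divr_gt0 e0 S1)).
exists (\max_(k < n) N k)%N => m Nm w wr.
apply: le_trans (cabs_sum _ _ _) _.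
apply: (@le_trans _ _ (\sum_(k < n) (e / S) * M k)).
  apply: ler_sum => k _; rewrite cabsM ler_pM ?cabs_ge0 //; last exact: gM.
  by apply: FN => //; apply: leq_trans Nm; exact: (leq_bigmax k).
by rewrite -mulr_sumr mulrAC ler_pdivrMr // ler_wpM2l ?(ltW e0) // lerDl ler01.
Qed.

Lemma Ig_tends0 n (g : 'I_n -> C -> C) (p q E : R) (f : nat -> C -> C) :
  0 < p -> p <= q -> (forall k, analytic (g k)) -> vanishing_gap g p q ->
  (forall m, analytic (f m)) -> (forall m, mass p (f m) <= E%:E)%E -> tends0 f ->
  forall c : R, 0 < c -> exists N, forall m, (N <= m)%N -> (mass q (Ig g (f m)) <= c%:E)%E.
Proof.
move=> p0 pq Hg gap Hf fE f0 c c0; have q0 : 0 < q by exact: lt_le_trans pq.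
have [K K0 bnd] := @operator_bound R p q n p0 pq.
pose X := E `^ (q / p); have X0 : 0 <= X by exact: powR_ge0.
(* [operator_bound] with M = e and B = t = e^q gives K (t X + t) = c. *)
pose t := c / (K * (X + 1)); have t0 : 0 < t by rewrite divr_gt0 // mulr_gt0 // ltr_wpDl.
pose e := t `^ q^-1; have e0 : 0 < e by rewrite powR_gt0.
have eq_t : e `^ q = t by rewrite /e -powRrM mulVf ?gt_eqF // powRr1 // ltW.
have [r r1 gr] := gap e e0.
have [N sN] := sum_tends0 Hg (fun k => derivn_tends0 k Hf f0) r1 e0.
exists N => m Nm.
have := bnd g (f m) E e t [set w | cabs w <= r] Hg (Hf m) (ltW e0) (ltW t0) (fE m).
move=> /(_ _ _)/le_trans; apply.
- by move=> w k wd /= /negP; rewrite -ltNge; exact: gr.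
- move=> w wd wr; rewrite -eq_t ge0_ler_powR ?nnegrE ?cabs_ge0 ?(ltW q0) ?(ltW e0) //.
  exact: sN.
rewrite lee_fin eq_t -/X le_eqVlt; apply/orP; left; apply/eqP.
have Kn := lt0r_neq0 K0; have Xn : X + 1 != 0 by rewrite lt0r_neq0 // ltr_wpDl.
by rewrite /t; field; rewrite ?Kn ?Xn.
Qed.

Lemma vanishing_gap_bounded n (g : 'I_n -> C -> C) (p q : R) : (forall k, analytic (g k)) -> vanishing_gap g p q ->
  exists2 M : R, 0 <= M & forall w k, disc w ->
    cabs (g k w) * (1 - cabs w) `^ (n%:R - k%:R - 2 / p + 2 / q) <= M.
Proof.
move=> Hg gap; have [r r1 gr] := gap 1 ltr01.
have [M M0 gM] := fin_all_exists2 (fun k => analytic_bounded (Hg k) r1).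
(* For |w| <= r the weight is at most 1 or at most its value at r, according to the sign of the
   exponent; the factor in the sum covers both. *)
pose S := \sum_(k < n) M k * (1 + (1 - r) `^ (n%:R - k%:R - 2 / p + 2 / q)).
have S0 (k : 'I_n) : 0 <= M k * (1 + (1 - r) `^ (n%:R - k%:R - 2 / p + 2 / q)).
  by rewrite mulr_ge0 ?addr_ge0 ?powR_ge0.
exists (1 + S); first by rewrite addr_ge0 ?sumr_ge0.
move=> w k wd; have [wr|wr] := ltrP r (cabs w).
  by rewrite (le_trans (gr w k wd wr)) // lerDl sumr_ge0.
apply: (@le_trans _ _ S); last by rewrite lerDr.
apply: (@le_trans _ _ (M k * (1 + (1 - r) `^ (n%:R - k%:R - 2 / p + 2 / q)))); last first.
  by rewrite /S (bigD1 k) //= lerDl sumr_ge0.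
rewrite ler_pM ?cabs_ge0 ?powR_ge0 ?gM //.
set al := (n%:R - _ - _ + _).
rewrite /disc /= in wd; have d0 : 0 < 1 - cabs w by rewrite subr_gt0.
have r0 : 0 < 1 - r by rewrite subr_gt0.
have w0 := cabs_ge0 w.
have [al0|al0] := lerP 0 al.
  have : (1 - cabs w) `^ al <= 1 `^ al by rewrite ge0_ler_powR ?nnegrE ?(ltW d0) //; lra.
  by rewrite powR1; have := powR_ge0 (1 - r) al; lra.
have : (1 - cabs w) `^ al <= (1 - r) `^ al.
  rewrite -[al]opprK !(powRN _ (- al)) lef_pV2 ?posrE ?powR_gt0 //.
  by rewrite ge0_ler_powR ?nnegrE ?oppr_ge0 ?(ltW al0) ?(ltW r0) ?(ltW d0) //; lra.
lra.
Qed.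

Lemma mass_locally_bounded (p E : R) : 0 < p -> forall r : R, r < 1 -> exists M : R,
  forall f z, analytic f -> (mass p f <= E%:E)%E -> cabs z <= r -> cabs (f z) <= M.
Proof.
move=> p0 r r1; have [K K0 bnd] := @derivn_mass R p 0 p0.
have r0 : 0 < 1 - r by rewrite subr_gt0.
exists ((K * E / (1 - r) ^+ 2) `^ p^-1) => f z H fE zr.
have zd : disc z by exact: le_lt_trans zr r1.
have E0 : 0 <= E by rewrite -lee_fin (le_trans (mass_ge0 p f)).
have h1 : cabs (f z) `^ p * (1 - cabs z) ^+ 2 <= K * E.
  have := bnd f z H zd; rewrite /= mul0r add0r (@powR_mulrn _ _ 2) ?subr_ge0 ?(ltW zd) // => h.
  rewrite -lee_fin (le_trans h) // EFinM; apply: lee_wpmul2l => //.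
  by rewrite lee_fin ltW.
have h2 : cabs (f z) `^ p <= K * E / (1 - r) ^+ 2.
  rewrite ler_pdivlMr ?exprn_gt0 // (le_trans _ h1) // ler_wpM2l ?powR_ge0 //.
  by rewrite ler_pXn2r ?nnegrE ?(ltW r0) //; move: zd; rewrite /disc /=; lra.
have pi0 : 0 <= p^-1 by rewrite invr_ge0 ltW.
have := ge0_ler_powR pi0 _ _ h2; rewrite !nnegrE powR_ge0 divr_ge0 ?exprn_ge0 ?(ltW r0) ?mulr_ge0 ?(ltW K0) //.
by rewrite -powRrM divff ?gt_eqF // powRr1 ?cabs_ge0 //; exact.
Qed.

(** By [mass_limit] the limit h of the subsequence lies in A^p, so the differences with h have
    bounded mass. [Ig_tends0] then makes the image of h the limit of the images. *)
Lemma gap_compact n (g : 'I_n -> C -> C) (p q : R) : (forall k, analytic (g k)) -> 0 < p -> p <= q ->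
  vanishing_gap g p q -> compact_op p q (Ig g).
Proof.
move=> Hg p0 pq gap; have q0 : 0 < q by exact: lt_le_trans pq.
have [M M0 gM] := vanishing_gap_bounded Hg gap.
have [c bT] := gap_bounded Hg p0 pq M0 gM.
split=> [f /bT[]//|u Bu [N uN]].
have Hu j : analytic (u j) by case: (Bu j).
pose E := pi * `|N| `^ p.
have uE j : (mass p (u j) <= E%:E)%E.
  rewrite mass_Bnorm // lee_fin ler_wpM2l ?pi_ge0 // ge0_ler_powR ?nnegrE ?(ltW p0) ?Bnorm_ge0 //.
  exact: le_trans (uN j) (ler_norm _).
clearbody E.
have [phi [h [hphi Hh uh]]] := montel Hu (fun r r1 =>
  let: ex_intro M hM := mass_locally_bounded E p0 r1 in ex_intro _ M (fun j z => hM _ z (Hu j) (uE j))).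
exists phi, (Ig g h).
have f0 : tends0 (fun m z => u (phi m) z - h z).
  move=> r e r1 e0; pose t := Num.min e (1 - r).
  have t0 : 0 < t by rewrite lt_min e0 subr_gt0.
  have ti : 0 <= t^-1 by rewrite invr_ge0 ltW.
  exists (Num.bound t^-1) => m Nm.
  have mt : m.+1%:R^-1 <= t.
    rewrite -[t]invrK lef_pV2 ?posrE ?invr_gt0 // ltW // (lt_le_trans (archi_boundP ti)) // ler_nat.
    exact: leq_trans Nm (leqnSn _).
  move: mt; rewrite le_min => /andP[me mr] w wr.
  have := uh m w; move: mr me; move: (m.+1%:R^-1 : R) => x mr me h1.
  by apply: le_trans (h1 _) me; lra.
have hE : (mass p h <= (2 `^ p * (E + 8))%:E)%E.
  apply: (mass_limit p0 (fun m => Hu (phi m)) Hh (fun m => uE (phi m))) => w wd.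
  by have [N0 hN0] := f0 (cabs w) 1 wd ltr01; exists N0 => m /hN0; apply.
have Bh : Bergman p h by apply: Bergman_mass => //; apply: le_lt_trans hE _; rewrite ltry.
split; [exact: hphi|split; [exact: (bT h Bh).1|]].
have fE m : (mass p (fun z => u (phi m) z - h z)%R <= (2 `^ p * (E + 2 `^ p * (E + 8)))%:E)%E.
  apply: le_trans (massB p0 _ Hh) _ => //.
  by rewrite EFinM lee_wpmul2l ?lee_fin ?powR_ge0 // EFinD leeD.
have Hf m : analytic (fun z => u (phi m) z - h z) by exact: analyticB.
have T0 := Ig_tends0 p0 pq Hg gap Hf fE f0.
apply/cvgrPdist_le => e e0.
have pe : 0 < pi * e `^ q :> R by rewrite mulr_gt0 ?pi_gt0 ?powR_gt0.
have [N0 TN] := T0 _ pe; exists N0 => // m /= /TN hm.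
rewrite sub0r normrN ger0_norm ?Bnorm_ge0 //.
have HT : analytic (fun z => Ig g (u (phi m)) z - Ig g h z) by apply: analyticB; exact: analytic_Ig.
apply: (Bnorm_le q0 HT (ltW e0) _).2; apply: le_trans hm.
by rewrite -(@eq_mass R q _ _ (fun z zd => IgB Hg (Hu (phi m)) Hh zd)).
Qed.

End Compactness.

(** * Necessity *)

Section TestFunctions.
Variable R : realType.
Local Notation C := R[i].
Implicit Types (f g : C -> C) (z w : C).

Local Notation RR := (measurableTypeR R * measurableTypeR R)%type.
Local Notation area := (@area R).
Local Notation DD := (@DD R).

Lemma cjN z : cj (- z) = - cj z.
Proof. by case: z. Qed.

Lemma den_ge (a z : C) : 1 - cabs a * cabs z <= cabs (1 - cj a * z).
Proof. by have := moebius_den (- a) z; rewrite cabsN cjN mulNr. Qed.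

Lemma den_gt0 (a z : C) : disc a -> disc z -> 0 < cabs (1 - cj a * z).
Proof.
rewrite /disc /= => ad zd; apply: lt_le_trans (den_ge a z).
by have := cabs_ge0 a; have := cabs_ge0 z; nra.
Qed.

Lemma num_le_den (a z : C) : disc a -> disc z -> cabs (z - a) <= cabs (1 - cj a * z).
Proof.
rewrite /disc /= => ad zd; have := moebius_id (- a) z; rewrite cabsN cjN mulNr (addrC (- a)) => E.
have a0 := cabs_ge0 a; have z0 := cabs_ge0 z.
have : 0 <= (1 - cabs a ^+ 2) * (1 - cabs z ^+ 2) by rewrite mulr_ge0 // subr_ge0 expr_le1 // ltW.
by rewrite -E subr_ge0 ler_pXn2r // nnegrE cabs_ge0.
Qed.

(* The j-th power of the disc automorphism vanishing at a, times a kernel function whose A^p norm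
   stays bounded as |a| -> 1. *)
Definition utest (p : R) (N j : nat) (a z : C) : C :=
  (z - a) ^+ j * (((1 - cabs a) `^ (N%:R - 2 / p))%:C%C * (1 - cj a * z)^-1 ^+ (j + N)).

Lemma analytic_ucofactor (c a : C) m : disc a -> analytic (fun z => c * (1 - cj a * z)^-1 ^+ m).
Proof.
move=> ad; apply: analyticM; first exact: analytic_cst.
apply: (@analyticX R (fun z => (1 - cj a * z)^-1)); apply: (@analyticV R (fun z => 1 - cj a * z)).
  apply: (@analyticB R (fun=> 1) (fun z => cj a * z)); first exact: analytic_cst.
  by apply: (@analyticM R (fun=> cj a) id); [exact: analytic_cst|exact: analytic_id].
by move=> z zd; rewrite -cabs_gt0 den_gt0.
Qed.

Lemma analytic_utest p N j a : disc a -> analytic (utest p N j a).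
Proof.
move=> ad; apply: (@analyticM R (fun z => (z - a) ^+ j)); last exact: analytic_ucofactor.
apply: (@analyticX R (fun z => z - a)); apply: (@analyticB R id (fun=> a)); first exact: analytic_id.
exact: analytic_cst.
Qed.

Lemma utest_le p N j (a z : C) : disc a -> disc z ->
  cabs (utest p N j a z) <= (1 - cabs a) `^ (N%:R - 2 / p) * (cabs (1 - cj a * z))^-1 ^+ N.
Proof.
move=> ad zd; have D0 := den_gt0 ad zd; have := num_le_den ad zd.
rewrite /utest !cabsM !cabsX cabsV cabs_real ger0_norm ?powR_ge0 // exprD.
set D := cabs (1 - _) in D0 *; set X := _ `^ _; set Y := cabs (z - a) => YD.
have -> : Y ^+ j * (X * (D^-1 ^+ j * D^-1 ^+ N)) = (Y / D) ^+ j * (X * D^-1 ^+ N) by rewrite expr_div_n exprVn; ring.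
rewrite ler_piMl ?mulr_ge0 ?powR_ge0 ?exprn_ge0 ?invr_ge0 ?(ltW D0) //.
rewrite exprn_ile1 ?divr_ge0 ?cabs_ge0 ?(ltW D0) //.
by rewrite ler_pdivrMr // mul1r.
Qed.

Lemma utest_bound p N j (a z : C) : 0 < p -> disc a -> disc z ->
  cabs (utest p N j a z) <= (1 - cabs a) `^ (- (2 / p)).
Proof.
move=> p0 ad zd; apply: le_trans (utest_le _ _ _ ad zd) _.
have d0 : 0 < 1 - cabs a by rewrite subr_gt0.
have D0 := den_gt0 ad zd.
have dD : 1 - cabs a <= cabs (1 - cj a * z).
  apply: le_trans (den_ge a z); move: zd; rewrite /disc /=; have := cabs_ge0 a; have := cabs_ge0 z; nra.
rewrite powRD; last by rewrite (gt_eqF d0) implybT.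
rewrite powR_mulrn ?(ltW d0) // mulrAC ler_piMl ?powR_ge0 //.
rewrite -exprMn exprn_ile1 ?mulr_ge0 ?invr_ge0 ?(ltW d0) ?(ltW D0) //.
by rewrite ler_pdivrMr // mul1r.
Qed.

(** The p-th power of the kernel is |1 - conj(a) z|^(-N p), with integral O(d(a)^(2 - N p)) by
    [integral_kernel]; the normalization contributes d(a)^(N p - 2). *)
Lemma mass_utest p N j (a : C) : 0 < p -> 3 <= N%:R * p -> disc a -> (mass p (utest p N j a) <= 64%:E)%E.
Proof.
move=> p0 Np ad; have d0 : 0 < 1 - cabs a by rewrite subr_gt0.
have mK : measurable_fun DD (fun v : RR => (cabs (1 - cj a * pt v)) `^ (- (N%:R * p))).
  have := @measurable_analytic_powR R (fun z => 1 * (1 - cj a * z)^-1 ^+ 1) (N%:R * p) (analytic_ucofactor 1 1 ad).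
  apply: eq_measurable_fun => v; rewrite inE => vd.
  by rewrite mul1r expr1 cabsV -[(cabs _)^-1]powR_inv1 ?cabs_ge0 // -powRrM mulN1r.
apply: (@le_trans _ _ (\int[area]_(v in DD) (((1 - cabs a) `^ (N%:R * p - 2))%:E * ((cabs (1 - cj a * pt v)) `^ (- (N%:R * p)))%:E))%E).
  apply: ge0_le_integral.
  - exact: measurable_DD.
  - by move=> v _; rewrite lee_fin powR_ge0.
  - by apply/measurable_EFinP; apply: measurable_analytic_powR; exact: analytic_utest.
  - by apply: measurable_funeM; apply/measurable_EFinP.
  move=> v vd; rewrite -EFinM lee_fin.
  have D0 := den_gt0 ad vd.
  have := ge0_ler_powR (ltW p0) _ _ (utest_le p N j ad vd).
  rewrite !nnegrE cabs_ge0 mulr_ge0 ?powR_ge0 ?exprn_ge0 ?invr_ge0 ?(ltW D0) // => /(_ isT isT)/le_trans; apply.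
  rewrite powRM ?powR_ge0 ?exprn_ge0 ?invr_ge0 ?(ltW D0) // -powRrM.
  have -> : (N%:R - 2 / p) * p = N%:R * p - 2 by field; rewrite gt_eqF.
  rewrite le_eqVlt; apply/orP; left; apply/eqP; congr (_ * _).
  by rewrite exprVn -powR_mulrn ?(ltW D0) // -powRN -powRrM; congr (_ `^ _); ring.
rewrite ge0_integralZl_EFin; last 4 first.
- exact: measurable_DD.
- by move=> v _; rewrite lee_fin powR_ge0.
- by apply/measurable_EFinP.
- exact: powR_ge0.
apply: (@le_trans _ _ (((1 - cabs a) `^ (N%:R * p - 2))%:E * (64 * (1 - cabs a) `^ (2 - N%:R * p))%:E)%E).
  apply: lee_wpmul2l; first by rewrite lee_fin powR_ge0.
  exact: integral_kernel.
rewrite -EFinM lee_fin mulrCA -powRD; last by rewrite (gt_eqF d0) implybT.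
by rewrite (_ : N%:R * p - 2 + (2 - N%:R * p) = 0) ?powRr0 ?mulr1 //; ring.
Qed.

Lemma derivn_utest_lt p N j k (a : C) : disc a -> (k < j)%N -> cderivn k (utest p N j a) a = 0.
Proof.
move=> ad kj; pose h z := ((1 - cabs a) `^ (N%:R - 2 / p))%:C%C * (1 - cj a * z)^-1 ^+ (j + N).
have Hh : analytic h by exact: analytic_ucofactor.
have [hk [_ _ E]] := @cderivn_factor R a h j k Hh (ltnW kj) ad.
by rewrite (E a ad) subrr expr0n subn_eq0 leqNgt kj /= mul0r.
Qed.

(** The j-th derivative at a is j! times the cofactor there. As j! >= 1 and |1 - conj(a) a| = 1 -
    |a|^2 <= 2 d(a), only powers of 2 are lost. *)
Lemma derivn_utest_eq p N j (a : C) : disc a ->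
  2 ^- (j + N) * (1 - cabs a) `^ (- (j%:R + 2 / p)) <= cabs (cderivn j (utest p N j a) a).
Proof.
move=> ad; pose h z := ((1 - cabs a) `^ (N%:R - 2 / p))%:C%C * (1 - cj a * z)^-1 ^+ (j + N).
have Hh : analytic h by exact: analytic_ucofactor.
have d0 : 0 < 1 - cabs a by rewrite subr_gt0.
have [hk [_ ha E]] := @cderivn_factor R a h j j Hh (leqnn j) ad.
rewrite (E a ad) subnn expr0 mul1r ha cabsM cabs_natr ffactnn /h.
rewrite cabsM cabs_real ger0_norm ?powR_ge0 // cabsX cabsV.
have D0 := den_gt0 ad ad.
have DE : cabs (1 - cj a * a) = 1 - cabs a ^+ 2.
  have a0 := cabs_ge0 a; rewrite mulrC mul_cj -[1](rmorph1 (real_complex R)) -rmorphB cabs_real ger0_norm //.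
  by rewrite subr_ge0 expr_le1 // ltW.
have D2 : cabs (1 - cj a * a) <= 2 * (1 - cabs a) by rewrite DE; have := cabs_ge0 a; nra.
have fj : 1 <= j`!%:R :> R by rewrite ler1n fact_gt0.
apply: (@le_trans _ _ ((1 - cabs a) `^ (N%:R - 2 / p) * (cabs (1 - cj a * a))^-1 ^+ (j + N))); last first.
  by rewrite ler_peMl // mulr_ge0 ?powR_ge0 // exprn_ge0 // invr_ge0 ltW.
have -> : - (j%:R + 2 / p) = (N%:R - 2 / p) - (j + N)%:R by rewrite natrD; ring.
rewrite powRD; last by rewrite (gt_eqF d0) implybT.
rewrite mulrCA ler_wpM2l ?powR_ge0 // powRN powR_mulrn ?(ltW d0) // -!exprVn -exprMn.
apply: lerXn2r; rewrite ?nnegrE ?mulr_ge0 ?invr_ge0 ?(ltW d0) ?(ltW D0) // -invfM.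
by rewrite lef_pV2 ?posrE // mulr_gt0.
Qed.

(** Cauchy's estimate on the disc of radius d(a) around a, where [utest_bound] gives d(a)^(-2/p).
    The constant is uniform in N and j. *)
Lemma derivn_utest_gt p k : 0 < p -> exists2 K : R, 0 <= K & forall N j (a : C), disc a ->
  cabs (cderivn k (utest p N j a) a) <= K * (1 - cabs a) `^ (- (k%:R + 2 / p)).
Proof.
move=> p0; have [K K0 cau] := @cauchy_derivn R k.
exists K => // N j a ad; have d0 : 0 < 1 - cabs a by rewrite subr_gt0.
have := cau (utest p N j a) a (1 - cabs a) ((1 - cabs a) `^ (- (2 / p))) (analytic_utest p N j ad) d0 _ _ a.
move=> /(_ _ _ _)/le_trans; apply.
- by lra.
- by move=> w wa; apply: utest_bound => //; rewrite /disc /=; have := cabs_sub w a; lra.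
- by rewrite subrr cabs0 divr_gt0 // exprn_gt0.
rewrite opprD powRD; last by rewrite (gt_eqF d0) implybT.
by rewrite (powRN _ k%:R) powR_mulrn ?(ltW d0) // -mulrA [X in _ * X]mulrC.
Qed.

Lemma cancel_le (c x D G V A : R) : x * V = 1 -> 0 <= G -> 0 <= V -> 0 <= A -> c * x <= D ->
  c * (G * A) <= D * G * (V * A).
Proof.
move=> xV G0 V0 A0 h; have -> : c * (G * A) = c * x * (G * (V * A)).
  have -> : c * x * (G * (V * A)) = c * (G * A) * (x * V) by ring.
  by rewrite xV mulr1.
by rewrite -[leRHS]mulrA ler_wpM2r // !mulr_ge0.
Qed.

Lemma cancel_ge (c x D G V A : R) : x * V = 1 -> 0 <= G -> 0 <= V -> 0 <= A -> D <= c * x ->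
  D * G * (V * A) <= c * (G * A).
Proof.
move=> xV G0 V0 A0; rewrite -lerN2 -mulNr => h.
by have := cancel_le xV G0 V0 A0 h; rewrite !mulNr lerN2.
Qed.

(** * Recovering the coefficients from the test functions *)

Section Coefficients.
Variables (n : nat) (p q : R).
Hypotheses (p0 : 0 < p) (q0 : 0 < q).

Definition gap_weight (g : 'I_n -> C -> C) (k : 'I_n) (a : C) : R :=
  cabs (g k a) * (1 - cabs a) `^ (n%:R - k%:R - 2 / p + 2 / q).

Lemma gap_weight_ge0 (g : 'I_n -> C -> C) k a : 0 <= gap_weight g k a.
Proof. by rewrite mulr_ge0 ?cabs_ge0 ?powR_ge0. Qed.

(** Stated for a single a and an arbitrary bound E on the image, so that it serves boundedness, with
    E fixed, and compactness, with E small for a near the boundary. *)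
Lemma gap_weight_step N : exists2 K : R, 0 <= K & forall (g : 'I_n -> C -> C) (a : C) (j : 'I_n) (E : R),
  (forall k, analytic (g k)) -> disc a -> 0 <= E ->
  (mass q (Ig g (utest p N j a)) <= (E `^ q)%:E)%E ->
  gap_weight g j a <= K * (E + \sum_(k < n | (j < k)%N) gap_weight g k a).
Proof.
have [K1 K10 bnd] := @derivn_mass R q n q0.
have [K2 K20 der] := fin_all_exists2 (fun k : 'I_n => @derivn_utest_gt p k p0).
pose S := K1 `^ q^-1 + \sum_(k < n) K2 k.
have S0 : 0 <= S by rewrite addr_ge0 ?powR_ge0 ?sumr_ge0.
exists (2 ^+ (n + N) * S); first by rewrite mulr_ge0 ?exprn_ge0.
move=> g a j E Hg ad E0 TE.
pose d := 1 - cabs a; have d0 : 0 < d by rewrite subr_gt0.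
pose u := utest p N j a; have Hu : analytic u by exact: analytic_utest.
pose H z := \sum_(k < n) cderivn k u z * g k z.
have HH : analytic H by apply: analytic_sum => k; apply: analyticM => //; exact: analytic_cderivn.
have H_le : cabs (H a) * d `^ (n%:R + 2 / q) <= K1 `^ q^-1 * E.
  have := bnd (Ig g u) a (analytic_Ig Hg Hu) ad; rewrite /Ig cderivn_iter_Iop // -/d => h.
  have {}h : cabs (H a) `^ q * d `^ (n%:R * q + 2) <= K1 * E `^ q.
    rewrite -lee_fin (le_trans h) // EFinM; apply: lee_wpmul2l => //.
    by rewrite lee_fin ltW.
  have qi : 0 <= q^-1 by rewrite invr_ge0 ltW.
  have := ge0_ler_powR qi _ _ h; rewrite !nnegrE !mulr_ge0 ?powR_ge0 ?(ltW K10) // => /(_ isT isT).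
  rewrite !powRM ?powR_ge0 ?(ltW K10) // -!powRrM divff ?gt_eqF // !powRr1 ?cabs_ge0 //.
  by rewrite (_ : (n%:R * q + 2) / q = n%:R + 2 / q) //; field; rewrite gt_eqF.
(* The weight given by [derivn_mass] at order n splits into d^(k + 2/p), which cancels the size of
   the k-th derivative of the test function, and the weight of g_k. *)
have split_w (k : 'I_n) : d `^ (n%:R + 2 / q) = d `^ (k%:R + 2 / p) * d `^ (n%:R - k%:R - 2 / p + 2 / q).
  rewrite -powRD; last by rewrite (gt_eqF d0) implybT.
  by congr (_ `^ _); ring.
have inv_w (k : 'I_n) : d `^ (- (k%:R + 2 / p)) * d `^ (k%:R + 2 / p) = 1.
  by rewrite -powRD ?addNr ?powRr0 // (gt_eqF d0) implybT.
pose w := d `^ (n%:R + 2 / q); have w0 : 0 <= w by exact: powR_ge0.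
have lower : 2 ^- (j + N) * gap_weight g j a <= cabs (cderivn j u a * g j a) * w.
  rewrite cabsM /w (split_w j) /gap_weight -/d.
  exact: cancel_le (inv_w j) (cabs_ge0 _) (powR_ge0 _ _) (powR_ge0 _ _) (derivn_utest_eq p N j ad).
have upper (k : 'I_n) : cabs (cderivn k u a * g k a) * w <= K2 k * gap_weight g k a.
  rewrite cabsM /w (split_w k) /gap_weight -/d.
  exact: cancel_ge (inv_w k) (cabs_ge0 _) (powR_ge0 _ _) (powR_ge0 _ _) (der k N j a ad).
have HE : H a = cderivn j u a * g j a + \sum_(k < n | (j < k)%N) cderivn k u a * g k a.
  rewrite /H (bigD1 j) //=; congr (_ + _); rewrite (bigID (fun k : 'I_n => (j < k)%N)) /=.
  rewrite [X in _ + X]big1 ?addr0; last first.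
    move=> k /andP[kj]; rewrite -leqNgt leq_eqVlt => /orP[/eqP/val_inj h|kj'].
      by rewrite h eqxx in kj.
    by rewrite derivn_utest_lt // mul0r.
  by apply: eq_bigl => k; case: ltngtP => [jk||jk]; rewrite ?andbT ?andbF //; apply/eqP => h; rewrite h ltnn in jk.
have tail : cabs (\sum_(k < n | (j < k)%N) cderivn k u a * g k a) * w <= (\sum_(k < n) K2 k) * \sum_(k < n | (j < k)%N) gap_weight g k a.
  apply: (@le_trans _ _ (\sum_(k < n | (j < k)%N) cabs (cderivn k u a * g k a) * w)).
    by rewrite -mulr_suml ler_wpM2r // cabs_sum.
  rewrite mulr_sumr; apply: ler_sum => k jk; apply: le_trans (upper k) _.
  by rewrite ler_wpM2r ?gap_weight_ge0 // (bigD1 k) //= lerDl sumr_ge0.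
pose W : R := \sum_(k < n | (j < k)%N) gap_weight g k a; rewrite -/W in tail *.
have W0 : 0 <= W by rewrite sumr_ge0 // => k _; exact: gap_weight_ge0.
have main : 2 ^- (j + N) * gap_weight g j a <= S * (E + W).
  apply: le_trans lower _.
  have -> : cderivn j u a * g j a = H a - \sum_(k < n | (j < k)%N) cderivn k u a * g k a by rewrite HE addrK.
  apply: le_trans (ler_wpM2r w0 (cabsB _ _)) _; rewrite mulrDl.
  apply: le_trans (lerD H_le tail) _; rewrite /S.
  have := powR_ge0 K1 q^-1; have : 0 <= \sum_(k < n) K2 k by rewrite sumr_ge0.
  move: (K1 `^ _) (\sum_(k < n) K2 k) => x y; nra.
(* Replacing j by n makes the constant uniform in j. *)
have jn : 2 ^+ (j + N) <= 2 ^+ (n + N) :> R.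
  by rewrite ler_eXn2l ?ltr1n // leq_add2r ltnW.
rewrite -mulrA; apply: (@le_trans _ _ (2 ^+ (j + N) * (S * (E + W)))); last first.
  by rewrite ler_wpM2r // mulr_ge0 // addr_ge0.
by rewrite -ler_pdivrMl ?exprn_gt0.
Qed.

Lemma descending_ind (P : 'I_n -> Prop) : (forall j : 'I_n, (forall k : 'I_n, (j < k)%N -> P k) -> P j) -> forall j, P j.
Proof.
move=> IH j; move: {2}(n - j)%N (leqnn (n - j)) => m; elim: m j => [|m Hm] j.
  by rewrite leqn0 subn_eq0 leqNgt ltn_ord.
by move=> jm; apply: IH => k jk; apply: Hm; rewrite -ltnS (leq_trans _ jm) // ltn_sub2l.
Qed.
End Coefficients.

(** * Bounded and compact operators on the test functions *)

Section Necessity.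
Variables (n : nat) (p q : R) (g : 'I_n -> C -> C).
Hypotheses (p0 : 0 < p) (q0 : 0 < q) (Hg : forall k, analytic (g k)).

(** N p >= 3 is the condition of [integral_kernel]; it also makes the exponent N - 2/p positive, so
    that the test functions tend to 0 as |a| tends to 1. *)
Let N := Num.bound (3 / p).
Let Np : 3 <= N%:R * p.
Proof. by rewrite -ler_pdivrMr // ltW // archi_boundP // divr_ge0 // ltW. Qed.

Lemma Bergman_utest j a : disc a -> Bergman p (utest p N j a) /\ Bnorm p (utest p N j a) <= (64 / pi) `^ p^-1.
Proof.
move=> ad; apply: Bnorm_le => //; first exact: analytic_utest.
  exact: powR_ge0.
rewrite -powRrM mulVf ?gt_eqF // powRr1 ?divr_ge0 ?pi_ge0 //.
rewrite mulrC divfK ?gt_eqF ?pi_gt0 //; exact: mass_utest.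
Qed.

Lemma bounded_gap : bounded_op p q (Ig g) -> forall k, exists2 M : R, 0 <= M & forall a, disc a -> gap_weight p q g k a <= M.
Proof.
move=> [c bT]; have [K K0 step] := @gap_weight_step n p q p0 q0 N.
apply: descending_ind => j IH.
(* Restated for every k, with a dummy bound when k <= j, so that [fin_all_exists2] can choose all
   bounds at once. *)
have {IH} IH (k : 'I_n) : exists2 M : R, 0 <= M & (j < k)%N -> forall a, disc a -> gap_weight p q g k a <= M.
  by have [/IH[M M0 h]|_] := boolP (j < k)%N; [exists M|exists 0].
have [M M0 gM] := fin_all_exists2 IH.
(* The factor pi^(1/q) converts the bound on the norm of the image into the bound E^q on its
   mass. *)
pose E := pi `^ q^-1 * (`|c| * (64 / pi) `^ p^-1).
have E0 : 0 <= E by rewrite !mulr_ge0 ?powR_ge0.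
have S0 : 0 <= \sum_(k < n) M k by rewrite sumr_ge0.
exists (K * (E + \sum_(k < n) M k)); first by rewrite mulr_ge0 // addr_ge0.
move=> a ad; apply: le_trans (step g a j E Hg ad E0 _) _.
  have [Bu nu] := Bergman_utest j ad; have [BT nT] := bT _ Bu.
  rewrite mass_Bnorm // lee_fin powRM ?mulr_ge0 ?powR_ge0 // -powRrM mulVf ?gt_eqF // powRr1 ?pi_ge0 //.
  rewrite ler_wpM2l ?pi_ge0 // ge0_ler_powR ?nnegrE ?Bnorm_ge0 ?mulr_ge0 ?powR_ge0 ?(ltW q0) //.
  apply: le_trans nT _; apply: (@le_trans _ _ (`|c| * Bnorm p (utest p N j a))).
    by rewrite ler_wpM2r ?Bnorm_ge0 // ler_norm.
  by rewrite ler_wpM2l.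
rewrite ler_wpM2l // lerD2l big_mkcond /=; apply: ler_sum => k _.
by case: ifP => [jk|_]; [exact: gM|exact: M0].
Qed.

Lemma Iop_tends0 (f : nat -> C -> C) : (forall m, analytic (f m)) -> tends0 f -> tends0 (fun m => Iop (f m)).
Proof.
move=> Hf f0 r e r1 e0; have e2 : 0 < e / 2 by rewrite divr_gt0.
have [N0 fN] := f0 r _ r1 e2; exists N0 => m Nm w wr.
have wd : disc w by exact: le_lt_trans wr r1.
have w0 := cabs_ge0 w.
have h : cabs (cint 0 1 (fun t => f m (t%:C%C * w))) <= 2 * (1 - 0) * (e / 2).
  apply: cint_bound; [exact: ler01|exact: icts_radial|move=> t /andP[t0 t1]].
  by apply: fN => //; rewrite cabsM cabs_real ger0_norm //; nra.
rewrite IopE cabsM; move: h; rewrite subr0 mulr1 mulrC divfK // => h.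
rewrite -[e]mul1r ler_pM ?cabs_ge0 //; first exact: ltW.
Qed.

Lemma Ig_tends0_pointwise (f : nat -> C -> C) : (forall m, analytic (f m)) -> tends0 f -> tends0 (fun m => Ig g (f m)).
Proof.
move=> Hf f0; rewrite /Ig.
have HH m : analytic (fun z => \sum_(k < n) cderivn k (f m) z * g k z).
  by apply: analytic_sum => k; apply: analyticM => //; exact: analytic_cderivn.
have H0 := sum_tends0 Hg (fun k : 'I_n => derivn_tends0 k Hf f0).
(* Only the number of integrations is generalized; n stays fixed in the sum and in the type of g. *)
elim: (n in iter n) => [|i IH]; first exact: H0.
apply: (@Iop_tends0 (fun m => iter i (@Iop R) (fun z => \sum_(k < n) cderivn k (f m) z * g k z))) => // m.
exact: analytic_iter_Iop.
Qed.

(** On |w| <= r the denominator |1 - conj(a) w| is at least 1 - r, while the normalization d(a)^(N -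
    2/p) tends to 0. *)
Lemma utest_tends0 j (a : nat -> C) : (forall m, disc (a m)) -> (forall m, 1 - cabs (a m) <= m.+1%:R^-1) ->
  tends0 (fun m => utest p N j (a m)).
Proof.
move=> ad am r e r1 e0; pose b := N%:R - 2 / p.
have b0 : 0 < b by rewrite subr_gt0 ltr_pdivrMr //; apply: lt_le_trans Np; rewrite ltr_nat.
have r0 : 0 < 1 - r by rewrite subr_gt0.
pose t := (e * (1 - r) ^+ N) `^ b^-1.
have er : 0 < e * (1 - r) ^+ N by rewrite mulr_gt0 // exprn_gt0.
have t0 : 0 < t by rewrite powR_gt0.
have ti : 0 <= t^-1 by rewrite invr_ge0 ltW.
exists (Num.bound t^-1) => m Nm w wr.
have wd : disc w by exact: le_lt_trans wr r1.
have mt : m.+1%:R^-1 <= t.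
  rewrite -[t]invrK lef_pV2 ?posrE ?invr_gt0 // ltW // (lt_le_trans (archi_boundP ti)) // ler_nat.
  exact: leq_trans Nm (leqnSn _).
have d0 : 0 < 1 - cabs (a m) by rewrite subr_gt0; exact: ad.
apply: le_trans (utest_le _ _ _ (ad m) wd) _; rewrite -/b.
have D0 := den_gt0 (ad m) wd.
have rD : 1 - r <= cabs (1 - cj (a m) * w).
  apply: le_trans (den_ge _ _); have := cabs_ge0 (a m); have := cabs_ge0 w.
  by have := ad m; rewrite /disc /=; nra.
rewrite exprVn ler_pdivrMr ?exprn_gt0 //.
apply: (@le_trans _ _ (e * (1 - r) ^+ N)); last first.
  rewrite ler_wpM2l ?(ltW e0) //; apply: lerXn2r; rewrite ?nnegrE ?(ltW r0) //; exact: ltW.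
have -> : e * (1 - r) ^+ N = t `^ b by rewrite /t -powRrM mulVf ?gt_eqF // powRr1 // ltW.
by rewrite ge0_ler_powR ?nnegrE ?(ltW b0) ?(ltW d0) ?(ltW t0) //; apply: le_trans (am m) mt.
Qed.

(** Norm convergence implies pointwise convergence, by [derivn_mass] with k = 0, so the norm limit h
    agrees with the locally uniform limit 0. *)
Lemma mass_vanish (F : nat -> C -> C) h : (forall m, Bergman q (F m)) -> Bergman q h -> tends0 F ->
  (fun m => Bnorm q (fun z => F m z - h z)) @ \oo --> (0 : R) ->
  forall e : R, 0 < e -> exists m, (mass q (F m) <= e%:E)%E.
Proof.
move=> BF Bh F0 cv.
have Hh : analytic h by case: Bh.
have HF m : analytic (F m) by case: (BF m).
have small (c : R) : 0 < c -> exists N0, forall m, (N0 <= m)%N -> (mass q (fun z => F m z - h z)%R <= c%:E)%E.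
  move=> c0; pose t := (c / pi) `^ q^-1.
  have cp : 0 < c / pi by rewrite divr_gt0 ?pi_gt0.
  have t0 : 0 < t by rewrite powR_gt0.
  have tq : t `^ q = c / pi by rewrite /t -powRrM mulVf ?gt_eqF // powRr1 // ltW.
  have /cvgrPdist_le/(_ _ t0)[N0 _ hN] := cv; exists N0 => m Nm.
  have := hN m Nm; rewrite sub0r normrN ger0_norm ?Bnorm_ge0 // => h1.
  have BFh : Bergman q (fun z => F m z - h z).
    apply: Bergman_mass; first exact: analyticB.
    apply: le_lt_trans (massB q0 (HF m) Hh) _.
    by rewrite (mass_Bnorm q0 (BF m)) (mass_Bnorm q0 Bh) -EFinD -EFinM ltry.
  rewrite mass_Bnorm // lee_fin mulrC -ler_pdivlMr ?pi_gt0 // -tq.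
  by rewrite ge0_ler_powR ?nnegrE ?Bnorm_ge0 ?(ltW q0) ?(ltW t0).
have h0 z : disc z -> h z = 0.
  move=> zd; apply/eqP; rewrite -cabs_eq0; apply/eqP/le_anti; rewrite cabs_ge0 andbT.
  apply/ler_addgt0Pr => e e0; rewrite add0r.
  have [K K0 bnd] := @derivn_mass R q 0 q0.
  have d0 : 0 < 1 - cabs z by rewrite subr_gt0.
  have e2 : 0 < e / 2 by rewrite divr_gt0.
  pose c := (e / 2) `^ q * (1 - cabs z) `^ (0%:R * q + 2) / K.
  have c0 : 0 < c by rewrite divr_gt0 // mulr_gt0 // powR_gt0.
  have [N1 h1] := small c c0; have [N2 h2] := F0 (cabs z) (e / 2) zd e2.
  pose m := maxn N1 N2.
  have b1 := h1 m (leq_maxl _ _); have b2 := h2 m (leq_maxr _ _) z (lexx _).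
  have b3 : cabs (F m z - h z) <= e / 2.
    have := bnd (fun z => F m z - h z) z (analyticB (HF m) Hh) zd => /=.
    have : (K%:E * mass q (fun z => F m z - h z)%R <= (K * c)%:E)%E.
      by rewrite EFinM; apply: lee_wpmul2l => //; rewrite lee_fin ltW.
    move=> x1 x2; have := le_trans x2 x1.
    have -> : K * c = (e / 2) `^ q * (1 - cabs z) `^ (0%:R * q + 2) by rewrite /c mulrC divfK // gt_eqF.
    rewrite lee_fin ler_pM2r ?powR_gt0 // => x3; rewrite leNgt; apply/negP => x4.
    have := gt0_ltr_powR q0 _ _ x4; rewrite !nnegrE cabs_ge0 (ltW e2) => /(_ isT isT).
    by rewrite ltNge x3.
  have := cabs_sub (h z) (F m z); rewrite (cabsBC (h z)); lra.
move=> e e0; have [N0 hN] := small e e0; exists N0.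
by rewrite -(@eq_mass R q (fun z => F N0 z - h z)) ?hN // => z zd; rewrite h0 // subr0.
Qed.

(** Otherwise there are points a_m with 1 - |a_m| <= 1 / (m + 1) whose images have mass above e.
    Some subsequence of the images converges in norm, while the test functions, hence their images,
    tend to 0 locally uniformly; this contradicts [mass_vanish]. *)
Lemma compact_utest j : compact_op p q (Ig g) -> forall e : R, 0 < e -> exists2 r : R, r < 1 &
  forall a, disc a -> r < cabs a -> (mass q (Ig g (utest p N j a)) <= e%:E)%E.
Proof.
move=> [bT cT] e e0; apply: contrapT => H.
have {H} bad (m : nat) : exists a, [/\ disc a, 1 - cabs a <= m.+1%:R^-1 & ~ (mass q (Ig g (utest p N j a)) <= e%:E)%E].
  apply: contrapT => h; apply: H; exists (1 - m.+1%:R^-1); first by rewrite ltrBlDr ltrDl invr_gt0.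
  move=> a ad ar; apply: contrapT => h'; apply: h; exists a; split => //.
  by move: ar; move: (m.+1%:R^-1 : R) => x; lra.
have [a ha] := choice bad.
have ad m : disc (a m) by case: (ha m).
have Bu m : Bergman p (utest p N j (a m)) by case: (Bergman_utest j (ad m)).
have [|phi [h [hphi [Bh cv]]]] := cT (fun m => utest p N j (a m)) Bu.
  by exists ((64 / pi) `^ p^-1) => m; case: (Bergman_utest j (ad m)).
have u0 : tends0 (fun m => utest p N j (a (phi m))).
  have t0 : tends0 (fun m => utest p N j (a m)) by apply: utest_tends0 => // m; case: (ha m).
  (* A strictly increasing phi satisfies m <= phi m. *)
  move=> r t r1 tp; have [N0 hN] := t0 r t r1 tp; exists N0 => m Nm; apply: hN.
  apply: leq_trans Nm _; elim: m => // m IH; apply: leq_ltn_trans IH _; exact: hphi.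
have T0 := @Ig_tends0_pointwise (fun m => utest p N j (a (phi m))) (fun m => analytic_utest p N j (ad (phi m))) u0.
have [m hm] := mass_vanish (fun m => bT _ (Bu (phi m))) Bh T0 cv e0.
by case: (ha (phi m)) => _ _; apply.
Qed.

Lemma compact_gap : compact_op p q (Ig g) -> forall k (e : R), 0 < e -> exists2 r : R, r < 1 &
  forall a, disc a -> r < cabs a -> gap_weight p q g k a <= e.
Proof.
move=> cT; have [K K0 step] := @gap_weight_step n p q p0 q0 N.
apply: descending_ind => j IH e e0.
(* Chosen so that K (t + n t) <= e, with K + 1 in place of K since K may be 0. *)
pose t := e / ((K + 1) * (n%:R + 1)).
have Kn : 0 < (K + 1) * (n%:R + 1) by rewrite mulr_gt0 // ltr_wpDl.
have t0 : 0 < t by rewrite divr_gt0.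
have {IH} IH (k : 'I_n) : exists2 r : R, r < 1 & (j < k)%N -> forall a, disc a -> r < cabs a -> gap_weight p q g k a <= t.
  have [/IH/(_ t t0)[r r1 h]|_] := boolP (j < k)%N; first by exists r.
  by exists 0.
have [r r1 gr] := fin_all_exists2 IH.
have tq : 0 < t `^ q by rewrite powR_gt0.
have [r0 r01 T0] := compact_utest j cT tq.
exists (\big[Num.max/r0]_(k < n) r k).
  by elim/big_ind: _ => // x y x1 y1; rewrite gt_max x1.
move=> a ad; have rmax (x : R) : x <= \big[Num.max/r0]_(k < n) r k -> \big[Num.max/r0]_(k < n) r k < cabs a -> x < cabs a.
  exact: le_lt_trans.
move=> ra; have ra0 : r0 < cabs a by apply: rmax ra; exact: bigmax_ge_id.
have rak k : r k < cabs a by apply: rmax ra; exact: le_bigmax.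
apply: le_trans (step g a j t Hg ad (ltW t0) (T0 a ad ra0)) _.
have : \sum_(k < n | (j < k)%N) gap_weight p q g k a <= n%:R * t.
  rewrite mulr_natl -[n in _ *+ n]card_ord -sumr_const big_mkcond /=; apply: ler_sum => k _.
  by case: ifP => [jk|_]; [exact: gr|exact: ltW].
move=> h; apply: (@le_trans _ _ (K * ((n%:R + 1) * t))).
  by rewrite ler_wpM2l // mulrDl mul1r addrC lerD2r.
have -> : e = (K + 1) * ((n%:R + 1) * t) by rewrite /t; field; rewrite !lt0r_neq0 ?ltr_wpDl.
by rewrite ler_wpM2r ?lerDl // mulr_ge0 ?(ltW t0) // addr_ge0.
Qed.
End Necessity.

End TestFunctions.

(** * Weights in 1 - |z|, Bloch-type spaces and vanishing coefficients *)

Section Weights.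
Variable R : realType.
Local Notation C := R[i].
Implicit Types (f g : C -> C) (z w : C).

Lemma little_bloch_gap (al e : R) f : little_bloch al f -> 0 < e -> exists2 r : R, r < 1 &
  forall z, disc z -> r < cabs z -> cabs (f z) * (1 - cabs z) `^ al <= e.
Proof.
case=> _ lb e0; have c0 : 0 < 2 `^ `|al| :> R by rewrite powR_gt0.
have [r r1 fr] := lb _ (divr_gt0 e0 c0); exists r => // z zd zr.
apply: (@le_trans _ _ (2 `^ `|al| * (cabs (f z) * (1 - cabs z ^+ 2) `^ al))).
  by rewrite mulrCA ler_wpM2l ?cabs_ge0 //; case: (gap_powR al zd).
by rewrite mulrC -ler_pdivlMr // ltW // fr.
Qed.

Lemma gap_little_bloch (al : R) f : analytic f ->
  (forall e : R, 0 < e -> exists2 r : R, r < 1 &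
    forall z, disc z -> r < cabs z -> cabs (f z) * (1 - cabs z) `^ al <= e) -> little_bloch al f.
Proof.
move=> H gf; split => // e e0; have c0 : 0 < 2 `^ `|al| :> R by rewrite powR_gt0.
have e2 : 0 < e / 2 by rewrite divr_gt0.
have [r r1 fr] := gf _ (divr_gt0 e2 c0); exists r => // z zd zr.
apply: (@le_lt_trans _ _ (2 `^ `|al| * (cabs (f z) * (1 - cabs z) `^ al))).
  by rewrite mulrCA ler_wpM2l ?cabs_ge0 //; case: (gap_powR al zd).
apply: (@le_lt_trans _ _ (e / 2)); last by rewrite ltr_pdivrMr // ltr_pMr // ltr1n.
by rewrite mulrC -ler_pdivlMr // fr.
Qed.

Lemma gap_neg_eq0 (al M : R) f : analytic f -> al < 0 ->
  (forall z, disc z -> cabs (f z) * (1 - cabs z) `^ al <= M) -> forall z, disc z -> f z = 0.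
Proof.
move=> H al0 fM; apply: boundary_vanish => // e e0.
(* d(z) <= t gives d(z)^(-al) <= e / (|M| + 1), hence |f(z)| <= M d(z)^(-al) <= e. *)
pose t := (e / (`|M| + 1)) `^ (- al)^-1.
have M1 : 0 < `|M| + 1 by rewrite ltr_wpDl.
have t0 : 0 < t by rewrite powR_gt0 // divr_gt0.
exists (1 - t); first by rewrite ltrBlDr ltrDl.
move=> z zd zt; have d0 : 0 < 1 - cabs z by rewrite subr_gt0.
have := fM z zd; rewrite -[al]opprK powRN ler_pdivrMr ?powR_gt0 // => /le_trans; apply.
have dt : (1 - cabs z) `^ (- al) <= e / (`|M| + 1).
  have -> : e / (`|M| + 1) = t `^ (- al).
    by rewrite /t -powRrM mulVf ?oppr_eq0 ?lt_eqF // powRr1 // divr_ge0 // ltW.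
  by rewrite ge0_ler_powR ?nnegrE ?oppr_ge0 ?(ltW al0) ?(ltW d0) ?(ltW t0) //; lra.
move: dt; rewrite ler_pdivlMr // mulrDr mulr1; have := ler_norm M; have := powR_ge0 (1 - cabs z) (- al).
by move: (_ `^ _) => x; nra.
Qed.

(** As d <= 1 and al <= 0, the weight is at least 1, so |f| itself is small near the boundary. *)
Lemma gap_nonpos_eq0 (al : R) f : analytic f -> al <= 0 ->
  (forall e : R, 0 < e -> exists2 r : R, r < 1 &
    forall z, disc z -> r < cabs z -> cabs (f z) * (1 - cabs z) `^ al <= e) -> forall z, disc z -> f z = 0.
Proof.
move=> H al0 gf; apply: boundary_vanish => // e e0; have [r r1 fr] := gf e e0.
exists r => // z zd zr; apply: le_trans (fr z zd zr).
have d0 : 0 < 1 - cabs z by rewrite subr_gt0.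
rewrite ler_peMr ?cabs_ge0 // -[X in X <= _](powRr0 (1 - cabs z)).
by apply: ger_powR => //; rewrite d0 gerBl cabs_ge0.
Qed.

Lemma vanishing_gapP n (g : 'I_n -> C -> C) (p q : R) :
  (forall (k : 'I_n) (e : R), 0 < e -> exists2 r : R, r < 1 & forall w, disc w -> r < cabs w ->
    cabs (g k w) * (1 - cabs w) `^ (n%:R - k%:R - 2 / p + 2 / q) <= e) -> vanishing_gap g p q.
Proof.
move=> h e e0; have [r r1 gr] := fin_all_exists2 (fun k => h k e e0).
exists (\big[Num.max/0]_(k < n) r k).
  by elim/big_ind: _ => // x y x1 y1; rewrite gt_max x1.
move=> w k wd wr; apply: gr => //; apply: le_lt_trans wr.
exact: le_bigmax.
Qed.

Lemma eq0_gap (g : C -> C) (al e : R) w : 0 <= e -> (forall z, disc z -> g z = 0) -> disc w ->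
  cabs (g w) * (1 - cabs w) `^ al <= e.
Proof. by move=> e0 h wd; rewrite h // cabs0 mul0r. Qed.

End Weights.

Theorem theorem1p3 (R : realType) (n : nat) (g : 'I_n -> R[i] -> R[i]) (p q : R) :
  (0 < n)%N -> (forall k, analytic (g k)) -> 0 < p -> p <= q ->
  (bounded_op p q (Ig g) <->
     forall k : 'I_n,
       (2 / p - 2 / q <= n%:R - k%:R -> bloch (n%:R - k%:R - 2 / p + 2 / q) (g k)) /\
       (n%:R - k%:R < 2 / p - 2 / q -> forall z, disc z -> g k z = 0))
  /\
  (compact_op p q (Ig g) <->
     forall k : 'I_n,
       (2 / p - 2 / q < n%:R - k%:R -> little_bloch (n%:R - k%:R - 2 / p + 2 / q) (g k)) /\
       (n%:R - k%:R <= 2 / p - 2 / q -> forall z, disc z -> g k z = 0)).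
Proof.
move=> _ Hg p0 pq; have q0 : 0 < q := lt_le_trans p0 pq.
split; split.
- move=> bT k; have [M M0 gM] := bounded_gap p0 q0 Hg bT k.
  split=> [_|al]; first exact: gap_bloch (Hg k) gM.
  by apply: gap_neg_eq0 (Hg k) _ gM; lra.
- move=> h.
  have bnd (k : 'I_n) : exists2 M : R, 0 <= M & forall w, disc w ->
      cabs (g k w) * (1 - cabs w) `^ (n%:R - k%:R - 2 / p + 2 / q) <= M.
    have [h1 h2] := h k; have [/h1/bloch_gap //|/h2 g0] := lerP (2 / p - 2 / q) (n%:R - k%:R).
    by exists 0 => // w; exact: eq0_gap.
  have [M M0 gM] := fin_all_exists2 bnd.
  apply: (gap_bounded (M := \sum_(k < n) M k)) => //; first exact: sumr_ge0.
  by move=> w k wd; rewrite (le_trans (gM k w wd)) // (bigD1 k) //= lerDl sumr_ge0.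
- move=> cT k; have gM := compact_gap p0 q0 Hg cT k.
  split=> [_|al]; first exact: gap_little_bloch (Hg k) gM.
  by apply: gap_nonpos_eq0 (Hg k) _ gM; lra.
- move=> h; apply: gap_compact => //; apply: vanishing_gapP => k e e0.
  have [h1 h2] := h k; have [/h2 g0|/h1 lb] := lerP (n%:R - k%:R) (2 / p - 2 / q).
    by exists 0 => // w wd _; apply: eq0_gap => //; exact: ltW.
  exact: little_bloch_gap.
Qed.
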